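(* Let $N\ge 1$ and let $F:\mathbb{C}^N\to\mathbb{C}^N$ be a regular polynomial map of degree $d\ge 1$, with leading homogeneous part $F_h$. Then for every bounded set $E\subset\mathbb{C}^N$, $$d_\infty(F^{-1}E)=|\operatorname{Res}(F_h)|^{-1/(Nd^N)}\, d_\infty(E)^{1/d}.$$
   Context: Regular maps: a polynomial map $F:\mathbb{C}^N\to\mathbb{C}^N$ is regular if it extends to a holomorphic endomorphism of $\mathbb{P}^N$; its coordinate functions then all have the same degree $d$, called the degree of $F$. Equivalently (for $d\ge1$), each component has degree $d$ and the leading homogeneous part $F_h$ (the $N$-tuple of degree-$d$ homogeneous parts of the components) satisfies $F_h^{-1}\{0\}=\{0\}$. Resultant: for an $N$-tuple $H=(H_1,\dots,H_N)$ of homogeneous polynomials of degree $d$ in $N$ variables, $\operatorname{Res}(H)$ is the multiresultant (Gelfand–Kapranov–Zelevinsky): the unique absolutely irreducible polynomial with integer coefficients in the coefficients of $H$ such that (i) $\operatorname{Res}(H)\ne0$ if and only if $H$ is regular (i.e. $H^{-1}\{0\}=\{0\}$), and (ii) $\operatorname{Res}(z_1^d,\dots,z_N^d)=1$. It is homogeneous of degree $d^{N-1}$ in the coefficients of each $H_i$. Transfinite diameter (Fekete–Leja): for $n\ge 1$ let $e_1,\dots,e_{M(n)}$ be the monomials in $N$ variables of degree $\le n$, where $M(n)=\binom{N+n}{N}$, and let $D(n)=N\binom{N+n}{N+1}$. For bounded $E\subset\mathbb{C}^N$ put $$d_n(E)=\Big(\sup_{\zeta_1,\dots,\zeta_{M(n)}\in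 E}|\det(e_i(\zeta_j))_{i,j}|\Big)^{1/D(n)},\qquad d_\infty(E)=\lim_{n\to\infty}d_n(E);$$ the limit exists (Zaharjuta). (A supremum over the empty set is taken to be $0$.) *)

(* Defs.v *)
From HB Require Import structures.
(* [mpoly] must be loaded before MathComp-Analysis (notation levels). *)
From mathcomp Require Import all_boot all_order all_algebra.
From mathcomp Require Import mpoly complex.
From mathcomp Require Import all_classical all_reals all_analysis.

Set Implicit Arguments.
Unset Strict Implicit.
Unset Printing Implicit Defensive.

Import Order.TTheory GRing.Theory Num.Theory.
Import numFieldNormedType.Exports.
Export numFieldNormedType.Exports.

Local Open Scope classical_set_scope.
Local Open Scope ring_scope.
Local Open Scope complex_scope.

(* C^N is ['rV[R[i]]_N]. *)

Definition polymap (K : comNzRingType) (N : nat) (F : 'I_N -> {mpoly K[N]})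
    (z : 'rV[K]_N) : 'rV[K]_N :=
  \row_i (F i).@[fun j => z ord0 j].

Definition leading_part (K : comNzRingType) (N d : nat)
    (F : 'I_N -> {mpoly K[N]}) (i : 'I_N) : {mpoly K[N]} :=
  pihomog mdeg d (F i).

Definition regular_forms (K : comNzRingType) (N : nat)
    (H : 'I_N -> {mpoly K[N]}) : Prop :=
  polymap H @^-1` [set 0] = [set 0].

(* [msize p] is the total degree of [p] plus one, and [msize 0 = 0]. For
   [0 < d] this is equivalent to the extension of [F] to a holomorphic
   endomorphism of P^N given by components of degree [d]. *)
Definition regular_map (K : comNzRingType) (N d : nat)
    (F : 'I_N -> {mpoly K[N]}) : Prop :=
  (forall i, msize (F i) = d.+1) /\ regular_forms (leading_part d F).

(* Index of the coefficients of an [N]-tuple of forms of degree [d] in [N]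
   variables: [(i, m)] stands for the coefficient of ['X_[m]] in the [i]-th
   form. *)
Definition coef_index (N d : nat) : finType :=
  ('I_N * {m : 'X_{1..N < d.+1} | mdeg m == d})%type.

Definition form_coefs (K : comNzRingType) (N d : nat)
    (H : 'I_N -> {mpoly K[N]}) (k : 'I_#|coef_index N d|) : K :=
  (H (enum_val k).1)@_(val (enum_val k).2).

Definition eval_at_forms (K : comNzRingType) (N d : nat)
    (P : {mpoly int[#|coef_index N d|]}) (H : 'I_N -> {mpoly K[N]}) : K :=
  (map_mpoly intr P).@[form_coefs H].

Definition irreducible_elt (A : idomainType) (p : A) : Prop :=
  [/\ p != 0, p \isn't a GRing.unit &
      forall q r : A, p = q * r -> q \is a GRing.unit \/ r \is a GRing.unit].

(* These properties characterize [P] uniquely. Absolute irreducibility is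
   irreducibility over the complex numbers. *)
Definition is_multiresultant (R : realType) (N d : nat)
    (P : {mpoly int[#|coef_index N d|]}) : Prop :=
  [/\ irreducible_elt (map_mpoly intr P : {mpoly R[i][#|coef_index N d|]}),
      forall H : 'I_N -> {mpoly R[i][N]}, (forall i, H i \is d.-homog) ->
        eval_at_forms P H != 0 <-> regular_forms H
    & eval_at_forms P (fun i : 'I_N => 'X_i ^+ d : {mpoly R[i][N]}) = 1].

Definition bounded_CN (R : realType) (N : nat) (E : set 'rV[R[i]]_N) : Prop :=
  exists M : R, forall z, E z -> forall i, Normc.normc (z ord0 i) <= M.

Definition monomial_det (K : comNzRingType) (N n : nat)
    (zeta : 'I_#|{: 'X_{1..N < n.+1}}| -> 'rV[K]_N) : K :=
  \det (\matrix_(i, j) ('X_[K, bmnm (enum_val i)]).@[fun k => zeta j ord0 k]).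

(* [sup set0 = 0]. The exponent is the inverse of the sum of the degrees of the
   monomials of degree at most [n]. *)
Definition fekete_diam (R : realType) (N n : nat) (E : set 'rV[R[i]]_N) : R :=
  sup [set x : R | exists2 zeta, (forall j, E (zeta j)) &
                     x = Normc.normc (@monomial_det R[i] N n zeta)]
    `^ (N * 'C(N + n, N.+1))%:R^-1.

(* The limit exists when [E] is bounded (Zaharjuta). *)
Definition transfinite_diam (R : realType) (N : nat)
    (E : set 'rV[R[i]]_N) : R :=
  limn (fun n => fekete_diam n E).

(* Main.v *)
Require Import Defs.
From HB Require Import structures.
From mathcomp Require Import all_boot all_order all_algebra all_fingroup all_field.
From mathcomp Require Import mpoly complex zify ring lra.
From mathcomp Require Import all_classical all_reals all_analysis.
From Stdlib Require Import Classical.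

Set Implicit Arguments.
Unset Strict Implicit.
Unset Printing Implicit Defensive.

Import Order.TTheory GRing.Theory Num.Theory.
Import numFieldNormedType.Exports.

Local Open Scope ring_scope.
Local Open Scope complex_scope.

(* Choose homogeneous [a_s], one for each monomial [z^s] with exponents below
   [d], so that the products [a_s H^b], with [H] the leading part of [F], form a
   basis of the homogeneous polynomials of each degree.

   The product of the determinants of these bases (in terms of monomials) up to
   degree [d n] is [|Res H|^c], with [c] equal to [d 'C(N + n, N + 1)] up to
   [O(n^N)], and up to a factor [exp O(n^N)]. This holds for [H = z^d], with
   [a_s = z^s], and is propagated to every [H] by changing one form of the system
   at a time: the determinant of multiplication by [H_i] modulo the other forms
   is a polynomial in [H_i] vanishing where the resultant does, so irreducibility
   of the resultant and a count of degrees identify the change with a quotient of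
   resultants (Poisson's formula).

   Since [a_s F^b] is unitriangular with respect to [a_s H^b], Vandermonde
   determinants of the preimage [Y] of [E] can be computed with either family. If
   [p_b] are monic polynomials with small sup norm on [E], then [a_s p_b(F)] gives
   an upper bound for the maximal Vandermonde determinant of [Y]. Evaluating
   [a_s F^b] at all points of the fibres over points of [E], the determinant
   factors as a Kronecker product, which gives the lower bound; the fibres where
   the [a_s] are not independent are avoided at negligible cost. All losses are
   [exp O(n^N log n)], negligible after taking roots of order [~ n^(N+1)]. The same
   monic polynomials show that the transfinite diameter is a limit. *)

(** The exponents come from counting degrees. The sum of degrees [D(n) = N 'C(N + n, N + 1)] grows
    like [N n^(N+1) / (N+1)!], so an exponent [d n^(N+1) / (N+1)!] of the resultant becomes
    [1 / (N d^N)] after division by [D(d n)]; its sign is negative because the Vandermonde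
    determinant of the preimage in the monomial basis is obtained by dividing by the basis
    determinants. A generic fibre has [d^N] points, so the determinant of [E] in degree [n] enters
    with exponent [d^N], and [d^N D(n) / D(d n)] tends to [1 / d].

    The obstacle is that the monomials [z^s] cannot serve as [a_s] in general: for the regular
    system [(z_1 z_2, z_1^2 + z_2^2)] the product [z_1 z_2] lies in the ideal. The [a_s] are
    therefore obtained by completing independent rows to an invertible matrix, and nothing is known
    of them beyond their degrees and the size of the determinants. An exchange of one form requires
    regularity before and after, which dictates a detour through a generic system between the powers
    and [H]. *)

(** * Determinants indexed by lists *)

(** Rows and columns are lists, so that blocks are concatenations and changes of index are maps. The
    matrix has size [size r]; when [size c = size r] the defaults [x1] and [x2] are never read. *)
Definition dt (K : comNzRingType) (T1 T2 : Type) (x1 : T1) (x2 : T2)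
    (r : seq T1) (c : seq T2) (M : T1 -> T2 -> K) : K :=
  \det (\matrix_(i < size r, j < size r) M (nth x1 r i) (nth x2 c j)).

Section ListDeterminant.

Variable K : comNzRingType.

Lemma dtE (T1 T2 : Type) (x1 : T1) (x2 : T2) n r c (M : T1 -> T2 -> K) :
  size r = n ->
  dt x1 x2 r c M = \det (\matrix_(i < n, j < n) M (nth x1 r i) (nth x2 c j)).
Proof. by move=> <-. Qed.

Lemma dt_nil (T1 T2 : Type) (x1 : T1) (x2 : T2) c (M : T1 -> T2 -> K) :
  dt x1 x2 [::] c M = 1.
Proof. by rewrite /dt det_mx00. Qed.

Lemma dt_tr (T1 T2 : Type) (x1 : T1) (x2 : T2) r c (M : T1 -> T2 -> K) :
  size r = size c -> dt x1 x2 r c M = dt x2 x1 c r (fun y x => M x y).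
Proof.
move=> src; rewrite (dtE x1 x2 c M src) /dt -det_tr; congr (\det _).
by apply/matrixP => i j; rewrite !mxE.
Qed.

Lemma eq_dt_in (T1 T2 : eqType) (x1 x1' : T1) (x2 x2' : T2) r c
    (M M' : T1 -> T2 -> K) : size r = size c ->
  {in r & c, forall x y, M x y = M' x y} ->
  dt x1 x2 r c M = dt x1' x2' r c M'.
Proof.
move=> src eqM; congr (\det _); apply/matrixP => i j; rewrite !mxE.
have jc : (j < size c)%N by rewrite -src.
by rewrite (set_nth_default x1') // (set_nth_default x2') // eqM ?mem_nth.
Qed.

Lemma dt_map (T1 T2 S1 S2 : Type) (x1 : T1) (x2 : T2) (y1 : S1) (y2 : S2)
    (f : S1 -> T1) (g : S2 -> T2) r c (M : T1 -> T2 -> K) : size r = size c ->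
  dt x1 x2 (map f r) (map g c) M = dt y1 y2 r c (fun x y => M (f x) (g y)).
Proof.
move=> src; rewrite (dtE _ _ _ _ (size_map f r)); congr (\det _).
apply/matrixP => i j; rewrite !mxE (nth_map y1) // (nth_map y2) //.
by rewrite -src.
Qed.

Lemma dt_mul (T1 T2 : eqType) (T3 : Type) (x1 : T1) (x2 : T2) (x3 : T3) r t c
    (A : T1 -> T3 -> K) (B : T3 -> T2 -> K) : size r = size t ->
  dt x1 x2 r c (fun x y => \sum_(z <- t) A x z * B z y) =
  dt x1 x3 r t A * dt x3 x2 t c B.
Proof.
move=> srt; rewrite (dtE x3 x2 c B (esym srt)) /dt -det_mulmx; congr (\det _).
apply/matrixP => i j; rewrite !mxE (big_nth x3) -srt big_mkord.
by apply: eq_bigr => k _; rewrite !mxE.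
Qed.

Lemma dt_cat (T1 T2 : eqType) (x1 : T1) (x2 : T2) r1 r2 c1 c2
    (M : T1 -> T2 -> K) : size r1 = size c1 -> size r2 = size c2 ->
  {in r1 & c2, forall x y, M x y = 0} ->
  dt x1 x2 (r1 ++ r2) (c1 ++ c2) M = dt x1 x2 r1 c1 M * dt x1 x2 r2 c2 M.
Proof.
move=> s1 s2 M0; rewrite (dtE _ _ _ _ (size_cat r1 r2)).
set A := (X in \det X); rewrite -[A]submxK.
have -> : ursubmx A = 0.
  apply/matrixP => i j; rewrite !mxE /= !nth_cat ltn_ord -s1 ltnNge leq_addr /=.
  by rewrite addKn M0 ?mem_nth -?s2.
rewrite det_lblock /dt; congr (_ * _); congr determinant;
  apply/matrixP => i j; rewrite !mxE.
  by rewrite !nth_cat /= ltn_ord -s1 ltn_ord.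
by rewrite !nth_cat /= -s1 !ltnNge !leq_addr /= !addKn.
Qed.

Lemma dt_cat' (T1 T2 : eqType) (x1 : T1) (x2 : T2) r1 r2 c1 c2
    (M : T1 -> T2 -> K) : size r1 = size c1 -> size r2 = size c2 ->
  {in r2 & c1, forall x y, M x y = 0} ->
  dt x1 x2 (r1 ++ r2) (c1 ++ c2) M = dt x1 x2 r1 c1 M * dt x1 x2 r2 c2 M.
Proof.
move=> s1 s2 M0; rewrite dt_tr ?size_cat ?s1 ?s2 // dt_cat -?s1 -?s2 //; last first.
  by move=> x y xc yr; apply: M0.
by rewrite [in RHS]dt_tr // [X in _ = _ * X]dt_tr.
Qed.

Lemma dt_flatten (T1 T2 I : eqType) (x1 : T1) (x2 : T2) (l : seq I)
    (r : I -> seq T1) (c : I -> seq T2) (M : T1 -> T2 -> K) :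
  uniq l -> {in l, forall i, size (r i) = size (c i)} ->
  {in l &, forall i j, i != j -> {in r i & c j, forall x y, M x y = 0}} ->
  dt x1 x2 (flatten (map r l)) (flatten (map c l)) M =
  \prod_(i <- l) dt x1 x2 (r i) (c i) M.
Proof.
elim: l => [_ _ _|i l IH /= /andP[il ul] s0 M0].
  by rewrite big_nil dt_nil.
rewrite big_cons -IH //; first last.
- by move=> j k jl kl; apply: M0; rewrite inE ?jl ?kl orbT.
- by move=> j jl; apply: s0; rewrite inE jl orbT.
apply: dt_cat => [||x y xr /flattenP[s /mapP[j jl ->] ys]].
- by apply: s0; rewrite inE eqxx.
- rewrite !size_flatten /shape -!map_comp; congr sumn; apply/eq_in_map => j jl /=.
  by apply: s0; rewrite inE jl orbT.
- apply: (M0 i j) => //; rewrite ?inE ?eqxx ?jl ?orbT //.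
  by apply: contraNneq il => ->.
Qed.

Lemma dt_delta (T : eqType) (x y : T) r : uniq r ->
  dt x y r r (fun a b => (a == b)%:R) = 1 :> K.
Proof.
move=> ur; rewrite /dt -[RHS](det1 K (size r)); congr (\det _).
apply/matrixP => i j; rewrite !mxE (set_nth_default x y) // nth_uniq //.
Qed.

Lemma dt_trig (T1 T2 : Type) (x1 : T1) (x2 : T2) r c (M : T1 -> T2 -> K) :
  (forall i j, (i < j < size r)%N -> M (nth x1 r i) (nth x2 c j) = 0) ->
  dt x1 x2 r c M = \prod_(i < size r) M (nth x1 r i) (nth x2 c i).
Proof.
move=> M0; rewrite /dt det_trig; first by apply: eq_bigr => i _; rewrite mxE.
by apply/is_trig_mxP => i j ij; rewrite mxE M0 // ij /=.
Qed.

End ListDeterminant.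

Section NormListDeterminant.

Variable K : numFieldType.

(** Reordering the rows changes a determinant by a sign only; comparing absolute values frees the
    later arguments from ordering their bases. *)
Lemma ndt_perm (T1 T2 : eqType) (x1 : T1) (x2 : T2) r r' c
    (M : T1 -> T2 -> K) : perm_eq r r' ->
  `|dt x1 x2 r c M| = `|dt x1 x2 r' c M|.
Proof.
move=> rr'; have sr := perm_size rr'.
have /tuple_permP[s rE] : perm_eq (in_tuple r) (tcast (esym sr) (in_tuple r')).
  by rewrite val_tcast.
rewrite (dtE _ _ _ _ (esym sr)) /dt.
set A := (X in _ = `|\det X|).
have -> : \matrix_(i < size r, j < size r) M (nth x1 r i) (nth x2 c j) =
  row_perm s A.
  apply/matrixP => i j; rewrite !mxE; congr M.
  have := congr1 (fun t => nth x1 t i) rE; rewrite nth_mktuple => /= ->.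
  by rewrite (tnth_nth x1) val_tcast.
by rewrite row_permE det_mulmx det_perm normrM normrX normrN1 expr1n mul1r.
Qed.

Lemma ndt_permC (T1 T2 : eqType) (x1 : T1) (x2 : T2) r c c'
    (M : T1 -> T2 -> K) : size r = size c -> perm_eq c c' ->
  `|dt x1 x2 r c M| = `|dt x1 x2 r c' M|.
Proof.
move=> src cc'; rewrite dt_tr // (ndt_perm _ _ _ _ cc') -dt_tr //.
by rewrite src (perm_size cc').
Qed.

Lemma ndt_le (T1 T2 : eqType) (x1 : T1) (x2 : T2) r c (M : T1 -> T2 -> K)
    (t : T1 -> K) : size r = size c ->
  {in r & c, forall x y, `|M x y| <= t x} ->
  `|dt x1 x2 r c M| <= (size r)`!%:R * \prod_(x <- r) t x.
Proof.
move=> src Mt; rewrite /dt /determinant; apply: le_trans (ler_norm_sum _ _ _) _.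
rewrite (big_nth x1) big_mkord.
apply: le_trans (_ : _ <= \sum_(s : 'S_(size r)) \prod_(i < size r) t (nth x1 r i)) _.
  apply: ler_sum => s _; rewrite normrM normrX normrN1 expr1n mul1r normr_prod.
  apply: ler_prod => i _; rewrite normr_ge0 mxE Mt ?mem_nth //.
  by rewrite -src.
by rewrite sumr_const card_Sn mulr_natl.
Qed.

(** Laplace expansion along the first row; [c'] stands for the columns with one entry removed.
    Iterated, it discards bounded rows at the cost of one factor per row. *)
Lemma ndt_cons_le (T1 T2 : eqType) (x1 : T1) (x2 : T2) x r c
    (M : T1 -> T2 -> K) (B V : K) : size c = (size r).+1 ->
  {in c, forall y, `|M x y| <= B} ->
  (forall c', size c' = size r -> {subset c' <= c} -> `|dt x1 x2 r c' M| <= V) ->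
  `|dt x1 x2 (x :: r) c M| <= (size r).+1%:R * (B * V).
Proof.
move=> sc MB MV; rewrite /dt (expand_det_row _ ord0) /=.
apply: le_trans (ler_norm_sum _ _ _) _.
apply: le_trans (_ : _ <= \sum_(j < (size r).+1) B * V) _; last first.
  by rewrite sumr_const card_ord mulr_natl.
apply: ler_sum => j _; rewrite normrM mxE /=.
have jc : (j < size c)%N by rewrite sc.
apply: ler_pM => //; first by rewrite MB ?mem_nth.
rewrite /cofactor normrM normrX normrN1 expr1n mul1r.
pose c' := take j c ++ drop j.+1 c.
have sc' : size c' = size r.
  by rewrite size_cat size_take size_drop jc sc subSS subnKC // -ltnS.
have c'c : {subset c' <= c}.
  by move=> y; rewrite mem_cat => /orP[/mem_take|/mem_drop].
have := MV c' sc' c'c; rewrite /dt; congr (`|\det _| <= _).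
apply/matrixP => k l; rewrite !mxE /=; congr M.
rewrite /c' nth_cat size_take jc; have [lj|jl] := ltnP l j.
  by rewrite nth_take // /bump leqNgt lj.
by rewrite nth_drop /bump jl addSn subnKC.
Qed.

End NormListDeterminant.

(** * Factoriality and hypersurfaces *)

Definition dvd_elt (A : idomainType) (p a : A) : Prop := exists c, a = p * c.

Definition prime_elt (A : idomainType) (p : A) : Prop :=
  [/\ p != 0, p \isn't a GRing.unit &
      forall a b : A, dvd_elt p (a * b) -> dvd_elt p a \/ dvd_elt p b].

(** Factorisations into primes, rather than irreducibles, are automatically unique, so their
    existence characterizes factoriality. *)
Definition factorial_ring (A : idomainType) : Prop :=
  forall a : A, a != 0 -> exists s : seq A, exists2 u : A, u \is a GRing.unit &
    (forall x, x \in s -> prime_elt x) /\ a = u * \prod_(x <- s) x.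

Section Divisibility.

Variable A : idomainType.
Implicit Types a b c p : A.

Lemma dvd_elt_mulr p a b : dvd_elt p a -> dvd_elt p (a * b).
Proof. by case=> c ->; exists (c * b); rewrite mulrA. Qed.

Lemma dvd_eltD p a b : dvd_elt p a -> dvd_elt p b -> dvd_elt p (a + b).
Proof. by case=> c -> [c' ->]; exists (c + c'); rewrite mulrDr. Qed.

Lemma dvd_eltB p a b : dvd_elt p a -> dvd_elt p b -> dvd_elt p (a - b).
Proof. by case=> c -> [c' ->]; exists (c - c'); rewrite mulrBr. Qed.

Lemma dvd_elt0 p : dvd_elt p 0.
Proof. by exists 0; rewrite mulr0. Qed.

End Divisibility.

Section PolyDivisibility.

Import Pdiv.Idomain.

Variable A : idomainType.
Implicit Types a b c p : A.

Lemma dvd_polyC p (f : {poly A}) :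
  dvd_elt p%:P f <-> forall i, dvd_elt p f`_i.
Proof.
split=> [[g ->] i|]; first by rewrite coefCM; exists g`_i.
elim/poly_ind: f => [_|f c IH pf]; first exact: dvd_elt0.
apply: dvd_eltD; last first.
  have [d Ed] := pf 0%N; exists d%:P; rewrite -polyCM -Ed.
  by rewrite coefD coefMX coefC /= add0r.
apply/dvd_elt_mulr/IH => i; have := pf i.+1.
by rewrite coefD coefMX coefC /= addr0.
Qed.

Lemma polyC_unit a : (a%:P \is a GRing.unit) = (a \is a GRing.unit).
Proof.
rewrite poly_unitE coefC /= size_polyC.
by have [->|] := eqVneq a 0; rewrite ?unitr0.
Qed.

(** Induction on both polynomials: [p] divides the product of the constant terms, hence one of them;
    subtracting that constant and dividing by ['X] lowers a degree. *)
Lemma prime_polyC p : prime_elt p -> prime_elt p%:P.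
Proof.
case=> p0 pu pM; split; rewrite ?polyC_eq0 ?polyC_unit //.
elim/poly_ind=> [g _|f a IHf]; first by left; apply: dvd_elt0.
have dC c (h : {poly A}) : dvd_elt p c -> dvd_elt p%:P (c%:P * h).
  by case=> e ->; exists (e%:P * h); rewrite polyCM mulrA.
have dX (h : {poly A}) : dvd_elt p%:P (h * 'X) -> dvd_elt p%:P h.
  move=> /dvd_polyC hX; apply/dvd_polyC => i; have := hX i.+1.
  by rewrite coefMX.
elim/poly_ind=> [_|g b IHg d]; first by right; apply: dvd_elt0.
have /pM[pa|pb] : dvd_elt p (a * b).
- move/dvd_polyC/(_ 0%N): d; rewrite coef0M !coefD !coefMX !coefC /=.
  by rewrite !add0r.
- have : dvd_elt p%:P (f * (g * 'X + b%:P)).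
    apply: dX; rewrite mulrAC.
    have -> : f * 'X * (g * 'X + b%:P) = (f * 'X + a%:P) * (g * 'X + b%:P)
      - a%:P * (g * 'X + b%:P) by rewrite -mulrBl addrK.
    by apply: dvd_eltB => //; apply: dC.
  case/IHf=> [pf|]; [left|by right].
  by apply: dvd_eltD; [apply: dvd_elt_mulr|rewrite -[a%:P]mulr1; apply: dC].
- have : dvd_elt p%:P ((f * 'X + a%:P) * g).
    apply: dX; rewrite -mulrA.
    have -> : (f * 'X + a%:P) * (g * 'X) = (f * 'X + a%:P) * (g * 'X + b%:P)
      - b%:P * (f * 'X + a%:P) by rewrite [b%:P * _]mulrC -mulrBr addrK.
    by apply: dvd_eltB => //; apply: dC.
  case/IHg=> [|pg]; [by left|right].
  by apply: dvd_eltD; [apply: dvd_elt_mulr|rewrite -[b%:P]mulr1; apply: dC].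
Qed.

Lemma irreducible_primitive (p : {poly A}) : irreducible_elt p ->
  (1 < size p)%N -> forall c, prime_elt c -> ~ dvd_elt c%:P p.
Proof.
case=> _ _ pI sp c [_ cu _] [g Eg]; case: (pI _ _ Eg); first by rewrite polyC_unit; apply/negP.
rewrite poly_unitE => /andP[/eqP sg _]; move: sp; rewrite Eg mul_polyC.
by rewrite ltnNge (leq_trans (size_scale_leq _ _)) // sg.
Qed.

(** Each prime factor of [c] divides [p * g] but not [p], hence divides [g] and can be cancelled. *)
Lemma strip_primitive (p : {poly A}) h g c : factorial_ring A ->
  (forall d, prime_elt d -> ~ dvd_elt d%:P p) ->
  c != 0 -> c%:P * h = p * g -> dvd_elt p h.
Proof.
move=> fA pP c0; have [s [u uu [sP ->]]] := fA c c0.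
elim: s => [|d s IH] in h g sP *.
  rewrite big_nil mulr1 => E; exists (u^-1%:P * g).
  by rewrite mulrCA -E mulrA -polyCM mulVr // mul1r.
have dP : prime_elt d by apply: sP; rewrite mem_head.
have sP' x : x \in s -> prime_elt x by move=> xs; apply: sP; rewrite inE xs orbT.
rewrite big_cons mulrCA polyCM -mulrA => E.
have [d0 _ dM] := prime_polyC dP.
case: (dM p g) => [|/pP//|[g' Eg]]; first by eexists; rewrite -E.
by apply: (IH h g' sP'); apply: (mulfI d0); rewrite E Eg mulrCA.
Qed.

(** A factorisation over the fraction field, with denominator [c] cleared, descends to [A]: each
    prime factor of [c] is cancelled from [q] or from [g], and [e] collects, up to a unit, those
    cancelled from [q]. *)
Lemma strip_factor (p q g : {poly A}) c : factorial_ring A ->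
  c != 0 -> c%:P * p = q * g ->
  exists e : A, exists q' g' : {poly A}, [/\ q = e%:P * q' & p = q' * g'].
Proof.
move=> fA c0; have [s [u uu [sP ->]]] := fA c c0.
elim: s => [|d s IH] in q g sP *.
  rewrite big_nil mulr1 => E; exists u, (u^-1%:P * q), g.
  by rewrite -mulrA -E !mulrA -!polyCM divrr // mulVr // !mul1r.
have dP : prime_elt d by apply: sP; rewrite mem_head.
have sP' x : x \in s -> prime_elt x by move=> xs; apply: sP; rewrite inE xs orbT.
rewrite big_cons mulrCA polyCM -mulrA => E.
have [d0 _ dM] := prime_polyC dP.
case: (dM q g) => [|[q' Eq]|[g' Eg]]; first by eexists; rewrite -E.
  have [|e [q'' [g'' [Eq' Ep]]]] := IH q' g sP'.
    by apply: (mulfI d0); rewrite E Eq !mulrA.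
  by exists (d * e), q'', g''; split; rewrite // Eq Eq' polyCM mulrA.
by apply: (IH q g' sP'); apply: (mulfI d0); rewrite E Eg mulrCA.
Qed.

(** Over a domain [gcdp] divides only up to constants. Clearing these constants turns the common
    factor into a genuine nonconstant factor of [p], which irreducibility makes associated to
    [p]. *)
Lemma dvd_of_gcd (p g : {poly A}) : factorial_ring A -> irreducible_elt p ->
  (1 < size p)%N -> (1 < size (gcdp p g))%N -> dvd_elt p g.
Proof.
move=> fA pI sp sg; have pP := irreducible_primitive pI sp.
have [[c f] /= c0 Ep] := dvdpP _ _ (dvdp_gcdl p g).
have [[c' g1] /= c'0 Eg] := dvdpP _ _ (dvdp_gcdr p g).
move: Ep Eg; rewrite -!mul_polyC ![_ * gcdp p g]mulrC => Ep Eg.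
have [e [q [f' [Eq Ep']]]] := strip_factor fA c0 Ep.
have sq : (1 < size q)%N.
  by apply: leq_trans sg _; rewrite Eq mul_polyC size_scale_leq.
have [_ _ /(_ _ _ Ep')[qu|fu]] := pI.
  by move: qu; rewrite poly_unitE => /andP[/eqP sq1 _]; rewrite sq1 in sq.
apply: (@strip_primitive p g (e%:P * f'^-1 * g1) c' fA pP c'0).
by rewrite Eg Eq Ep' [e%:P * f'^-1]mulrC -!mulrA mulVKr // mulrCA.
Qed.

(** The resultant is such a constant when both polynomials are nonconstant; a constant [g] is its
    own witness. *)
Lemma coprime_elim (p g : {poly A}) : (1 < size p)%N -> g != 0 ->
  ~~ (1 < size (gcdp p g))%N ->
  exists2 c : A, c != 0 & exists u v, c%:P = u * p + v * g.
Proof.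
move=> sp g0 sg; have [sg1|sg1] := leqP (size g) 1.
  exists g`_0; first by apply: contraNneq g0 => g00; rewrite [g]size1_polyC // g00.
  by exists 0, 1; rewrite mul0r add0r mul1r -size1_polyC.
have [[u v] _ E] := resultant_in_ideal sp sg1.
exists (resultant p g); last by exists u, v.
by rewrite resultant_eq0.
Qed.

(** If [p] does not divide [g], a nonzero constant [c] lies in the ideal generated by [p] and [g];
    then [c%:P * h] is a multiple of [p], and primitivity of [p] removes [c]. *)
Lemma prime_of_irreducible_poly (p : {poly A}) : factorial_ring A ->
  irreducible_elt p -> (1 < size p)%N -> prime_elt p.
Proof.
move=> fA pI sp; have pP := irreducible_primitive pI sp.
case: (pI) => p0 pu _; split=> // g h [k Ek].
have [sg|sg] := boolP (1 < size (gcdp p g))%N; first by left; apply: dvd_of_gcd.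
have [->|g0] := eqVneq g 0; first by left; apply: dvd_elt0.
have [c c0 [u [v E]]] := coprime_elim sp g0 sg.
right; apply: (@strip_primitive p h (u * h + v * k) c fA pP c0).
by rewrite E mulrDl -[v * g * h]mulrA Ek mulrDr !mulrA [u * p]mulrC [v * p]mulrC.
Qed.

End PolyDivisibility.

Section RingIso.

Variables (A B : idomainType) (f : {rmorphism A -> B}) (g : {rmorphism B -> A}).
Hypotheses (fK : cancel f g) (gK : cancel g f).

Lemma iso_unit x : (f x \is a GRing.unit) = (x \is a GRing.unit).
Proof.
apply/idP/idP => [fu|]; last exact: rmorph_unit.
by rewrite -[x]fK; apply: rmorph_unit.
Qed.

Lemma iso_eq0 x : (f x == 0) = (x == 0).
Proof. by rewrite -[0 in LHS](rmorph0 f) (can_eq fK). Qed.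

Lemma iso_irreducible p : irreducible_elt p -> irreducible_elt (f p).
Proof.
case=> p0 pu pI; split; rewrite ?iso_eq0 ?iso_unit // => q r E.
have [] := pI (g q) (g r); first by rewrite -rmorphM -E fK.
  by rewrite -iso_unit gK; left.
by rewrite -iso_unit gK; right.
Qed.

Lemma iso_dvd p a : dvd_elt (f p) (f a) -> dvd_elt p a.
Proof. by case=> c /(congr1 g); rewrite rmorphM !fK => ->; exists (g c). Qed.

Lemma iso_prime p : prime_elt (f p) -> prime_elt p.
Proof.
case; rewrite iso_eq0 iso_unit => p0 pu pP; split=> // a b [c E].
have [|d|d] := pP (f a) (f b); last 2 first.
- by left; apply: iso_dvd.
- by right; apply: iso_dvd.
by exists (f c); rewrite -!rmorphM E.
Qed.

End RingIso.

Section MpolyDivisibility.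

(** Nonzero constants are units over a field, so both factors of a reducible polynomial have smaller
    degree. *)
Lemma factorial_mpoly (K : fieldType) n :
  (forall p : {mpoly K[n]}, irreducible_elt p -> prime_elt p) ->
  factorial_ring {mpoly K[n]}.
Proof.
move=> irrP a; have [m] := ubnP (msize a); elim: m a => // m IH a am a0.
have [au|au] := boolP (a \is a GRing.unit).
  by exists [::], a => //; split=> //; rewrite big_nil mulr1.
have [aI|aI] := classic (irreducible_elt a).
  exists [:: a], 1; rewrite ?unitr1 // big_seq1 mul1r; split=> // x.
  by rewrite inE => /eqP ->; apply: irrP.
have [q [r [E qu ru]]] : exists q r, [/\ a = q * r,
    q \isn't a GRing.unit & r \isn't a GRing.unit].
  apply: NNPP => H; apply: aI; split=> // q r E.
  apply: NNPP => /not_or_and[/negP qu /negP ru]; apply: H.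
  by exists q, r.
have nz (x : {mpoly K[n]}) : x \isn't a GRing.unit -> x != 0 -> (1 < msize x)%N.
  move=> xu x0; rewrite ltnNge; apply: contra xu => /msize1_polyC Ex.
  have x00 : x@_0 != 0 by apply: contraNneq x0 => x00; rewrite Ex x00.
  by rewrite Ex; apply/unitrP; exists ((x@_0)^-1)%:MP; rewrite -!mpolyCM mulVf ?divff.
have [q0 r0] : q != 0 /\ r != 0.
  by apply/andP; rewrite -negb_or -mulf_eq0 -E.
have sE := msizeM q0 r0; have sq := nz _ qu q0; have sr := nz _ ru r0.
rewrite ltnS E sE in am.
have [qm rm] : (msize q < m)%N /\ (msize r < m)%N.
  by move: (mmeasure mdeg q) (mmeasure mdeg r) am sq sr => i j *; lia.
have [s [u uu [sP Eq]]] := IH q qm q0.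
have [t [v vu [tP Er]]] := IH r rm r0.
exists (s ++ t), (u * v); first by rewrite unitrM uu.
split=> [x|]; first by rewrite mem_cat => /orP[/sP|/tP].
by rewrite big_cat E Eq Er /= mulrACA.
Qed.

Variable K : comNzRingType.
Variable n : nat.

(** The inverse of [muni], made a ring morphism so that statements on univariate polynomials over
    [{mpoly K[n]}] transfer to [{mpoly K[n.+1]}]. *)
Definition unmuni (P : {poly {mpoly K[n]}}) : {mpoly K[n.+1]} :=
  (map_poly (@mwiden n K) P).['X_ord_max].

Lemma unmuni_is_additive : additive unmuni.
Proof. by move=> p q; rewrite /unmuni rmorphB hornerD hornerN. Qed.

Lemma unmuni_is_multiplicative : multiplicative unmuni.
Proof.
by split=> [p q|]; rewrite /unmuni ?rmorphM ?hornerM // rmorph1 hornerC.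
Qed.

HB.instance Definition _ :=
  GRing.isAdditive.Build {poly {mpoly K[n]}} {mpoly K[n.+1]} unmuni
    unmuni_is_additive.
HB.instance Definition _ :=
  GRing.isMultiplicative.Build {poly {mpoly K[n]}} {mpoly K[n.+1]} unmuni
    unmuni_is_multiplicative.

End MpolyDivisibility.

Section MpolyUni.

Variable n : nat.

Lemma unmuniD (K : comNzRingType) : {morph @unmuni K n : p q / p + q}.
Proof. exact: raddfD. Qed.

Lemma unmuniM (K : comNzRingType) : {morph @unmuni K n : p q / p * q}.
Proof. exact: rmorphM. Qed.

Lemma unmuniXn (K : comNzRingType) k : {morph @unmuni K n : p / p ^+ k}.
Proof. exact: rmorphXn. Qed.

Lemma unmuniC (K : comNzRingType) (p : {mpoly K[n]}) :
  unmuni p%:P = mwiden p.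
Proof. by rewrite /unmuni map_polyC hornerC. Qed.

Lemma unmuniX (K : comNzRingType) : unmuni 'X = 'X_ord_max :> {mpoly K[n.+1]}.
Proof. by rewrite /unmuni map_polyX hornerX. Qed.

Lemma muni_meval (K : comNzRingType) (p : {mpoly K[n.+1]}) (v : 'I_n.+1 -> K) :
  p.@[v] = (map_poly (meval (fun i => v (widen_ord (leqnSn n) i))) (muni p)).[v ord_max].
Proof.
rewrite muniE mevalE rmorph_sum /= horner_sum; apply: eq_bigr => m _.
rewrite map_polyZ /= mevalZ mevalX map_polyXn hornerZ hornerXn -mulrA.
by congr (_ * _); rewrite big_ord_recr; congr (_ * _); apply: eq_bigr => i _; rewrite mnmE.
Qed.

Lemma muni_mwiden (K : comNzRingType) (p : {mpoly K[n]}) : muni (mwiden p) = p%:P.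
Proof.
elim/mpolyind: p => [|c m p _ _ IH]; first by rewrite mwiden0 muni0.
rewrite mwidenD muniD IH polyCD mwidenZ muniZ mwidenX; congr (_ + _).
rewrite muniE msuppX big_seq1 mcoeffX eqxx scale1r mnmwiden_ordmax expr0.
rewrite -[in RHS]mul_mpolyC polyCM -mul_polyC; congr (_ * _).
rewrite alg_polyC; congr ('X_[_])%:P; apply/mnmP => i.
by rewrite mnmE mnmwiden_widen.
Qed.

Lemma muni_X (K : comNzRingType) : muni ('X_ord_max : {mpoly K[n.+1]}) = 'X.
Proof.
rewrite muniE msuppX big_seq1 mcoeffX eqxx scale1r mnm1E eqxx expr1.
rewrite -[RHS]scale1r; congr (_ *: _); rewrite -mpolyX0; congr 'X_[_].
by apply/mnmP => i; rewrite mnmE mnm1E mnm0E -val_eqE /= gtn_eqF.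
Qed.

Lemma unmuniK (K : comNzRingType) : cancel (@unmuni K n) (@muni n K).
Proof.
move=> P; elim/poly_ind: P => [|P c IH]; first by rewrite !rmorph0.
rewrite unmuniD unmuniM muniD muniM.
by rewrite IH unmuniX muni_X unmuniC muni_mwiden.
Qed.

Lemma muniK (K : comNzRingType) : cancel (@muni n K) (@unmuni K n).
Proof.
elim/mpolyind => [|c m p _ _ IH]; first by rewrite !rmorph0.
rewrite muniD unmuniD; congr (_ + _); last exact: IH.
rewrite -mul_mpolyC muniM unmuniM muniC unmuniC mwidenC; congr (_ * _).
rewrite muniE msuppX big_seq1 mcoeffX eqxx scale1r -mul_polyC unmuniM unmuniXn.
rewrite unmuniX unmuniC mwidenX mpolyXn -mpolyXD; congr 'X_[_]; apply/mnmP => i.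
rewrite mnmDE mulmnE mnm1E.
have [->|im] := eqVneq i ord_max; first by rewrite mul1n mnmwiden_ordmax.
have ii : (i < n)%N.
  by rewrite ltn_neqAle -ltnS ltn_ord andbT; apply: contraNneq im => /= E; apply/eqP/val_inj.
have -> : i = widen_ord (leqnSn n) (Ordinal ii) by apply: val_inj.
by rewrite mnmwiden_widen mnmE mul0n addn0.
Qed.

End MpolyUni.

Section MuniDivisibility.

Variables (K : idomainType) (n : nat).
Local Notation A := {mpoly K[n.+1]}.
Local Notation B := {poly {mpoly K[n]}}.

Lemma muni_irreducible (p : A) : irreducible_elt p -> irreducible_elt (muni p).
Proof. exact: (@iso_irreducible A B _ _ (@muniK n K) (@unmuniK n K)). Qed.

Lemma muni_prime (p : A) : prime_elt (muni p) -> prime_elt p.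
Proof. exact: (@iso_prime A B _ _ (@muniK n K)). Qed.

Lemma muni_dvd (p a : A) : dvd_elt (muni p) (muni a) -> dvd_elt p a.
Proof. exact: (@iso_dvd A B _ _ (@muniK n K)). Qed.

End MuniDivisibility.

Lemma horner_map_comb (A B : comNzRingType) (f : {rmorphism A -> B})
    (u p v q : {poly A}) x : (map_poly f (u * p + v * q)).[x] =
  (map_poly f u).[x] * (map_poly f p).[x] + (map_poly f v).[x] * (map_poly f q).[x].
Proof. by rewrite rmorphD !rmorphM hornerD !hornerM. Qed.

Section MevalBig.

Variables (K : comNzRingType) (n : nat) (v : 'I_n -> K).

Lemma meval_sum (I : Type) (r : seq I) (P : pred I) (F : I -> {mpoly K[n]}) :
  (\sum_(i <- r | P i) F i).@[v] = \sum_(i <- r | P i) (F i).@[v].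
Proof. exact: raddf_sum. Qed.

Lemma meval_prod (I : Type) (r : seq I) (P : pred I) (F : I -> {mpoly K[n]}) :
  (\prod_(i <- r | P i) F i).@[v] = \prod_(i <- r | P i) (F i).@[v].
Proof. exact: rmorph_prod. Qed.

Lemma meval_exp (p : {mpoly K[n]}) k : (p ^+ k).@[v] = p.@[v] ^+ k.
Proof. exact: rmorphXn. Qed.

End MevalBig.

Lemma poly_nonroot (K : numDomainType) (p : {poly K}) : p != 0 ->
  exists x, p.[x] != 0.
Proof.
move=> p0; apply: NNPP => H.
have := max_poly_roots (p := p) (rs := [seq i%:R | i <- iota 0 (size p)]) p0.
rewrite size_map size_iota ltnn => /(_ _ _)/notF; apply.
  by apply/allP => x /mapP[i _ ->]; apply/rootP/eqP; apply/negPn/negP => h; apply: H; eexists; exact: h.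
by rewrite map_inj_uniq ?iota_uniq // => i j /eqP; rewrite eqr_nat => /eqP.
Qed.

Lemma mpoly_nonroot (K : numDomainType) n (p : {mpoly K[n]}) : p != 0 ->
  exists v, p.@[v] != 0.
Proof.
elim: n p => [|n IH] p p0.
  exists (fun _ => 0); rewrite [p]nvar0_mpolyC mevalC.
  by apply: contraNneq p0 => E; rewrite [p]nvar0_mpolyC E.
have q0 : lead_coef (muni p) != 0.
  rewrite lead_coef_eq0; apply: contraNneq p0 => E.
  by rewrite -[p]muniK E rmorph0.
have [v vP] := IH _ q0.
have [|x xP] := @poly_nonroot K (map_poly (meval v) (muni p)).
  by rewrite -lead_coef_eq0 lead_coef_map_eq.
exists (fun i : 'I_n.+1 => if unlift ord_max i is Some j then v j else x).
rewrite muni_meval unlift_none (eq_map_poly (g := meval v)) // => q.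
apply: meval_eq => i; rewrite (_ : widen_ord _ i = lift ord_max i) ?liftK //.
by apply: val_inj; rewrite /= /bump leqNgt ltn_ord.
Qed.

(* The two statements are proved together: the Nullstellensatz for the
   hypersurface [p = 0] follows from elimination of the last variable, and
   primality of irreducible polynomials is Gauss's lemma. *)
Lemma hypersurface_nullstellensatz_prime (K : numClosedFieldType) n
    (p : {mpoly K[n]}) : irreducible_elt p ->
  prime_elt p /\
  forall g, (forall v, p.@[v] = 0 -> g.@[v] = 0) -> dvd_elt p g.
Proof.
elim: n p => [|n IH] p pI.
  case: pI => p0 /negP[]; apply/unitrP; exists ((p@_0)^-1)%:MP.
  rewrite [p]nvar0_mpolyC -!mpolyCM mcoeffC eqxx mulr1 mulVf ?divff //.
    by apply: contraNneq p0 => E; rewrite [p]nvar0_mpolyC E.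
  by apply: contraNneq p0 => E; rewrite [p]nvar0_mpolyC E.
have fA : factorial_ring {mpoly K[n]}.
  by apply: factorial_mpoly => q /IH[].
pose ext (v : 'I_n -> K) x (i : 'I_n.+1) :=
  if unlift ord_max i is Some j then v j else x.
have extP (g : {mpoly K[n.+1]}) v x :
    g.@[ext v x] = (map_poly (meval v) (muni g)).[x].
  rewrite muni_meval {2}/ext unlift_none (eq_map_poly (g := meval v)) // => q.
  apply: meval_eq => i; rewrite /ext (_ : widen_ord _ i = lift ord_max i) ?liftK //.
  by apply: val_inj; rewrite /= /bump leqNgt ltn_ord.
have qI := muni_irreducible pI.
have p0 : muni p != 0 by case: qI.
(* If the last variable does not occur in [p], the induction hypothesis applies to its constant
   coefficient, and [g] is treated coefficient by coefficient. *)
have [sp|sp] := leqP (size (muni p)) 1.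
  have Ep := size1_polyC sp; set c := _`_0 in Ep.
  have cI : irreducible_elt c.
    have [q0 qu qM] := qI; split; first by rewrite -polyC_eq0 -Ep.
      by rewrite -polyC_unit -Ep.
    move=> a b E; rewrite -(polyC_unit a) -(polyC_unit b).
    by apply: qM; rewrite Ep E polyCM.
  have [cP cN] := IH _ cI; split.
    by apply: muni_prime; rewrite Ep; apply: prime_polyC.
  move=> g gP; apply: muni_dvd; rewrite Ep.
  apply/dvd_polyC => i; apply: cN => v cv.
  suff -> : ((muni g)`_i).@[v] = (map_poly (meval v) (muni g))`_i.
    suff -> : map_poly (meval v) (muni g) = 0 by rewrite coef0.
    apply/eqP; apply/negPn/negP => /poly_nonroot[x] /eqP[].
    by rewrite -extP gP // extP Ep map_polyC hornerC.
  by rewrite coef_map.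
split.
  by apply: muni_prime; apply: prime_of_irreducible_poly.
move=> g gP; apply: muni_dvd.
have [sg|sg] := boolP (1 < size (gcdp (muni p) (muni g)))%N.
  exact: dvd_of_gcd.
have [->|g0] := eqVneq (muni g) 0; first exact: dvd_elt0.
have [c c0 [u [w E]]] := coprime_elim sp g0 sg.
have lc0 : lead_coef (muni p) != 0 by rewrite lead_coef_eq0.
(* Where neither [c] nor the leading coefficient of [p] vanishes, [p] keeps its degree in the last
   variable and has a root; [g] vanishes there as well, against the Bezout identity for [c]. *)
have [v] := mpoly_nonroot (mulf_neq0 c0 lc0); rewrite mevalM mulf_eq0 negb_or => /andP[cv lv].
have sP : size (map_poly (meval v) (muni p)) = size (muni p).
  exact: size_map_poly_id0.
have /closed_rootP[x /rootP xr] : size (map_poly (meval v) (muni p)) != 1%N.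
  by rewrite sP gtn_eqF.
case/eqP: cv; have gx : (map_poly (meval v) (muni g)).[x] = 0.
  by rewrite -extP; apply: gP; rewrite extP.
have key (P G : {poly {mpoly K[n]}}) : c%:P = u * P + w * G ->
    (map_poly (meval v) P).[x] = 0 -> (map_poly (meval v) G).[x] = 0 -> c.@[v] = 0.
  move=> EP P0 G0; have -> : c.@[v] = (map_poly (meval v) c%:P).[x].
    by rewrite map_polyC hornerC.
  by rewrite EP horner_map_comb P0 G0 !mulr0 addr0.
exact: key E xr gx.
Qed.

Lemma hypersurface_nullstellensatz (K : numClosedFieldType) n
    (p g : {mpoly K[n]}) : irreducible_elt p ->
  (forall v, p.@[v] = 0 -> g.@[v] = 0) -> dvd_elt p g.
Proof. by move=> /hypersurface_nullstellensatz_prime[_]; apply. Qed.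

(** * Homogeneous bases and resultants *)

Section MonomialLists.

Variable N : nat.
Implicit Types (m : 'X_{1..N}) (J : {set 'I_N}) (k n : nat).

(** Sorted by the monomial order, which refines the degree, so that a family with prescribed leading
    terms has a triangular matrix. *)
Definition monos_le (n : nat) : seq 'X_{1..N} :=
  sort <=%O [seq bmnm x | x <- enum {: 'X_{1..N < n.+1}}].

Definition monos_eq (n : nat) : seq 'X_{1..N} := [seq m <- monos_le n | mdeg m == n].

Lemma mem_monos_le n m : (m \in monos_le n) = (mdeg m <= n)%N.
Proof.
rewrite mem_sort; apply/mapP/idP => [[x _ ->]|mn]; first by rewrite -ltnS bmdeg.
by exists (BMultinom (mn : (mdeg m < n.+1)%N)); rewrite ?mem_enum.
Qed.

Lemma monos_le_uniq n : uniq (monos_le n).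
Proof. by rewrite sort_uniq map_inj_uniq ?enum_uniq //; apply: val_inj. Qed.

Lemma monos_le_sorted n : sorted <=%O (monos_le n).
Proof. exact: sort_le_sorted. Qed.

Lemma mem_monos_eq n m : (m \in monos_eq n) = (mdeg m == n).
Proof.
by rewrite mem_filter mem_monos_le andbC; case: eqP => [->|]; rewrite ?leqnn ?andbF.
Qed.

Lemma monos_eq_uniq n : uniq (monos_eq n).
Proof. exact/filter_uniq/monos_le_uniq. Qed.

Variable d : nat.
Hypothesis d0 : (0 < d)%N.

Definition mshift (j : 'I_N) m := (m + U_(j) *+ d)%MM.
Definition munshift (j : 'I_N) m := (m - U_(j) *+ d)%MM.

Lemma mshiftE j m i : mshift j m i = (m i + (j == i) * d)%N.
Proof. by rewrite mnmDE mulmnE mnm1E. Qed.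

Lemma mdeg_mshift j m : mdeg (mshift j m) = (mdeg m + d)%N.
Proof. by rewrite mdegD mdegMn mdeg1 mul1n. Qed.

Lemma mshiftK j : cancel (mshift j) (munshift j).
Proof. by move=> m; apply: addmK. Qed.

Lemma mshift_inj j : injective (mshift j).
Proof. exact: can_inj (mshiftK j). Qed.

Lemma munshiftK j m : (d <= m j)%N -> mshift j (munshift j m) = m.
Proof.
move=> dm; apply: submK; apply/mnm_lepP => i; rewrite mulmnE mnm1E.
by have [<-|] := eqVneq j i; rewrite ?mul1n ?mul0n.
Qed.

Lemma mdeg_munshift j m k : (d <= m j)%N -> mdeg m = (k + d)%N ->
  mdeg (munshift j m) = k.
Proof. by move=> dm; rewrite -{1}(munshiftK dm) mdeg_mshift => /addIn. Qed.

(** For a basis with [f (mshift d j m) = H j * f m], these monomials index a basis of the degree [k]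
    part of the quotient by the forms [H j] with [j] in [J]. *)
Definition rmonos (J : {set 'I_N}) (k : nat) :=
  [seq m : 'X_{1..N} <- monos_eq k | [forall (j | j \in J), (m j < d)%N]].

Lemma mem_rmonos J k m :
  (m \in rmonos J k) = (mdeg m == k) && [forall (j | j \in J), (m j < d)%N].
Proof. by rewrite mem_filter mem_monos_eq andbC. Qed.

Lemma rmonos_uniq J k : uniq (rmonos J k).
Proof. exact/filter_uniq/monos_eq_uniq. Qed.

Lemma rmonos0 k : rmonos finset.set0 k = monos_eq k.
Proof.
by apply/all_filterP/allP => m _; apply/forall_inP => j; rewrite inE.
Qed.

Lemma mnm_le_mdeg m j : (m j <= mdeg m)%N.
Proof. by rewrite mdegE (bigD1 j) // leq_addr. Qed.

Lemma rmonos_small J j k : (k < d)%N -> rmonos (j |: J) k = rmonos J k.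
Proof.
move=> kd; apply: eq_in_filter => m; rewrite mem_monos_eq => /eqP mk.
apply/forall_inP/forall_inP => H i iJ; first by apply: H; rewrite !inE iJ orbT.
by apply: leq_ltn_trans (mnm_le_mdeg m i) _; rewrite mk.
Qed.

(** Index form of the exact sequence given by multiplication by the form [j] on the quotient by the
    forms of [J]: cokernel indices, then image indices. *)
Lemma rmonos_split J j k : j \notin J ->
  perm_eq (rmonos J (k + d)) (rmonos (j |: J) (k + d) ++ map (mshift j) (rmonos J k)).
Proof.
move=> jJ; apply: uniq_perm; rewrite ?rmonos_uniq // ?cat_uniq.
  rewrite rmonos_uniq map_inj_uniq ?rmonos_uniq ?andbT; last exact: mshift_inj.
  apply/hasPn => _ /mapP[m _ ->]; rewrite mem_rmonos negb_and; apply/orP; right.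
  apply/negP => /forall_inP/(_ j); rewrite !inE eqxx => /(_ isT).
  by rewrite mshiftE eqxx mul1n ltnNge leq_addl.
move=> m; rewrite mem_cat !mem_rmonos; apply/idP/orP.
  case/andP=> mk /forall_inP mJ; have [mj|mj] := ltnP (m j) d.
    left; rewrite mk; apply/forall_inP => i; rewrite !inE.
    by case/predU1P => [->|/mJ].
  right; apply/mapP; exists (munshift j m); last by rewrite munshiftK.
  rewrite mem_rmonos (mdeg_munshift mj (eqP mk)) eqxx; apply/forall_inP => i iJ.
  by apply: leq_ltn_trans (mJ i iJ); rewrite mnmBE leq_subr.
case=> [/andP[-> /forall_inP H]|/mapP[m' + ->]].
  by apply/forall_inP => i iJ; apply: H; rewrite !inE iJ orbT.
rewrite mem_rmonos mdeg_mshift eqn_add2r => /andP[-> /forall_inP H].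
apply/forall_inP => i iJ; rewrite mshiftE (negPf (_ : j != i)) ?addn0 ?H //.
by apply: contraNneq jJ => ->.
Qed.

(** Shifted rows vanish on the columns reduced in direction [j], and on shifted columns they
    reproduce the matrix of degree [k]. *)
Lemma ndt_rmonos_rec (K : numFieldType) (M : 'X_{1..N} -> 'X_{1..N} -> K) J j k :
  j \notin J ->
  (forall m m', M (mshift j m) m' = if (d <= m' j)%N then M m (munshift j m') else 0) ->
  `|dt 0%MM 0%MM (rmonos J (k + d)) (rmonos J (k + d)) M| =
  `|dt 0%MM 0%MM (rmonos (j |: J) (k + d)) (rmonos (j |: J) (k + d)) M| *
  `|dt 0%MM 0%MM (rmonos J k) (rmonos J k) M|.
Proof.
move=> jJ MP; have pR := rmonos_split k jJ.
rewrite (ndt_perm _ _ _ _ pR) (ndt_permC _ _ _ _ pR); last by rewrite -(perm_size pR).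
rewrite dt_cat' ?size_map // => [|x y /mapP[m _ ->]]; last first.
  rewrite mem_rmonos => /andP[_ /forall_inP/(_ j)]; rewrite !inE eqxx => /(_ isT) yj.
  by rewrite MP leqNgt yj.
rewrite normrM (dt_map _ _ 0%MM 0%MM) //; congr (_ * `|_|); apply: eq_dt_in => // x y _ _.
by rewrite MP mshiftK mshiftE eqxx mul1n leq_addl.
Qed.

End MonomialLists.

Section HomogeneousBasis.

Variables (K : numFieldType) (N : nat).
Implicit Types (f : 'X_{1..N} -> {mpoly K[N]}) (co : {mpoly K[N]} -> 'X_{1..N} -> K).

(** The coordinates [co] are carried along with the basis and are defined on all polynomials, so
    that inhomogeneous polynomials, whose parts are treated degree by degree, have coordinates
    too. *)
Record hbasis f co : Prop := HBasis {
  hb_homog : forall m, f m \is (mdeg m).-homog;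
  hb_linear : forall a g h m, co (a *: g + h) m = a * co g m + co h m;
  hb_span : forall k h, h \is k.-homog ->
    h = \sum_(m <- monos_eq N k) co h m *: f m;
  hb_delta : forall m m', co (f m) m' = (m == m')%:R }.

Definition coef_dt f (k : nat) :=
  dt 0%MM 0%MM (monos_eq N k) (monos_eq N k) (fun m m' => (f m)@_m').

Lemma hbasis_of_dt f : (forall m, f m \is (mdeg m).-homog) ->
  (forall k, coef_dt f k != 0) -> exists co, hbasis f co.
Proof.
move=> fh fd; pose s k := monos_eq N k.
pose A k := \matrix_(i < size (s k), j < size (s k))
  (f (nth 0%MM (s k) i))@_(nth 0%MM (s k) j).
have Au k : A k \in unitmx by rewrite unitmxE unitfE; apply: fd.
(* The coefficients of [h] times the inverse matrix in degree [mdeg m]; the last factor selects the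
   position of [m]. *)
pose co (h : {mpoly K[N]}) m :=
  \sum_(j < size (s (mdeg m))) \sum_(l < size (s (mdeg m)))
   h@_(nth 0%MM (s (mdeg m)) j) * invmx (A (mdeg m)) j l *
   (nth 0%MM (s (mdeg m)) l == m)%:R.
have sdeg k (l : 'I_(size (s k))) : mdeg (nth 0%MM (s k) l) = k.
  by apply/eqP; rewrite -mem_monos_eq mem_nth.
have coE k h (l : 'I_(size (s k))) : co h (nth 0%MM (s k) l) =
    \sum_(j < size (s k)) h@_(nth 0%MM (s k) j) * invmx (A k) j l.
  rewrite /co sdeg; apply: eq_bigr => j _; rewrite (bigD1 l) //= eqxx mulr1.
  rewrite big1 ?addr0 // => l' ll'; rewrite nth_uniq ?monos_eq_uniq //.
  by rewrite (negPf (_ : _ != _)) ?mulr0.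
exists co; split=> // [a g h m|k h hk|m m'].
- rewrite mulr_sumr -big_split; apply: eq_bigr => j _.
  rewrite mulr_sumr -big_split; apply: eq_bigr => l _ /=.
  by rewrite mcoeffD mcoeffZ !mulrDl !mulrA.
- apply/mpolyP => m; have [mk|mk] := eqVneq (mdeg m) k; last first.
    rewrite (dhomog_nemf_coeff hk mk) raddf_sum /= big_seq big1 // => m'.
    rewrite mem_monos_eq => /eqP m'k; rewrite mcoeffZ.
    by rewrite (dhomog_nemf_coeff (fh m')) ?mulr0 // m'k.
  have ms : m \in s k by rewrite mem_monos_eq mk.
  have im : (index m (s k) < size (s k))%N by rewrite index_mem.
  rewrite raddf_sum /= (big_nth 0%MM) big_mkord.
  under eq_bigr => l _ do rewrite coE mcoeffZ mulr_suml.
  rewrite exchange_big /=.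
  have -> : h@_m = \sum_(j < size (s k)) h@_(nth 0%MM (s k) j) * (j == Ordinal im)%:R.
    rewrite (bigD1 (Ordinal im)) //= eqxx mulr1 nth_index // big1 ?addr0 // => j.
    by move=> /negPf ->; rewrite mulr0.
  apply: eq_bigr => j _; under eq_bigr => l _ do rewrite -mulrA.
  rewrite -mulr_sumr; congr (_ * _).
  have /matrixP/(_ j (Ordinal im)) := mulVmx (Au k); rewrite !mxE => <-.
  by apply: eq_bigr => l _; rewrite mxE /= nth_index.
- have [/eqP mm|mm] := boolP (mdeg m == mdeg m'); last first.
    rewrite (negPf (_ : m != m')); last by apply: contraNneq mm => ->.
    rewrite /co big1 // => j _; rewrite big1 // => l _.
    by rewrite (dhomog_nemf_coeff (fh m)) ?mul0r //= sdeg eq_sym.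
  have ms : m \in s (mdeg m') by rewrite mem_monos_eq mm.
  have ms' : m' \in s (mdeg m') by rewrite mem_monos_eq.
  have im : (index m (s (mdeg m')) < size (s (mdeg m')))%N by rewrite index_mem.
  have im' : (index m' (s (mdeg m')) < size (s (mdeg m')))%N by rewrite index_mem.
  have := coE (mdeg m') (f m) (Ordinal im'); rewrite /= nth_index // => ->.
  have /matrixP/(_ (Ordinal im) (Ordinal im')) := mulmxV (Au (mdeg m')).
  rewrite !mxE -val_eqE /= => E.
  have -> : (m == m') = (index m (s (mdeg m')) == index m' (s (mdeg m'))).
    by rewrite -(nth_uniq 0%MM im im') ?nth_index ?monos_eq_uniq.
  rewrite -E.
  by apply: eq_bigr => j _; rewrite mxE /= nth_index.
Qed.

Variables (f : 'X_{1..N} -> {mpoly K[N]}) (co : {mpoly K[N]} -> 'X_{1..N} -> K).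
Hypothesis fB : hbasis f co.

Lemma co0 m : co 0 m = 0.
Proof.
have := hb_linear fB 0 0 0 m; rewrite scaler0 add0r mul0r add0r => _.
by have := hb_linear fB (-1) 0 0 m; rewrite scaler0 add0r mulN1r addNr.
Qed.

Lemma coD g h m : co (g + h) m = co g m + co h m.
Proof. by rewrite -[g in LHS]scale1r (hb_linear fB) mul1r. Qed.

Lemma coZ a g m : co (a *: g) m = a * co g m.
Proof. by rewrite -[_ *: g]addr0 (hb_linear fB) co0 addr0. Qed.

Lemma co_sum (I : Type) (r : seq I) (P : pred I) (F : I -> {mpoly K[N]}) m :
  co (\sum_(i <- r | P i) F i) m = \sum_(i <- r | P i) co (F i) m.
Proof. by elim/big_rec2: _ => [|i x y _ <-]; rewrite ?co0 // coD. Qed.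

Lemma co_homog k h m : h \is k.-homog -> mdeg m != k -> co h m = 0.
Proof.
move=> hk mk; rewrite (hb_span fB hk) co_sum big_seq big1 // => m'.
rewrite mem_monos_eq coZ (hb_delta fB) => /eqP m'k.
by rewrite (negPf (_ : m' != m)) ?mulr0 //; apply: contraNneq mk => <-; apply/eqP.
Qed.

Lemma coef_dt_change g k : {in monos_eq N k, forall m, g m \is k.-homog} ->
  coef_dt g k = dt 0%MM 0%MM (monos_eq N k) (monos_eq N k) (fun m m' => co (g m) m')
                * coef_dt f k.
Proof.
move=> gh; rewrite /coef_dt -dt_mul //; apply: eq_dt_in => // m m' mk _.
rewrite {1}(hb_span fB (gh m mk)) raddf_sum.
by apply: eq_bigr => m'' _; rewrite /= mcoeffZ.
Qed.

Lemma homogE_monos k (p : {mpoly K[N]}) : p \is k.-homog ->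
  p = \sum_(m <- monos_eq N k) p@_m *: 'X_[m].
Proof.
move=> pk; apply/mpolyP => m; rewrite raddf_sum /=.
under eq_bigr => m' _ do rewrite mcoeffZ mcoeffX.
have [mk|mk] := boolP (m \in monos_eq N k).
  rewrite (bigD1_seq _ mk (monos_eq_uniq _ _)) /= eqxx mulr1 big1 ?addr0 //.
  by move=> m' /negPf ->; rewrite mulr0.
rewrite (dhomog_nemf_coeff pk) -?mem_monos_eq // big_seq big1 // => m' m'k.
by rewrite (negPf (_ : m' != m)) ?mulr0 //; apply: contraNneq mk => <-.
Qed.

Variables (d : nat) (H : 'I_N -> {mpoly K[N]}).
Hypothesis HP : forall m j, f (mshift d j m) = H j * f m.

(** Multiplication by [H j] sends basis vectors to basis vectors by a shift of the index, hence
    shifts coordinates. *)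
Lemma co_mul k j h m : h \is k.-homog ->
  co (H j * h) m = if (d <= m j)%N then co h (munshift d j m) else 0.
Proof.
move=> hk; rewrite {1}(hb_span fB hk) mulr_sumr co_sum.
under eq_bigr => m' _ do rewrite -scalerAr -HP coZ (hb_delta fB).
case: ifP => mj; last first.
  rewrite big1 // => m' _; rewrite (negPf (_ : _ != m)) ?mulr0 //.
  by apply: contraFneq mj => <-; rewrite mshiftE eqxx mul1n leq_addl.
have [mk|mk] := boolP (munshift d j m \in monos_eq N k).
  rewrite (bigD1_seq _ mk (monos_eq_uniq _ _)) /= munshiftK // eqxx mulr1.
  rewrite big1 ?addr0 // => m' m'm; rewrite (negPf (_ : _ != m)) ?mulr0 //.
  by apply: contraNneq m'm => <-; rewrite mshiftK.
rewrite (co_homog hk); last by rewrite -mem_monos_eq.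
rewrite big_seq big1 // => m' m'k; rewrite (negPf (_ : _ != m)) ?mulr0 //.
by apply: contraNneq mk => <-; rewrite mshiftK.
Qed.

End HomogeneousBasis.

(** * Degree in a block of variables *)

Section BlockDegree.

Variables (K : numFieldType) (M : nat) (B : pred 'I_M).
Implicit Types (p q : {mpoly K[M]}) (m : 'X_{1..M}).

Definition block_deg m := (\sum_(k | B k) m k)%N.

Definition block_scale (x : K) (u : 'I_M -> K) k := if B k then x * u k else u k.

(* Its degree in ['X] is the degree of [p] in the variables of the block [B]. *)
Definition block_poly p : {poly {mpoly K[M]}} :=
  mmap (polyC \o @mpolyC M K) (fun k => (if B k then 'X else 1) * ('X_k)%:P) p.

Lemma block_poly_is_multiplicative : multiplicative block_poly.
Proof. exact: mmap_is_multiplicative. Qed.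

HB.instance Definition _ :=
  GRing.isAdditive.Build {mpoly K[M]} {poly {mpoly K[M]}} block_poly
    (mmap_is_additive _ _).
HB.instance Definition _ :=
  GRing.isMultiplicative.Build {mpoly K[M]} {poly {mpoly K[M]}} block_poly
    block_poly_is_multiplicative.

Lemma block_polyM p q : block_poly (p * q) = block_poly p * block_poly q.
Proof. exact: rmorphM. Qed.

Lemma block_polyE p :
  block_poly p = \sum_(m <- msupp p) (p@_m *: 'X_[m])%:P * 'X^(block_deg m).
Proof.
apply: eq_bigr => m _ /=; rewrite -mul_mpolyC polyCM -mulrA; congr (_ * _).
rewrite /mmap1; under eq_bigr => k _ do rewrite exprMn.
rewrite big_split /= mulrC; congr (_ * _).
  rewrite mpolyXE_id rmorph_prod; apply: eq_bigr => k _.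
  by rewrite [RHS]rmorphXn.
rewrite /block_deg (bigID B) /= [X in _ * X]big1 ?mulr1 => [|k /negPf ->]; last first.
  by rewrite expr1n.
by rewrite -prodrXr; apply: eq_bigr => k ->.
Qed.

Lemma block_polyX k : block_poly 'X_k = (if B k then 'X else 1) * ('X_k)%:P.
Proof. by rewrite /block_poly mmapX mmap1U. Qed.

Lemma block_polyZ c p : block_poly (c *: p) = (c%:MP)%:P * block_poly p.
Proof. by rewrite /block_poly mmapZ. Qed.

Lemma block_poly_eval p x u :
  (map_poly (meval u) (block_poly p)).[x] = p.@[block_scale x u].
Proof.
rewrite block_polyE rmorph_sum /= horner_sum mevalE; apply: eq_bigr => m _.
rewrite rmorphM /= map_polyC map_polyXn hornerCM hornerXn /= mevalZ mevalX -mulrA.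
congr (_ * _); rewrite /block_deg -prodrXr (bigID B) /= [RHS](bigID B) /=.
rewrite mulrAC -big_split /=; congr (_ * _); apply: eq_bigr => k.
  by rewrite /block_scale => ->; rewrite exprMn mulrC.
by rewrite /block_scale => /negPf ->.
Qed.

Lemma block_deg_lt_size p m : m \in msupp p -> (block_deg m < size (block_poly p))%N.
Proof.
move=> mp; rewrite ltnNge; apply/negP => /leq_sizeP/(_ _ (leqnn _))/eqP.
apply/negP; rewrite block_polyE coef_sum.
under eq_bigr => m' _ do rewrite coefCM coefXn.
apply/eqP => /(congr1 (mcoeff m)); rewrite raddf_sum /= mcoeff0.
rewrite (bigD1_seq _ mp (msupp_uniq _)) /= eqxx mulr1 mcoeffZ mcoeffX eqxx mulr1.
rewrite big1 ?addr0 => [/eqP|m' m'm]; first by rewrite mcoeff_eq0 mp.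
case: eqP => _; rewrite ?mulr0 ?mulr1 ?mcoeff0 // mcoeffZ mcoeffX.
by rewrite (negPf m'm) mulr0.
Qed.

Definition line_poly (a b : 'I_M -> K) p : {poly K} :=
  mmap polyC (fun k => (a k)%:P + (b k)%:P * 'X) p.

Lemma line_poly_eval a b p x :
  (line_poly a b p).[x] = p.@[fun k => a k + x * b k].
Proof.
rewrite /line_poly /mmap horner_sum mevalE; apply: eq_bigr => m _.
rewrite hornerCM /mmap1 horner_prod; congr (_ * _); apply: eq_bigr => k _.
by rewrite horner_exp !hornerE mulrC.
Qed.

(** The line moves only in the variables of the block, so its parameter has degree at most the
    degree in the block. *)
Lemma size_line_poly a b p e : (forall k, ~~ B k -> b k = 0) ->
  {in msupp p, forall m, (block_deg m < e)%N} -> (size (line_poly a b p) <= e)%N.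
Proof.
move=> b0 pe; rewrite /line_poly /mmap big_seq.
apply: leq_trans (size_sum _ _ _) _; apply/bigmax_leqP_seq => m _ mp.
apply: leq_trans (pe m mp).
rewrite mul_polyC (leq_trans (size_scale_leq _ _)) //.
have sM (p1 p2 : {poly K}) n1 n2 : (size p1 <= n1.+1)%N -> (size p2 <= n2.+1)%N ->
    (size (p1 * p2)%R <= (n1 + n2).+1)%N.
  by move=> s1 s2; apply: leq_trans (size_polyMleq _ _) _; lia.
rewrite /mmap1 /block_deg [X in (_ <= X.+1)%N]big_mkcond /=.
elim/big_ind2: _ => [|p1 n1 p2 n2|k _]; rewrite ?size_poly1 //.
  by move=> s1 s2; apply: sM.
have s1 : (size ((a k)%:P + (b k)%:P * 'X)%R <= (B k : nat).+1)%N.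
  case: (boolP (B k)) => [_|/b0 ->]; last by rewrite mul0r addr0 size_polyC leq_b1.
  apply: leq_trans (size_polyD _ _) _; rewrite geq_max.
  rewrite (leq_trans (size_polyC_leq1 _)) // mul_polyC.
  by rewrite (leq_trans (size_scale_leq _ _)) // size_polyX.
elim: (m k) => [|n IH]; first by rewrite expr0 size_poly1; case: (B k).
rewrite exprS; move: (sM _ _ _ _ s1 IH).
by case: (B k); rewrite ?add1n ?add0n.
Qed.

End BlockDegree.

Lemma dt_row_scale (K : comNzRingType) (T1 T2 : Type) (x1 : T1) (x2 : T2) r c
    (a : T1 -> K) (M : T1 -> T2 -> K) :
  dt x1 x2 r c (fun x y => a x * M x y) = (\prod_(x <- r) a x) * dt x1 x2 r c M.
Proof.
rewrite (big_nth x1) big_mkord /dt.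
rewrite [X in X * _](_ : _ = \det (diag_mx (\row_(i < size r) a (nth x1 r i)))); last first.
  by rewrite det_diag; apply: eq_bigr => i _; rewrite mxE.
rewrite -det_mulmx; congr (\det _); apply/matrixP => i j.
by rewrite mul_diag_mx !mxE.
Qed.

Lemma dt_morph (K L : comNzRingType) (g : {rmorphism K -> L}) (T1 T2 : Type)
    (x1 : T1) (x2 : T2) r c (M : T1 -> T2 -> K) :
  g (dt x1 x2 r c M) = dt x1 x2 r c (fun x y => g (M x y)).
Proof.
rewrite /dt -det_map_mx; congr (\det _); apply/matrixP => i j.
by rewrite !mxE.
Qed.

(** * Systems of forms and their coefficient vectors *)

Section Forms.

Variables (K : numFieldType) (N d : nat).
Local Notation M := #|coef_index N d|.
Implicit Types (u : 'I_M -> K) (H : 'I_N -> {mpoly K[N]}).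

Definition trivial_zeros H :=
  forall v : 'I_N -> K, (forall j, (H j).@[v] = 0) -> forall l, v l = 0.

Definition form_of u (j : 'I_N) : {mpoly K[N]} :=
  \sum_(m : {m : 'X_{1..N < d.+1} | mdeg m == d})
    u (enum_rank ((j, m) : coef_index N d)) *: 'X_[bmnm (val m)].

Lemma form_of_homog u j : form_of u j \is d.-homog.
Proof.
by apply: rpred_sum => m _; apply: rpredZ; rewrite dhomogX; case: m.
Qed.

Lemma mcoeff_form_of u j m :
  (form_of u j)@_(bmnm (val m)) = u (enum_rank ((j, m) : coef_index N d)).
Proof.
rewrite raddf_sum (bigD1 m) //= mcoeffZ mcoeffX eqxx mulr1 big1 ?addr0 // => m' m'm.
by rewrite mcoeffZ mcoeffX (negPf (_ : _ != _)) ?mulr0.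
Qed.

Lemma form_coefsK u : form_coefs (form_of u) =1 u.
Proof.
by move=> k; rewrite /form_coefs mcoeff_form_of -surjective_pairing enum_valK.
Qed.

Lemma form_ofK H j : (forall i, H i \is d.-homog) -> form_of (form_coefs (d := d) H) j = H j.
Proof.
move=> Hh; apply/mpolyP => m; have [/eqP md|md] := boolP (mdeg m == d); last first.
  by rewrite !(dhomog_nemf_coeff _ md) ?form_of_homog.
have mb : (mdeg m < d.+1)%N by rewrite md.
have mP : mdeg (BMultinom mb) == d by apply/eqP.
rewrite -[m]/(bmnm (val (Sub (BMultinom mb) mP : {m : 'X_{1..N < d.+1} | mdeg m == d}))).
by rewrite mcoeff_form_of /form_coefs enum_rankK.
Qed.

(* Coefficient of ['X_[m]] in [u_j * g], linear in the generic coefficients. *)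
Definition generic_coef (j : 'I_N) (g : {mpoly K[N]}) m0 : {mpoly K[M]} :=
  \sum_(m : {m : 'X_{1..N < d.+1} | mdeg m == d})
    (('X_[bmnm (val m)] * g)@_m0) *: 'X_(enum_rank ((j, m) : coef_index N d)).

Lemma generic_coef_eval j g m0 u : (generic_coef j g m0).@[u] = (form_of u j * g)@_m0.
Proof.
rewrite /generic_coef raddf_sum /form_of mulr_suml raddf_sum; apply: eq_bigr => m _ /=.
by rewrite mevalZ mevalXU -scalerAl mcoeffZ mulrC.
Qed.

Definition in_block (i : 'I_N) (k : 'I_M) := (enum_val k).1 == i.

Lemma generic_coef_block i j g m0 :
  block_poly (in_block i) (generic_coef j g m0) =
  (if j == i then 'X else 1) * (generic_coef j g m0)%:P.
Proof.
rewrite /generic_coef [LHS]raddf_sum rmorph_sum mulr_sumr; apply: eq_bigr => m _ /=.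
rewrite block_polyZ block_polyX /in_block enum_rankK /= mulrCA; congr (_ * _).
by rewrite -mul_mpolyC polyCM.
Qed.

End Forms.

(** * A line of systems with known degenerate members *)

Section Example.

Variables (K : numFieldType) (N d : nat) (i : 'I_N) (d0 : (0 < d)%N).
Local Notation M := #|coef_index N d|.

(** Where the [i]-th coordinate is 1, the forms with [j != i] cut out the grid of points with the
    other coordinates among [0, ..., d - 1]. The form [i] vanishes at a grid point [m] exactly when
    [x] is the weight [\sum_(l | l != i) c l * m l]. *)
Definition ex_forms (c : 'I_N -> K) (x : K) (j : 'I_N) : {mpoly K[N]} :=
  if j == i then x *: 'X_i ^+ d - \sum_(l | l != i) c l *: ('X_l * 'X_i ^+ d.-1)
  else \prod_(k < d) ('X_j - k%:R *: 'X_i).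

Lemma dhomog_prod_linear n (F : 'I_n -> {mpoly K[N]}) :
  (forall k, F k \is 1.-homog) -> \prod_(k < n) F k \is n.-homog.
Proof.
elim: n F => [|n IH] F F1; first by rewrite big_ord0 dhomog1.
by rewrite big_ord_recl; apply: (@dhomogM _ _ _ 1 _ n _) => //; apply: IH.
Qed.

Lemma mpolyX1_homog (j : 'I_N) : ('X_j : {mpoly K[N]}) \is 1.-homog.
Proof. by rewrite dhomogX /= mdeg1. Qed.

Lemma mpolyXn_homog (j : 'I_N) k : ('X_j ^+ k : {mpoly K[N]}) \is k.-homog.
Proof. by have := dhomogMn k (mpolyX1_homog j); rewrite mul1n. Qed.

Lemma ex_forms_homog c x j : ex_forms c x j \is d.-homog.
Proof.
rewrite /ex_forms; case: eqP => _.
  apply: rpredB; first by apply/rpredZ/mpolyXn_homog.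
  apply: rpred_sum => l _; apply: rpredZ.
  have := dhomogM (mpolyX1_homog l) (mpolyXn_homog i d.-1).
  by rewrite add1n prednK.
by apply: dhomog_prod_linear => k; apply: rpredB; rewrite ?rpredZ ?mpolyX1_homog.
Qed.

Lemma ex_forms_degenerate c (m : 'X_{1..N}) :
  (forall j, j != i -> (m j < d)%N) ->
  exists v, (forall j, (ex_forms c (\sum_(l | l != i) c l * (m l)%:R) j).@[v] = 0) /\
    v i != 0.
Proof.
move=> mJ; exists (fun j => if j == i then 1 else (m j)%:R); rewrite eqxx oner_eq0.
split=> // j; rewrite /ex_forms; case: eqP => [_|/eqP ji].
  rewrite mevalB mevalZ meval_exp mevalXU eqxx expr1n mulr1 meval_sum.
  apply/eqP.
  rewrite subr_eq0; apply/eqP; apply: eq_bigr => l /negPf li.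
  by rewrite mevalZ mevalM meval_exp !mevalXU eqxx li expr1n mulr1.
rewrite meval_prod (bigD1 (Ordinal (mJ j ji))) //=.
by rewrite mevalB mevalZ !mevalXU eqxx (negPf ji) mulr1 subrr mul0r.
Qed.

(** The forms with [j != i] force [v j = k * v i] for some [k < d]. Hence [v i = 0] gives [v = 0],
    while [v i != 0] gives a grid point, whose weight is not [x]. *)
Lemma ex_forms_nondegenerate c x :
  (forall kp : {ffun 'I_N -> 'I_d}, x != \sum_(l | l != i) c l * (kp l)%:R) ->
  trivial_zeros (ex_forms c x).
Proof.
move=> xP v v0.
have pj j : j != i -> exists2 k : 'I_d, v j = k%:R * v i & True.
  move=> ji; have := v0 j; rewrite /ex_forms (negPf ji) meval_prod => /eqP.
  rewrite prodf_seq_eq0 => /hasP[k _ /=]; rewrite mevalB mevalZ !mevalXU subr_eq0.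
  by move=> /eqP; exists k.
have vi : v i = 0.
  apply/eqP; apply/negPn/negP => vi.
  have [kp kpP] : exists kp : {ffun 'I_N -> 'I_d}, forall j, j != i -> v j = (kp j)%:R * v i.
    pose k0 := Ordinal d0.
    exists [ffun j => if [pick k : 'I_d | v j == k%:R * v i] is Some k then k else k0].
    move=> j /pj[k vj _]; rewrite ffunE; case: pickP => [k' /eqP //|/(_ k)].
    by rewrite vj eqxx.
  case/negP: (xP kp); apply/eqP.
  have := v0 i; rewrite /ex_forms eqxx mevalB mevalZ meval_exp mevalXU meval_sum.
  move/eqP; rewrite subr_eq0 => /eqP E.
  apply: (mulIf (_ : v i ^+ d != 0)); first by rewrite expf_neq0.
  rewrite E mulr_suml; apply: eq_bigr => l li.
  rewrite mevalZ mevalM meval_exp !mevalXU kpP // -!mulrA -exprS prednK //.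
move=> l; have [->//|li] := eqVneq l i.
by have [k -> _] := pj l li; rewrite vi mulr0.
Qed.

Lemma ex_forms_line c x (k : 'I_M) :
  form_coefs (ex_forms c x) k =
  form_coefs (ex_forms c 0) k + x * (if in_block i k then
    ('X_i ^+ d : {mpoly K[N]})@_(bmnm (val (enum_val k).2)) else 0).
Proof.
rewrite /form_coefs /ex_forms /in_block; case: eqP => _; last by rewrite mulr0 addr0.
by rewrite !mcoeffB scale0r mcoeff0 mcoeffZ sub0r addrC.
Qed.

(** Two distinct elements of [s] differ in a coordinate other than [i], so the difference of their
    weights is a nonzero linear form in [c]; a common non-root of these forms separates [s]. *)
Lemma separating_weights (s : seq 'X_{1..N}) : uniq s ->
  {in s &, forall m m' : 'X_{1..N}, (forall j, j != i -> m j = m' j) -> m = m'} ->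
  exists c : 'I_N -> K, {in s &, injective (fun m : 'X_{1..N} => \sum_(l | l != i) c l * (m l)%:R)}.
Proof.
move=> us sJ.
pose L (m m' : 'X_{1..N}) : {mpoly K[N]} := \sum_(l | l != i) ((m l)%:R - (m' l)%:R) *: 'X_l.
have : \prod_(m <- s) \prod_(m' <- s | m' != m) L m m' != 0.
  rewrite prodf_seq_neq0; apply/allP => m ms /=.
  rewrite prodf_seq_neq0; apply/allP => m' ms'; apply/implyP => mm'.
  apply: contraNneq mm' => L0; apply/eqP/sJ => // j ji.
  have /(congr1 (mcoeff U_(j))) := L0; rewrite /L raddf_sum /= mcoeff0.
  rewrite (bigD1 j) //= mcoeffZ mcoeffXU eqxx mulr1 big1 ?addr0 => [/eqP|l /andP[_ lj]].
    by rewrite subr_eq0 eqr_nat eq_sym => /eqP.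
  by rewrite mcoeffZ mcoeffXU (negPf lj) mulr0.
case/mpoly_nonroot => c; rewrite meval_prod prodf_seq_neq0 => /allP cP.
exists c => m m' ms ms' E; apply/eqP; apply/negPn/negP => mm'.
have /= := cP m ms; rewrite meval_prod prodf_seq_neq0 => /allP/(_ m' ms').
rewrite eq_sym mm' /= => /negP[]; rewrite /L meval_sum.
under eq_bigr => l _ do rewrite mevalZ mevalXU mulrBl ![_%:R * _]mulrC.
by rewrite sumrB subr_eq0; apply/eqP.
Qed.

End Example.

(** * Poisson's formula for the resultant *)

Lemma size_cofactor (A : idomainType) (p q r : {poly A}) e : r = p * q -> r != 0 ->
  size r = e.+1 -> (e < size p)%N -> (size q <= 1)%N.
Proof.
move=> ->; rewrite mulf_eq0 negb_or => /andP[p0 q0]; rewrite size_mul //.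
by move: (size p) (size q) => x y; lia.
Qed.

Section Poisson.

Variables (K : numClosedFieldType) (N d : nat) (d0 : (0 < d)%N).
Local Notation M := #|coef_index N d|.
Variable Rs : {mpoly K[M]}.
Hypothesis Rs_irr : irreducible_elt Rs.
Hypothesis Rs_zero : forall H : 'I_N -> {mpoly K[N]},
  (forall i, H i \is d.-homog) ->
  (Rs.@[form_coefs (d := d) H] != 0 <-> trivial_zeros H).

Variables (i : 'I_N) (t : nat).
Local Notation red := (rmonos d (~: [set i])).
Hypothesis t_large : {in red t, forall m : 'X_{1..N}, (d <= m i)%N}.

Lemma red_inj : {in red t &, forall m m' : 'X_{1..N},
  (forall j, j != i -> m j = m' j) -> m = m'}.
Proof.
move=> m m'; rewrite !mem_rmonos => /andP[/eqP mt _] /andP[/eqP mt' _] E.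
apply/mnmP => j; have [->|/E //] := eqVneq j i.
move: mt; rewrite -mt' !mdegE (bigD1 i) //= [RHS](bigD1 i) //=.
by rewrite (eq_bigr (fun j => m' j)) => [/addIn|l /E].
Qed.

Lemma red_lt m j : m \in red t -> j != i -> (m j < d)%N.
Proof.
by rewrite mem_rmonos => /andP[_ /forall_inP H] ji; apply: H; rewrite !inE.
Qed.

(* Interpolation gives as many zeros as there are reduced monomials, so the
   degree of the resultant in the [i]-th form is at least their number. *)
Lemma resultant_block_deg : (size (red t) < size (block_poly (in_block i) Rs))%N.
Proof.
have [c cI] := @separating_weights K N i _ (rmonos_uniq _ _ _) red_inj.
pose a := form_coefs (d := d) (ex_forms d i c 0).
pose b (k : 'I_M) : K := if in_block i k then
    ('X_i ^+ d : {mpoly K[N]})@_(bmnm (val (enum_val k).2)) else 0.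
pose q := line_poly a b Rs.
have qE x : q.[x] = Rs.@[form_coefs (d := d) (ex_forms d i c x)].
  by rewrite line_poly_eval; apply: meval_eq => k; rewrite [RHS]ex_forms_line.
have q0 : q != 0.
  (* The roots of [P] are the weights of all grid points; any other parameter gives a regular
     system, so the resultant is not identically zero on the line. *)
  pose P : {poly K} := \prod_(kp : {ffun 'I_N -> 'I_d})
    ('X - (\sum_(l | l != i) c l * (kp l)%:R)%:P).
  have /poly_nonroot[x] : P != 0.
    by rewrite prodf_seq_neq0; apply/allP => kp _ /=; rewrite polyXsubC_eq0.
  rewrite horner_prod prodf_seq_neq0 => /allP xP.
  have : Rs.@[form_coefs (d := d) (ex_forms d i c x)] != 0.
    apply/(Rs_zero (ex_forms_homog i d0 c x))/ex_forms_nondegenerate => // kp.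
    by have := xP kp (mem_index_enum _); rewrite /= hornerXsubC subr_eq0.
  by rewrite -qE; apply: contraNneq => ->; rewrite horner0.
have sq : (size (red t) < size q)%N.
  rewrite -(size_map (fun m : 'X_{1..N} => \sum_(l | l != i) c l * (m l)%:R)).
  apply: max_poly_roots => //.
    apply/allP => _ /mapP[m mt ->]; apply/rootP; rewrite qE.
    apply/eqP; apply/negPn/negP => R0.
    have nd := (Rs_zero (ex_forms_homog i d0 c _)).1 R0.
    have [|v [v0 /eqP]] := @ex_forms_degenerate K N d i c m; last by apply; apply: nd.
    by move=> j; apply: red_lt.
  by rewrite map_inj_in_uniq ?rmonos_uniq.
rewrite ltnNge; apply/negP => sB; move: sq; rewrite ltnNge => /negP[].
apply: (@size_line_poly _ _ (in_block i)) => [k /negPf kB|m /block_deg_lt_size/leq_trans]; last exact.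
by rewrite /b kB.
Qed.

Variables (f : 'X_{1..N} -> {mpoly K[N]}) (co : {mpoly K[N]} -> 'X_{1..N} -> K).
Variables G H : 'I_N -> {mpoly K[N]}.
Hypothesis fB : hbasis f co.
Hypothesis fG : forall m j, f (mshift d j m) = G j * f m.
Hypothesis f0 : coef_dt f t != 0.
Hypothesis Gh : forall j, G j \is d.-homog.
Hypothesis Hh : forall j, H j \is d.-homog.
Hypothesis GH : forall j, j != i -> H j = G j.

(** Macaulay's choice of one form per monomial: the form [i] serves only the monomials reduced in
    all other directions, hence exactly [size (red t)] rows. For the other monomials of degree [t]
    the [pick] succeeds. *)
Definition red_dir (m : 'X_{1..N}) : 'I_N :=
  if m \in red t then i else odflt i [pick j | (j != i) && (d <= m j)%N].

Lemma red_dir_le m : m \in monos_eq N t -> (d <= m (red_dir m))%N.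
Proof.
rewrite mem_monos_eq /red_dir => mt; case: ifP => [/t_large //|].
rewrite mem_rmonos mt /= => /negbT; rewrite negb_forall => /existsP[j].
rewrite !inE negb_imply -leqNgt => jP.
by case: pickP => [l /andP[]|/(_ j)]; rewrite ?jP.
Qed.

Lemma red_dir_neq m : m \in monos_eq N t -> (red_dir m == i) = (m \in red t).
Proof.
rewrite mem_monos_eq /red_dir => mt; case: ifP => [_|]; first by rewrite eqxx.
rewrite mem_rmonos mt /= => /negbT; rewrite negb_forall => /existsP[j].
rewrite !inE negb_imply -leqNgt => jP.
by case: pickP => [l /andP[/negPf]|/(_ j)]; rewrite ?jP.
Qed.

Let row (u : 'I_M -> K) m := form_of u (red_dir m) * f (munshift d (red_dir m) m).

Lemma row_homog u m : m \in monos_eq N t -> row u m \is t.-homog.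
Proof.
move=> mt; have dm := red_dir_le mt; rewrite mem_monos_eq in mt.
have dt' : (d <= t)%N by rewrite -(eqP mt); apply: leq_trans dm (mnm_le_mdeg _ _).
have := dhomogM (form_of_homog u (red_dir m)) (hb_homog fB (munshift d (red_dir m) m)).
have -> : mdeg (munshift d (red_dir m) m) = (t - d)%N.
  by apply: mdeg_munshift dm _; rewrite subnK // (eqP mt).
by rewrite subnKC.
Qed.

Definition poisson_det : {mpoly K[M]} :=
  dt 0%MM 0%MM (monos_eq N t) (monos_eq N t) (fun m m' =>
    generic_coef d (red_dir m) (f (munshift d (red_dir m) m)) m').

Lemma poisson_detE u : poisson_det.@[u] = coef_dt (row u) t.
Proof.
rewrite /poisson_det (dt_morph (meval u)); apply: eq_dt_in => // m m' _ _.
exact: generic_coef_eval.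
Qed.

(** The values of the monomials at the common zero [v] form a vector killed by every row; its entry
    at the pure power of the variable [l] is nonzero. *)
Lemma poisson_det_degenerate u v l :
  (forall j, (form_of u j).@[v] = 0) -> v l != 0 -> poisson_det.@[u] = 0.
Proof.
move=> uv vl; rewrite poisson_detE /coef_dt; set s := monos_eq N t.
apply/eqP; rewrite /dt -det_tr; apply/det0P.
exists (\row_(k < size s) ('X_[nth 0%MM s k] : {mpoly K[N]}).@[v]).
  have ls : (U_(l) *+ t)%MM \in s by rewrite mem_monos_eq mdegMn mdeg1 mul1n.
  have li : (index (U_(l) *+ t)%MM s < size s)%N by rewrite index_mem.
  apply/eqP => /rowP/(_ (Ordinal li)); rewrite !mxE /= nth_index // -mpolyXn.
  by rewrite meval_exp mevalXU => /eqP; rewrite expf_eq0 (negPf vl) andbF.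
apply/rowP => k; rewrite !mxE.
have ks : nth 0%MM s k \in s by rewrite mem_nth.
transitivity ((row u (nth 0%MM s k)).@[v]); last by rewrite mevalM uv mul0r.
rewrite [in RHS](homogE_monos (row_homog u ks)) meval_sum (big_nth 0%MM) big_mkord.
by apply: eq_bigr => j _; rewrite !mxE mevalZ mulrC.
Qed.

(** Each row is linear in the coefficients of a single form, and the form [i] is used exactly in the
    rows of [red t]. *)
Lemma poisson_det_block :
  block_poly (in_block i) poisson_det = 'X^(size (red t)) * poisson_det%:P.
Proof.
pose bp := (block_poly (in_block (d := d) i) :
  {rmorphism {mpoly K[M]} -> {poly {mpoly K[M]}}}).
pose pc := (polyC : {rmorphism {mpoly K[M]} -> {poly {mpoly K[M]}}}).
pose s := monos_eq N t.
pose A m m' := generic_coef d (red_dir m) (f (munshift d (red_dir m) m)) m'.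
transitivity (dt 0%MM 0%MM s s (fun m m' => bp (A m m'))).
  exact: (dt_morph bp 0%MM 0%MM s s A).
transitivity ('X^(size (red t)) * dt 0%MM 0%MM s s (fun m m' => pc (A m m'))); last first.
  by congr (_ * _); rewrite -(dt_morph pc 0%MM 0%MM s s A).
transitivity (dt 0%MM 0%MM s s (fun m m' =>
    (if red_dir m == i then 'X else 1) * pc (A m m'))).
  by apply: eq_dt_in => // m m' _ _; apply: generic_coef_block.
rewrite dt_row_scale; congr (_ * _).
rewrite -big_mkcond /= big_seq_cond -big_filter big_const_seq count_predT.
rewrite iter_mulr_1; congr ('X^ _).
rewrite size_filter /rmonos size_filter; apply: eq_in_count => m mt /=.
by rewrite mt red_dir_neq // mem_rmonos -mem_monos_eq mt.
Qed.

Lemma poisson_G : poisson_det.@[form_coefs (d := d) G] = coef_dt f t.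
Proof.
rewrite poisson_detE; apply: eq_dt_in => // m m' mt _.
by rewrite /row form_ofK // -fG munshiftK // red_dir_le.
Qed.

(** Rows using a form other than [i] are basis vectors, because [H] and [G] agree there; what
    remains is multiplication by [H i] modulo the other forms. *)
Lemma poisson_H : `|poisson_det.@[form_coefs (d := d) H]| =
  `|dt 0%MM 0%MM (red t) (red t) (fun m m' => co (H i * f (munshift d i m)) m')| *
  `|coef_dt f t|.
Proof.
rewrite poisson_detE (coef_dt_change fB (row_homog _)) normrM; congr (_ * _).
pose nred := [seq m <- monos_eq N t | m \notin red t].
have pR : perm_eq (monos_eq N t) (red t ++ nred).
  have -> : red t = [seq m <- monos_eq N t | m \in red t].
    by apply: eq_in_filter => m mt; rewrite mem_rmonos -mem_monos_eq mt.
  by rewrite perm_sym; apply/permPl/perm_filterC.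
rewrite (ndt_perm _ _ _ _ pR) (ndt_permC _ _ _ _ pR); last by rewrite -(perm_size pR).
have rowE m : m \in nred -> row (form_coefs (d := d) H) m = f m.
  rewrite mem_filter => /andP[mR mt]; rewrite /row form_ofK // GH.
    by rewrite -fG munshiftK // red_dir_le.
  by rewrite red_dir_neq.
rewrite dt_cat' // => [|m m' mn mR]; last first.
  rewrite rowE // (hb_delta fB) (negPf (_ : m != m')) //.
  by apply: contraTneq mR => <-; move: mn; rewrite mem_filter => /andP[].
rewrite normrM [X in _ * `|X|](_ : _ = 1); last first.
  rewrite -(dt_delta K 0%MM 0%MM (r := nred)) ?(filter_uniq _ (monos_eq_uniq _ _)) //.
  by apply: eq_dt_in => // m m' mn _; rewrite rowE // (hb_delta fB).
rewrite normr1 mulr1; congr `|_|; apply: eq_dt_in => // m m' mR _.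
have mt : m \in monos_eq N t by move: mR; rewrite mem_rmonos -mem_monos_eq => /andP[].
by rewrite /row form_ofK // (eqP (_ : red_dir m == i)) // red_dir_neq.
Qed.

(** By the Nullstellensatz [Rs] divides [poisson_det]. In the coefficients of the form [i] the
    latter has degree [size (red t)] and [Rs] has at least this degree, so the cofactor [T] does not
    involve them and takes the same value at [G] and [H]. *)
Theorem poisson_formula :
  `|dt 0%MM 0%MM (red t) (red t) (fun m m' => co (H i * f (munshift d i m)) m')| *
  `|Rs.@[form_coefs (d := d) G]| = `|Rs.@[form_coefs (d := d) H]|.
Proof.
have [T E] : dvd_elt Rs poisson_det.
  apply: hypersurface_nullstellensatz Rs_irr _ => u Ru.
  apply: NNPP => nu; have : Rs.@[form_coefs (d := d) (form_of u)] != 0.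
    apply/(Rs_zero (form_of_homog u)) => v uv l; apply: NNPP => vl; apply: nu.
    by apply: poisson_det_degenerate uv _; apply/eqP; exact: vl.
  by rewrite (meval_eq _ (form_coefsK u)) Ru eqxx.
have n0 : poisson_det.@[form_coefs (d := d) G] != 0 by rewrite poisson_G.
have T0 : T != 0 by apply: contraNneq n0 => T0; rewrite E T0 mulr0 meval0.
have pd0 : poisson_det != 0 by apply: contraNneq n0 => ->; rewrite meval0.
pose B := in_block (d := d) i.
have BE : block_poly B poisson_det = block_poly B Rs * block_poly B T.
  by rewrite E block_polyM.
have sE : size (block_poly B poisson_det) = (size (red t)).+1.
  by rewrite poisson_det_block mulrC size_mulXn ?polyC_eq0 // size_polyC pd0 addn1.
have BR0 : block_poly B poisson_det != 0 by rewrite -size_poly_gt0 sE.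
have sT := size_cofactor BE BR0 sE resultant_block_deg.
have TE u x : T.@[block_scale B x u] = ((block_poly B T)`_0).@[u].
  by rewrite -block_poly_eval {1}(size1_polyC sT) map_polyC hornerC.
(* Setting the coefficients of the form [i] to zero leaves [T] unchanged and makes the two systems
   coincide. *)
have TT : T.@[form_coefs (d := d) H] = T.@[form_coefs (d := d) G].
  have s1 u : T.@[u] = T.@[block_scale B 0 u].
    rewrite TE -(TE u 1); apply: meval_eq => k.
    by rewrite /block_scale mul1r if_same.
  rewrite s1 [RHS]s1; apply: meval_eq => k; rewrite /block_scale.
  by case: ifPn => kB; rewrite ?mul0r // /form_coefs GH.
have EG := congr1 (meval (form_coefs (d := d) G)) E.
have EH := congr1 (meval (form_coefs (d := d) H)) E.
move: EG EH; rewrite poisson_G !mevalM TT => EG EH.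
have TG0 : `|T.@[form_coefs (d := d) G]| != 0.
  rewrite normr_eq0; apply: contraNneq f0; rewrite EG => ->.
  by rewrite mulr0.
apply: (mulIf TG0); rewrite -mulrA -!normrM -EG normrM -poisson_H EH.
by rewrite !normrM.
Qed.

End Poisson.

(** * Determinants of the bases of box type *)

(** The new rows [C] are a basis of a complement of the row space of [A]; the hypothesis on sizes
    says that there are as many as [r1] asks for. *)
Lemma dt_complete_rows (K : fieldType) (T : eqType) (x0 : T) (r1 r2 c : seq T)
    (A : T -> T -> K) : uniq (r1 ++ r2) -> uniq c ->
  (size r1 + size r2)%N = size c ->
  (forall x : T -> K, {in c, forall y, \sum_(m <- r2) x m * A m y = 0} ->
     {in r2, forall m, x m = 0}) ->
  exists C : T -> T -> K,
    dt x0 x0 (r1 ++ r2) c (fun m y => if m \in r2 then A m y else C m y) != 0.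
Proof.
rewrite cat_uniq => /and3P[u1 /hasPn u12 u2] uc sc Ainj.
pose n := (size r1 + size r2)%N.
pose A' := \matrix_(i < size r2, j < n) A (nth x0 r2 i) (nth x0 c j).
have Af : row_free A'.
  apply: inj_row_free => v vA; apply/rowP => k; rewrite mxE.
  pose x m := \sum_(l < size r2) v 0 l * (nth x0 r2 l == m)%:R.
  have xE (l : 'I_(size r2)) : x (nth x0 r2 l) = v 0 l.
    rewrite /x (bigD1 l) //= eqxx mulr1 big1 ?addr0 // => l' ll'.
    by rewrite nth_uniq // (negPf (_ : l' != l :> nat)) ?mulr0.
  rewrite -xE; apply: Ainj; last exact: mem_nth.
  move=> y yc; have yn : (index y c < n)%N by rewrite /n sc index_mem.
  have /rowP/(_ (Ordinal yn)) := vA; rewrite !mxE => E; rewrite -[RHS]E.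
  rewrite (big_nth x0) big_mkord; apply: eq_bigr => l _.
  by rewrite xE mxE /= nth_index.
have rk : \rank (A'^C)%MS = size r1.
  by rewrite mxrank_compl (eqP Af) /n addnK.
pose C0 := castmx (rk, erefl n) (row_base (A'^C)%MS).
exists (fun m y => \sum_(k < size r1) \sum_(l < n) C0 k l *
  (nth x0 r1 k == m)%:R * (nth x0 c l == y)%:R).
rewrite (dtE x0 x0 c _ (size_cat r1 r2)) -unitfE -unitmxE -/n.
rewrite (_ : \matrix_(i, j) _ = col_mx C0 A'); last first.
  apply/matrixP => k l; rewrite !mxE; case: splitP => k' kE.
    rewrite nth_cat kE ltn_ord; case: ifP => [h|_].
      by have := u12 _ h; rewrite mem_nth.
    rewrite (bigD1 k') //= (bigD1 l) //= !eqxx !mulr1.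
    rewrite [X in _ + X + _]big1 ?[X in _ + X]big1 ?addr0 //.
      move=> k2 kk; rewrite big1 // => l2 _; rewrite nth_uniq //.
      by rewrite (negPf (_ : k2 != k' :> nat)) ?mulr0 ?mul0r.
    move=> l2 ll; rewrite [X in _ * X](_ : _ = 0) ?mulr0 //.
    by rewrite nth_uniq -?sc // (negPf (_ : l2 != l :> nat)).
  by rewrite nth_cat kE ltnNge leq_addr /= addKn mem_nth // mxE.
rewrite -row_full_unit -sub1mx; apply: submx_trans (_ : (1%:M <= A' + A'^C)%MS) _.
  by rewrite sub1mx addsmx_compl_full.
by rewrite -addsmxE addsmxC addsmxS // eqmx_cast eq_row_base.
Qed.

Section BasisOfBox.

Variables (K : numFieldType) (N d : nat) (d0 : (0 < d)%N).
Implicit Types (a : 'X_{1..N} -> {mpoly K[N]}) (H : 'I_N -> {mpoly K[N]}).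

Definition mbox (m : 'X_{1..N}) := [multinom (m j %% d)%N | j < N].
Definition mquo (m : 'X_{1..N}) := [multinom (m j %/ d)%N | j < N].

Lemma mbox_quo m : m = (mbox m + mquo m *+ d)%MM.
Proof. by apply/mnmP => j; rewrite mnmDE mulmnE !mnmE addnC -divn_eq. Qed.

Definition power_prod H (b : 'X_{1..N}) := \prod_j H j ^+ b j.

(* Writing [m = s + d b] with [s] in the box [s_j < d], the basis vector of index
   [m] is [a_s H^b]: the [a_s] generate the polynomials freely over K[H]. *)
Definition box_basis a H m := a (mbox m) * power_prod H (mquo m).

Lemma box_basis_shift a H j m : box_basis a H (mshift d j m) = H j * box_basis a H m.
Proof.
rewrite /box_basis mulrCA; congr (_ * _).
  congr a; apply/mnmP => l; rewrite [LHS]mnmE [RHS]mnmE mshiftE.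
  by case: (j == l); rewrite ?mul1n ?modnDr ?addn0.
rewrite /power_prod (bigD1 j) //= [in RHS](bigD1 j) //= mulrA -exprS; congr (_ * _).
  by rewrite /mquo mnmE [in RHS]mnmE mshiftE eqxx mul1n divnDr ?dvdnn // divnn d0 addn1.
apply: eq_bigr => l lj; rewrite /mquo mnmE [in RHS]mnmE mshiftE.
by rewrite eq_sym (negPf lj) addn0.
Qed.

Lemma box_basis_box a H (m : 'X_{1..N}) : (forall j, (m j < d)%N) -> box_basis a H m = a m.
Proof.
move=> mb; rewrite /box_basis /power_prod big1 ?mulr1 => [|j _].
  by congr a; apply/mnmP => j; rewrite mnmE modn_small.
by rewrite mnmE divn_small.
Qed.

Lemma power_prod_homog H b e : (forall j, H j \is e.-homog) ->
  power_prod H b \is (mdeg b * e).-homog.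
Proof.
move=> Hh; rewrite /power_prod mdegE big_distrl /=.
elim/big_ind2: _ => [|p n q n' pn qn|j _]; first exact: dhomog1.
  exact: dhomogM.
by rewrite mulnC; apply: dhomogMn.
Qed.

Lemma box_basis_homog a H m : (forall s, a s \is (mdeg s).-homog) ->
  (forall j, H j \is d.-homog) -> box_basis a H m \is (mdeg m).-homog.
Proof.
move=> ah Hh; rewrite {2}[m]mbox_quo mdegD mdegMn.
by apply: dhomogM => //; apply: power_prod_homog.
Qed.

End BasisOfBox.

(** * Exchanging one form of a system *)

Section Exchange.

Variables (K : numClosedFieldType) (N d : nat) (d0 : (0 < d)%N).
Local Notation M := #|coef_index N d|.
Variable Rs : {mpoly K[M]}.
Hypothesis Rs_irr : irreducible_elt Rs.
Hypothesis Rs_zero : forall H : 'I_N -> {mpoly K[N]},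
  (forall i, H i \is d.-homog) ->
  (Rs.@[form_coefs (d := d) H] != 0 <-> trivial_zeros H).

Variable i : 'I_N.
Local Notation red := (rmonos d (~: [set i])).

(** Otherwise all exponents are below [d], which bounds the degree by [N * (d - 1)]. *)
Lemma rmonos_large t : (N * d <= t)%N -> {in red t, forall m : 'X_{1..N}, (d <= m i)%N}.
Proof.
move=> Nt m; rewrite mem_rmonos => /andP[/eqP mt /forall_inP mJ].
rewrite leqNgt; apply/negP => mi; move: Nt; rewrite -mt leqNgt => /negP[].
have N0 : (0 < N)%N by case: (N) i => [[]|].
rewrite mdegE; apply: leq_ltn_trans (_ : (\sum_(j < N) d.-1 < _)%N).
  apply: leq_sum => j _; rewrite -ltnS prednK //.
  by have [->//|ji] := eqVneq j i; apply: mJ; rewrite !inE.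
by rewrite big_const_ord iter_addn_0 mulnC ltn_pmul2l // ltn_predL.
Qed.

Variables (a : 'X_{1..N} -> {mpoly K[N]}) (G H : 'I_N -> {mpoly K[N]}).
Variable co : {mpoly K[N]} -> 'X_{1..N} -> K.
Let f := box_basis d a G.
Hypothesis fB : hbasis f co.
Hypothesis f0 : forall k, coef_dt f k != 0.
Hypothesis Gh : forall j, G j \is d.-homog.
Hypothesis Hh : forall j, H j \is d.-homog.
Hypothesis GH : forall j, j != i -> H j = G j.
Hypothesis Gn : trivial_zeros G.
Hypothesis Hn : trivial_zeros H.

Let fG m j : f (mshift d j m) = G j * f m.
Proof. exact: box_basis_shift. Qed.

Let iJ : i \notin ~: [set i].
Proof. by rewrite !inE eqxx. Qed.

Let box t : seq 'X_{1..N} := rmonos d (i |: ~: [set i]) t.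

Lemma mem_box t (m : 'X_{1..N}) : (m \in box t) = (mdeg m == t) && [forall j, (m j < d)%N].
Proof.
rewrite mem_rmonos; congr (_ && _); apply/forallP/forallP => mJ j.
  by have /implyP := mJ j; apply; rewrite !inE; case: (j == i).
exact/implyP.
Qed.

Lemma red_box_lt t (m : 'X_{1..N}) : m \in red t -> m \notin box t -> (d <= m i)%N.
Proof.
rewrite mem_rmonos mem_box => /andP[-> /forall_inP mJ] /= /forallPn[j].
rewrite -leqNgt; have [->//|ji] := eqVneq j i.
by rewrite leqNgt mJ // !inE.
Qed.

Lemma homog_Hf m t : mdeg m = t -> H i * f m \is (t + d).-homog.
Proof. by move=> <-; rewrite addnC; apply: dhomogM (Hh i) (hb_homog fB m). Qed.

(* Multiplication by [H i] is injective modulo the other forms: after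
   multiplying by a large power of [G i], this is the Poisson formula. *)
Lemma mul_red_inj t (x : 'X_{1..N} -> K) :
  {in red (t + d)%N, forall y, \sum_(m <- red t) x m * co (H i * f m) y = 0} ->
  {in red t, forall m, x m = 0}.
Proof.
have RG : Rs.@[form_coefs (d := d) G] != 0 by apply/Rs_zero.
have RH : Rs.@[form_coefs (d := d) H] != 0 by apply/Rs_zero.
(* In these degrees the box is empty, the matrix is square, and its determinant has norm the nonzero
   quotient of the two resultants. *)
have large k : (N * d <= k)%N -> forall z : 'X_{1..N} -> K,
  {in red (k + d)%N, forall y, \sum_(m <- red k) z m * co (H i * f m) y = 0} ->
  {in red k, forall m, z m = 0}.
  move=> Nk z zP m mk.
  have kd := leq_trans Nk (leq_addr d k).
  have tl := rmonos_large kd.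
  have := poisson_formula d0 Rs_irr Rs_zero tl fB fG (f0 _) Gh Hh GH.
  set D := dt _ _ _ _ _ => DE.
  have D0 : D != 0.
    rewrite -normr_eq0; apply: contraNneq RH => D0; move: DE; rewrite D0 mul0r.
    by move/esym/eqP; rewrite normr_eq0.
  pose s := red (k + d)%N.
  have us : uniq s by apply: rmonos_uniq.
  have bx : box (k + d) = [::].
    apply/eqP; rewrite -size_eq0 -all_pred0; apply/allP => m' /=.
    rewrite mem_box => /andP[m'k /forallP mb].
    have : m' \in s by rewrite mem_rmonos m'k; apply/forall_inP.
    by move=> /tl; rewrite leqNgt mb.
  have ps : perm_eq s (map (mshift d i) (red k)).
    by have := rmonos_split d k iJ; rewrite -/(box _) bx.
  apply/eqP; apply/negPn/negP => zm; case/negP: D0; apply/det0P.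
  exists (\row_(l < size s) z (munshift d i (nth 0%MM s l))).
    have ms : mshift d i m \in s by rewrite (perm_mem ps) map_f.
    have li : (index (mshift d i m) s < size s)%N by rewrite index_mem.
    apply: contraNneq zm => /rowP/(_ (Ordinal li)).
    by rewrite !mxE /= nth_index // mshiftK => ->.
  apply/rowP => l; rewrite !mxE.
  have ls : nth 0%MM s l \in s by rewrite mem_nth.
  rewrite -[RHS](zP _ ls).
  transitivity (\sum_(m' <- s) z (munshift d i m') *
      co (H i * f (munshift d i m')) (nth 0%MM s l)).
    by rewrite (big_nth 0%MM) big_mkord; apply: eq_bigr => j _; rewrite !mxE.
  by rewrite (perm_big _ ps) /= big_map; apply: eq_bigr => m' _; rewrite mshiftK.
suff down s k : (forall z : 'X_{1..N} -> K,
    {in red (k + s * d + d)%N, forall y, \sum_(m <- red (k + s * d)%N) z m * co (H i * f m) y = 0} ->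
    {in red (k + s * d)%N, forall m, z m = 0}) -> forall z : 'X_{1..N} -> K,
    {in red (k + d)%N, forall y, \sum_(m <- red k) z m * co (H i * f m) y = 0} ->
    {in red k, forall m, z m = 0}.
  apply: (down N); apply: large; exact: leq_addl.
elim: s k => [|s IH] k; first by rewrite mul0n addn0.
rewrite mulSn addnA => Hs z zP.
have {Hs IH} Hs := IH _ Hs.
(* Coordinates of [G i] times the element with coordinates [z]: the hypothesis passes from degree
   [k] to degree [k + d]. *)
pose z' (m : 'X_{1..N}) := if (d <= m i)%N then z (munshift d i m) else 0.
suff z'0 : {in red (k + d)%N, forall m, z' m = 0}.
  move=> m mk; have := z'0 (mshift d i m); rewrite /z' mshiftK mshiftE eqxx mul1n leq_addl.
  by apply; rewrite (perm_mem (rmonos_split d k iJ)) mem_cat map_f ?orbT.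
apply: Hs => y; rewrite mem_rmonos => /andP[/eqP yk /forall_inP yJ].
rewrite (perm_big _ (rmonos_split d k iJ)) /= big_cat big_map /=.
rewrite big_seq big1 ?add0r => [|m]; last first.
  rewrite mem_rmonos => /andP[_ /forall_inP/(_ i)]; rewrite !inE eqxx => /(_ isT) mi.
  by rewrite /z' leqNgt mi mul0r.
transitivity (\sum_(m <- red k) z m *
  (if (d <= y i)%N then co (H i * f m) (munshift d i y) else 0)).
  rewrite !big_seq; apply: eq_bigr => m; rewrite mem_rmonos => /andP[/eqP mk _].
  rewrite /z' mshiftE eqxx mul1n leq_addl mshiftK; congr (_ * _).
  by rewrite fG mulrCA (co_mul fB fG _ _ (homog_Hf mk)).
case: (leqP d (y i)) => yi; last by rewrite big1 // => m _; rewrite mulr0.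
apply: zP; rewrite mem_rmonos (mdeg_munshift yi yk) eqxx.
by apply/forall_inP => j jJ; apply: leq_ltn_trans (yJ j jJ); rewrite mnmBE leq_subr.
Qed.

Let shifted t := if (d <= t)%N then map (mshift d i) (red (t - d)%N) else [::].

Let red_perm t : perm_eq (red t) (box t ++ shifted t).
Proof.
rewrite /shifted; case: leqP => dt'; last by rewrite cats0 /box rmonos_small.
by have := rmonos_split d (t - d)%N iJ; rewrite subnK.
Qed.

Let mem_shifted t (m : 'X_{1..N}) : m \in red t -> (m \in shifted t) = (d <= m i)%N.
Proof.
move=> mt; apply/idP/idP => [|mi].
  by rewrite /shifted; case: ifP => // _ /mapP[m' _ ->]; rewrite mshiftE eqxx mul1n leq_addl.
move: (mt); rewrite (perm_mem (red_perm t)) mem_cat => /orP[|//].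
by rewrite mem_box => /andP[_ /forallP/(_ i)]; rewrite ltnNge mi.
Qed.

(** The rows of multiplication by [H i] are independent by [mul_red_inj]. The completing rows [C],
    one for each box monomial, become the coordinates of the new [a']. *)
Lemma exchange_completion : exists C : nat -> 'X_{1..N} -> 'X_{1..N} -> K, forall t,
  dt 0%MM 0%MM (red t) (red t) (fun m y =>
    if (d <= m i)%N then co (H i * f (munshift d i m)) y else C t m y) != 0.
Proof.
suff /choice[C CP] : forall t, exists C : 'X_{1..N} -> 'X_{1..N} -> K,
    dt 0%MM 0%MM (red t) (red t) (fun m y =>
    if (d <= m i)%N then co (H i * f (munshift d i m)) y else C m y) != 0.
  by exists C.
move=> t.
have pt := red_perm t.
have uR : uniq (red t) by apply: rmonos_uniq.
have [||||C CP] := @dt_complete_rows K _ 0%MM (box t) (shifted t) (red t)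
    (fun m y => co (H i * f (munshift d i m)) y).
- by rewrite -(perm_uniq pt).
- by [].
- by rewrite -size_cat (perm_size pt).
- move=> x xP; rewrite /shifted; case: leqP => dt' // _ /mapP[m mt ->].
  apply: (mul_red_inj (x := fun m => x (mshift d i m))) mt => y.
  rewrite subnK // => /xP; rewrite /shifted dt' big_map => E; rewrite -[RHS]E.
  by apply: eq_bigr => m' _; rewrite mshiftK.
exists C; rewrite -normr_eq0 (ndt_perm _ _ _ _ pt) normr_eq0; apply: contraNneq CP => E.
rewrite -[X in _ == X]E; apply/eqP/eq_dt_in; first by rewrite -(perm_size pt).
by move=> m y; rewrite -(perm_mem pt) => mt _; rewrite mem_shifted.
Qed.

(** [D J t] is the norm of the determinant from [f] to [f'] in degree [t] modulo the forms of [J].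
    Adding to [J] a form with [H j = G j] splits it along the exact sequence of multiplication. When
    only the form [i] is left, replacing [G i] by [H i] contributes the factor [q t], which in large
    degrees is the quotient of the resultants by Poisson's formula. *)
Theorem exchange : exists (a' : 'X_{1..N} -> {mpoly K[N]}) co'
    (D : {set 'I_N} -> nat -> K) (q : nat -> K),
  let f' := box_basis d a' H in
  [/\ (forall s, a' s \is (mdeg s).-homog) /\ hbasis f' co',
      [/\ forall t, 0 < q t, forall (J : {set 'I_N}) t, i \notin J -> 0 < D J t &
       forall t, D (~: [set i]) t =
         q t * (if (d <= t)%N then D (~: [set i]) (t - d)%N else 1)],
      forall (J : {set 'I_N}) j t, j \notin J -> j != i ->
        D J t = D (j |: J) t * (if (d <= t)%N then D J (t - d)%N else 1),
      (forall t, (N * d <= t)%N -> q t * `|Rs.@[form_coefs (d := d) G]| =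
         `|Rs.@[form_coefs (d := d) H]|) &
      forall t, coef_dt f' t != 0 /\ `|coef_dt f' t| = D finset.set0 t * `|coef_dt f t|].
Proof.
have [C CP] := exchange_completion.
pose a' s := \sum_(y <- red (mdeg s)) C (mdeg s) s y *: f y.
have a'h s : a' s \is (mdeg s).-homog.
  rewrite /a' big_seq; apply: rpred_sum => y; rewrite mem_rmonos => /andP[/eqP <- _].
  exact/rpredZ/(hb_homog fB).
pose f' := box_basis d a' H.
have f'h m : f' m \is (mdeg m).-homog by apply: box_basis_homog.
have f'H m j : f' (mshift d j m) = H j * f' m by apply: box_basis_shift.
pose Mf m y := co (f' m) y.
pose D J t := `|dt 0%MM 0%MM (rmonos d J t) (rmonos d J t) Mf|.
pose Qf (m y : 'X_{1..N}) :=
  if (d <= m i)%N then co (H i * f (munshift d i m)) y else co (a' m) y.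
pose q t := `|dt 0%MM 0%MM (red t) (red t) Qf|.
have coa t : {in box t & red t, forall m y, co (a' m) y = C t m y}.
  move=> m y; rewrite mem_box => /andP[/eqP mt _] yt.
  rewrite /a' mt (co_sum fB) (bigD1_seq _ yt (rmonos_uniq _ _ _)) /=.
  rewrite (coZ fB) (hb_delta fB) eqxx mulr1 big1 ?addr0 // => y' /negPf yy.
  by rewrite (coZ fB) (hb_delta fB) yy mulr0.
have q0 t : 0 < q t.
  rewrite /q normr_gt0; apply: contraNneq (CP t) => E; rewrite -[X in _ == X]E.
  apply/eqP/eq_dt_in => // m y mt yt; rewrite /Qf; case: ifP => // mi.
  have mb : m \in box t by apply: contraFT mi => /(red_box_lt mt).
  by rewrite (coa t).
have qR t : (N * d <= t)%N -> q t * `|Rs.@[form_coefs (d := d) G]| =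
         `|Rs.@[form_coefs (d := d) H]|.
  move=> Nt; have tl := rmonos_large Nt.
  rewrite -(poisson_formula d0 Rs_irr Rs_zero tl fB fG (f0 t) Gh Hh GH).
  congr (`|_| * _); apply: eq_dt_in => // m y mt _.
  by rewrite /Qf tl.
have DJ (J : {set 'I_N}) j t : j \notin J -> j != i ->
    D J t = D (j |: J) t * (if (d <= t)%N then D J (t - d)%N else 1).
  move=> jJ ji; case: leqP => dt'; last by rewrite mulr1 /D rmonos_small.
  rewrite -[in LHS](subnK dt') /D (ndt_rmonos_rec _ jJ) ?subnK // => m y.
  by rewrite /Mf f'H GH // (co_mul fB fG _ _ (f'h m)).
have Di t : D (~: [set i]) t =
    q t * (if (d <= t)%N then D (~: [set i]) (t - d)%N else 1).
  (* For a shifted [m], [f' m] is [H i] times [f' (munshift d i m)]; expanding the latter in [f] and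
     multiplying by [H i] factors [Mf] through [Qf], since multiples of the other forms have no
     coordinates in [red t]. The matrix [A] is block diagonal: the identity on the box and the
     matrix of degree [t - d] on the shifted monomials. *)
  pose A (m y : 'X_{1..N}) : K := if (d <= m i)%N then
    (if (d <= y i)%N then Mf (munshift d i m) (munshift d i y) else 0)
    else (m == y)%:R.
  have pt := red_perm t.
  have AQ : {in red t & red t, forall m y, Mf m y = \sum_(z <- red t) A m z * Qf z y}.
    move=> m y mt yt; rewrite /A; have [mi|mi] := leqP d (m i); last first.
      rewrite (bigD1_seq _ mt (rmonos_uniq _ _ _)) /= eqxx mul1r big1 ?addr0.
        have mb : m \in box t.
          by apply/negPn/negP => /(red_box_lt mt); rewrite leqNgt mi.
        rewrite /Mf /Qf leqNgt mi /f' box_basis_box // => j.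
        by move: mb; rewrite mem_box => /andP[_ /forallP].
      by move=> z /negPf zm; rewrite eq_sym zm mul0r.
    rewrite /Mf -{1}(munshiftK mi) f'H.
    set m0 := munshift d i m.
    rewrite {1}(hb_span fB (f'h m0)) mulr_sumr (co_sum fB).
    have dm : (d <= mdeg m)%N := leq_trans mi (mnm_le_mdeg m i).
    have m0t : mdeg m0 = (t - d)%N.
      move: mt; rewrite mem_rmonos => /andP[/eqP mt _].
      by apply: mdeg_munshift mi _; rewrite subnK // -mt.
    have dt' : (d <= t)%N.
      by move: mt; rewrite mem_rmonos => /andP[/eqP <- _].
    rewrite (bigID (mem (red (mdeg m0)))) /= [X in _ + X]big_seq_cond [X in _ + X]big1 ?addr0.
      rewrite (perm_big _ pt) big_cat /= [X in _ = X + _]big_seq [X in _ = X + _]big1 ?add0r.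
        rewrite /shifted dt' big_map -m0t -big_filter.
        rewrite (_ : [seq _ <- _ | _] = red (mdeg m0)); last first.
          apply: eq_in_filter => z zm; rewrite mem_rmonos.
          by rewrite mem_monos_eq in zm; rewrite zm.
        apply: eq_bigr => z _; rewrite mshiftE eqxx mul1n leq_addl mshiftK.
        by rewrite /Qf mshiftE eqxx mul1n leq_addl mshiftK -scalerAr (coZ fB).
      move=> z; rewrite mem_box => /andP[_ /forallP/(_ i) zi].
      by rewrite leqNgt zi mul0r.
    move=> z /andP[zm]; rewrite mem_rmonos -mem_monos_eq zm /= => /forall_inPn[j jJ].
    rewrite -leqNgt => zj; rewrite -scalerAr (coZ fB) -(munshiftK zj) fG mulrCA.
    rewrite (co_mul fB fG _ _ (homog_Hf erefl)) leqNgt.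
    by move: yt; rewrite mem_rmonos => /andP[_ /forall_inP/(_ j jJ) ->]; rewrite mulr0.
  rewrite /D (eq_dt_in 0%MM 0%MM 0%MM 0%MM _ AQ) // (dt_mul _ _ 0%MM) // normrM mulrC; congr (_ * _).
  rewrite (ndt_perm _ _ _ _ pt) (ndt_permC _ _ _ _ pt); last by rewrite -(perm_size pt).
  have bi m : m \in box t -> (m i < d)%N by rewrite mem_box => /andP[_ /forallP].
  rewrite dt_cat // => [|m y mb ys]; last first.
    rewrite /A leqNgt bi //= (negPf (_ : m != y)) //; apply: contraTneq ys => <-.
    rewrite mem_shifted -?ltnNge ?bi // (perm_mem pt) mem_cat mb //.
  rewrite normrM [X in `|X| * _](_ : _ = 1); last first.
    rewrite -(dt_delta K 0%MM 0%MM (r := box t)) ?rmonos_uniq //.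
    by apply: eq_dt_in => // m y mb _; rewrite /A leqNgt bi.
  rewrite normr1 mul1r /shifted; case: leqP => dt'; last by rewrite dt_nil normr1.
  rewrite (dt_map _ _ 0%MM 0%MM) //; congr `|_|; apply: eq_dt_in => // m y _ _.
  by rewrite /A !mshiftE !eqxx !mul1n !leq_addl !mshiftK.
(* Induction on the number of forms outside [J] and, for each [J], on the degree; with one form left
   the positivity is that of [q]. *)
have Dpos n (J : {set 'I_N}) t : #|~: J| = n.+1 -> i \notin J -> 0 < D J t.
  elim: n J t => [|n IH] J t.
    move=> /eqP/cards1P[j jE] iJ'; have ij : i = j.
      by apply/eqP; rewrite -finset.in_set1 -jE inE.
    have -> : J = ~: [set i] by rewrite ij -jE finset.setCK.
    have [k] := ubnP t; elim: k t => // k IHk t tk; rewrite Di pmulr_rgt0 //.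
    by case: leqP => // dt'; apply: IHk; lia.
  move=> cJ iJ'; have [j jJ ji] : exists2 j, j \notin J & j != i.
    have : (0 < #|(~: J) :\ i|)%N.
      by have := cardsD1 i (~: J); rewrite cJ inE iJ' add1n => -[<-].
    by case/card_gt0P => j; rewrite !inE => /andP[ji jJ]; exists j.
  have [k] := ubnP t; elim: k t => // k IHk t tk.
  rewrite (DJ _ _ _ jJ ji) mulr_gt0 //.
    apply: IH; last by rewrite !inE negb_or eq_sym ji.
    have := cardsD1 j (~: J); rewrite cJ inE jJ add1n => -[->].
    by congr #|pred_of_set _|; apply/setP => l; rewrite !inE negb_or.
  by case: leqP => // dt'; apply: IHk; lia.
have cE t : `|coef_dt f' t| = D finset.set0 t * `|coef_dt f t|.
  rewrite (coef_dt_change fB) ?normrM /D ?rmonos0 // => m.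
  by rewrite mem_monos_eq => /eqP <-.
have c0 t : coef_dt f' t != 0.
  have D0 : 0 < D finset.set0 t.
    apply: (Dpos #|~: (finset.set0 : {set 'I_N})|.-1); last by rewrite inE.
    by rewrite prednK //; apply/card_gt0P; exists i; rewrite !inE.
  rewrite -normr_eq0 cE; apply: mulf_neq0; first exact: lt0r_neq0.
  by rewrite normr_eq0.
have [co' f'B] := hbasis_of_dt f'h c0.
have Dpos' (J : {set 'I_N}) t : i \notin J -> 0 < D J t.
  move=> iJ'; apply: (Dpos #|~: J|.-1) => //; rewrite prednK //.
  by apply/card_gt0P; exists i; rewrite inE.
by exists a', co', D, q; split.
Qed.

End Exchange.

(** * Asymptotics of the logarithms *)

Section ExchangeLog.

Variables (R : realDomainType) (N d : nat) (d0 : (0 < d)%N) (i : 'I_N).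
Variables (l : {set 'I_N} -> nat -> R) (q : nat -> R) (L : R) (k1 : nat).
Hypothesis l_last : forall t, l (~: [set i]) t =
  q t + (if (d <= t)%N then l (~: [set i]) (t - d)%N else 0).
Hypothesis l_rec : forall (J : {set 'I_N}) j t, i \notin J -> j \notin J -> j != i ->
  l J t = l (j |: J) t + (if (d <= t)%N then l J (t - d)%N else 0).
Hypothesis q_large : forall t, (k1 <= t)%N -> q t = L.

(** Induction on the number of forms outside [J]. The recursion is Pascal's rule for the main term;
    summing the errors along steps of [d] raises the exponent by one and keeps the constant. *)
Lemma log_asymptotics_set r (J : {set 'I_N}) : #|~: J| = r.+1 -> i \notin J ->
  exists2 C, 0 <= C &
  forall t, `|l J t - 'C(t %/ d + r, r.+1)%:R * L| <= C * t.+1%:R ^+ r.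
Proof.
elim: r J => [|r IH] J cJ iJ.
  have -> : J = ~: [set i].
    move/eqP: cJ => /cards1P[j jE]; have ij : i = j.
      by apply/eqP; have : i \in ~: J; [rewrite inE|rewrite jE inE].
    by rewrite ij -jE finset.setCK.
  (* From [k1 + d] on, [e] is unchanged by a step of [d], so it is bounded by its values below
     [k1 + d]. *)
  pose e t := l (~: [set i]) t - (t %/ d)%:R * L.
  have eE t : (k1 + d <= t)%N -> e t = e (t - d)%N.
    move=> kt; have dt' : (d <= t)%N by apply: leq_trans kt; apply: leq_addl.
    rewrite /e l_last dt' q_large; last by apply: leq_trans kt; apply: leq_addr.
    have -> : (t %/ d = (t - d) %/ d + 1)%N.
      by rewrite -{1}(subnK dt') divnDr ?dvdnn // divnn d0.
    by rewrite natrD; ring.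
  exists (\sum_(s < k1 + d) `|e s|); first by apply: sumr_ge0.
  move=> t; rewrite addn0 bin1 expr0 mulr1 -/(e t).
  have [k] := ubnP t; elim: k t => // k IHk t tk.
  have [kt|tk1] := leqP (k1 + d) t; first by rewrite eE // IHk //; lia.
  by rewrite (bigD1 (Ordinal tk1)) //= lerDl sumr_ge0.
have [j jJ ji] : exists2 j, j \notin J & j != i.
  have : (0 < #|(~: J) :\ i|)%N.
    by have := cardsD1 i (~: J); rewrite cJ inE iJ add1n => -[<-].
  by case/card_gt0P => j; rewrite !inE => /andP[ji jJ]; exists j.
have [||C C0 CP] := IH (j |: J).
- have := cardsD1 j (~: J); rewrite cJ inE jJ add1n => -[->].
  by congr #|pred_of_set _|; apply/setP => k; rewrite !inE negb_or.
- by rewrite !inE negb_or eq_sym ji.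
exists C => // t; have [k] := ubnP t; elim: k t => // k IHk t tk.
rewrite (l_rec _ iJ jJ ji) exprS.
case: leqP => dt'; last first.
  rewrite addr0 divn_small // add0n bin_small // mul0r subr0.
  have := CP t; rewrite divn_small // add0n bin_small // mul0r subr0 => /le_trans; apply.
  by rewrite mulrCA ler_peMl ?mulr_ge0 ?exprn_ge0 ?ler0n ?ler1n.
have Eb : 'C(t %/ d + r.+1, r.+2) =
    ('C(t %/ d + r, r.+1) + 'C((t - d) %/ d + r.+1, r.+2))%N.
  have -> : (t %/ d = ((t - d) %/ d).+1)%N.
    by rewrite -{1}(subnK dt') divnDr ?dvdnn // divnn d0 addn1.
  by rewrite addSn binS addnC addnS.
have IHt : `|l J (t - d)%N - 'C((t - d) %/ d + r.+1, r.+2)%:R * L| <= C * t%:R * t.+1%:R ^+ r.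
  apply: le_trans (IHk _ _) _; first by lia.
  rewrite exprS -mulrA ler_wpM2l // ler_pM ?exprn_ge0 ?ler0n // ?lerXn2r ?nnegrE ?ler0n ?ler_nat; lia.
rewrite Eb natrD mulrDl opprD addrACA.
apply: le_trans (ler_normD _ _) _; apply: le_trans (lerD (CP t) IHt) _.
by rewrite le_eqVlt; apply/orP; left; apply/eqP; rewrite -natr1; ring.
Qed.

Lemma log_asymptotics : exists2 C, 0 <= C &
  forall t, `|l finset.set0 t - 'C(t %/ d + N.-1, N)%:R * L| <= C * t.+1%:R ^+ N.-1.
Proof.
have N0 : (0 < N)%N by case: (N) i => [[]|].
have := @log_asymptotics_set N.-1 finset.set0; rewrite prednK //; apply; last by rewrite inE.
by rewrite finset.setC0 cardsT card_ord.
Qed.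

End ExchangeLog.

(** * Basis determinants of all regular systems *)

Section ResultantAsymptotics.

Variables (R : realType) (N d : nat) (d0 : (0 < d)%N).
Local Notation K := R[i].
Local Notation M := #|coef_index N d|.
Local Notation nm := Normc.normc.
Variable Rs : {mpoly K[M]}.
Hypothesis Rs_irr : irreducible_elt Rs.
Hypothesis Rs_zero : forall H : 'I_N -> {mpoly K[N]},
  (forall i, H i \is d.-homog) ->
  (Rs.@[form_coefs (d := d) H] != 0 <-> trivial_zeros H).
Hypothesis Rs_one : Rs.@[form_coefs (d := d) (fun j => 'X_j ^+ d)] = 1.
Implicit Types (G H : 'I_N -> {mpoly K[N]}).

Lemma normc_gt0 (x : K) : (0 < nm x) = (x != 0).
Proof. by rewrite -ltcR -[(nm x)%:C]/(`|x|) normr_gt0. Qed.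

Lemma normc_norm (x : K) : nm `|x| = nm x.
Proof. by apply: (@complexI R); rewrite -[LHS]/(`| (`|x|) |) -[RHS]/(`|x|) normr_id. Qed.

Lemma ln_normcM (x y : K) : x != 0 -> y != 0 -> ln (nm (x * y)) = ln (nm x) + ln (nm y).
Proof. by move=> x0 y0; rewrite Normc.normcM lnM ?posrE ?normc_gt0. Qed.

Lemma ln_mul_close (x y z b u v C C' T : R) : x = y * z -> 0 < y -> 0 < z ->
  `|ln y - b * (u - v)| <= C' * T -> `|ln z - b * v| <= C * T ->
  `|ln x - b * u| <= (C' + C) * T.
Proof.
move=> -> y0 z0 h1 h2; rewrite mulrDl lnM ?posrE //.
have -> : ln y + ln z - b * u = (ln y - b * (u - v)) + (ln z - b * v) by ring.
exact: le_trans (ler_normD _ _) (lerD h1 h2).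
Qed.

(** The main term refers to [H] alone, so that logarithms add up along a chain of exchanges while
    the error keeps its order; the binomial is that of [log_asymptotics], with [J] empty. *)
Definition det_asymptotics H :=
  exists (a : 'X_{1..N} -> {mpoly K[N]}) (co : {mpoly K[N]} -> 'X_{1..N} -> K) C,
  [/\ forall s, a s \is (mdeg s).-homog, hbasis (box_basis d a H) co,
   forall t, coef_dt (box_basis d a H) t != 0 &
   forall t, `|ln (nm (coef_dt (box_basis d a H) t)) -
     'C(t %/ d + N.-1, N)%:R * ln (nm (Rs.@[form_coefs (d := d) H]))| <=
     C * t.+1%:R ^+ N.-1].

Lemma det_asymptotics_exchange i G H :
  (forall j, G j \is d.-homog) -> (forall j, H j \is d.-homog) ->
  (forall j, j != i -> H j = G j) -> trivial_zeros G -> trivial_zeros H ->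
  det_asymptotics G -> det_asymptotics H.
Proof.
move=> Gh Hh GH Gn Hn [a [co [C [ah fB f0 fC]]]].
have [a' [co' [D [q [[a'h f'B] [q0 Dpos Di] DJ qR cE]]]]] :=
  exchange d0 Rs_irr Rs_zero fB f0 Gh Hh GH Gn Hn.
have RG : Rs.@[form_coefs (d := d) G] != 0 by apply/Rs_zero.
have RH : Rs.@[form_coefs (d := d) H] != 0 by apply/Rs_zero.
pose L := ln (nm (Rs.@[form_coefs (d := d) H])) - ln (nm (Rs.@[form_coefs (d := d) G])).
have iJ0 : i \notin ~: [set i] by rewrite !inE eqxx.
have lnD (J : {set 'I_N}) t : i \notin J -> D J t != 0.
  by move=> iJ; rewrite gt_eqF ?Dpos.
have lnif (b : bool) (x : K) : (b -> x != 0) -> ln (nm (if b then x else 1 : K)) = if b then ln (nm x) else 0.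
  by case: b => // _; rewrite Normc.normc1 ln1.
have [|||C' C'0 CP] := @log_asymptotics _ N d d0 i (fun J t => ln (nm (D J t)))
    (fun t => ln (nm (q t))) L (N * d)%N.
- move=> t; rewrite Di ln_normcM ?gt_eqF ?lnif // => [_|]; first exact: lnD.
  by case: ifP => _; rewrite ?ltr01 ?Dpos.
- move=> J j t iJ jJ ji; have iJ' : i \notin (j |: J).
    by rewrite !inE negb_or eq_sym ji.
  rewrite (DJ _ _ _ jJ ji) ln_normcM ?gt_eqF ?Dpos ?lnif // => [_|]; first exact: lnD.
  by case: ifP => _; rewrite ?ltr01 ?Dpos.
- move=> t /qR E.
  have nE : nm (q t) * nm (Rs.@[form_coefs (d := d) G]) = nm (Rs.@[form_coefs (d := d) H]).
    by rewrite -[in LHS](normc_norm (Rs.@[_])) -Normc.normcM -[in RHS]normc_norm; congr nm; exact: E.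
  have qn : q t != 0 by rewrite gt_eqF.
  by rewrite /L -nE lnM ?posrE ?normc_gt0 // addrK.
exists a', co', (C' + C); split; [exact: a'h|exact: f'B|by move=> t; have [] := cE t|move=> t].
have [c0 E] := cE t.
have nE : nm (coef_dt (box_basis d a' H) t) =
    nm (D finset.set0 t) * nm (coef_dt (box_basis d a G) t).
  rewrite -[in RHS](normc_norm (coef_dt _ _)) -Normc.normcM -[in LHS]normc_norm.
  by congr nm; exact: E.
have D0 : D finset.set0 t != 0 by rewrite lnD ?inE.
have y0 : 0 < nm (D finset.set0 t) by rewrite normc_gt0; exact: D0.
have z0 : 0 < nm (coef_dt (box_basis d a G) t) by rewrite normc_gt0; exact: f0.
exact: ln_mul_close nE y0 z0 (CP t) (fC t).
Qed.

Let powers (j : 'I_N) : {mpoly K[N]} := 'X_j ^+ d.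

Lemma powers_homog j : powers j \is d.-homog.
Proof. exact: mpolyXn_homog. Qed.

Lemma box_basis_powers m : box_basis d (fun s => 'X_[s]) powers m = 'X_[m].
Proof.
rewrite /box_basis {3}(mbox_quo d m) mpolyXD; congr (_ * _).
rewrite /power_prod mpolyXE_id; apply: eq_bigr => j _.
by rewrite /powers -exprM mulmnE mulnC.
Qed.

Lemma det_asymptotics_powers : det_asymptotics powers.
Proof.
have bE : box_basis d (fun s => 'X_[s]) powers = (fun m => 'X_[m]).
  by apply: funext => m; apply: box_basis_powers.
have c1 t : coef_dt (box_basis d (fun s => 'X_[s]) powers) t = 1.
  rewrite bE -[RHS](dt_delta K 0%MM 0%MM (monos_eq_uniq N t)).
  by apply: eq_dt_in => // m m' _ _; rewrite mcoeffX.
have fh m : box_basis d (fun s => 'X_[s]) powers m \is (mdeg m).-homog.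
  by rewrite bE dhomogX.
have [|co fB] := hbasis_of_dt fh; first by move=> k; rewrite c1 oner_eq0.
exists (fun s => 'X_[s]), co, 0; split=> // [s|t|t]; first by rewrite dhomogX.
  by rewrite c1 oner_eq0.
by rewrite c1 Rs_one Normc.normc1 ln1 mulr0 subrr normr0 mul0r.
Qed.

Definition mix_forms k G H (j : 'I_N) : {mpoly K[N]} := if (j < k)%N then G j else H j.

(** As a polynomial in the coefficients [u], the resultant of the mixed system takes the nonzero
    value of the resultant of [H] when [u] consists of the coefficients of [H]. *)
Lemma mix_resultant_neq0 k H : (forall j, H j \is d.-homog) ->
  trivial_zeros H -> exists P : {mpoly K[M]}, P != 0 /\
  forall u, P.@[u] = Rs.@[form_coefs (d := d) (mix_forms k (form_of u) H)].
Proof.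
move=> Hh Hn; pose c := form_coefs (d := d) H.
pose lq := [tuple (if (enum_val x).1 < k then 'X_x else (c x)%:MP) : {mpoly K[M]} | x < M]%N.
have PE u : (Rs \mPo lq).@[u] = Rs.@[form_coefs (d := d) (mix_forms k (form_of u) H)].
  rewrite comp_mpoly_meval; apply: meval_eq => x; rewrite tnth_mktuple.
  rewrite [RHS]/form_coefs /mix_forms; case: ifP => _; last by rewrite mevalC.
  by rewrite mevalXU -[LHS]form_coefsK.
exists (Rs \mPo lq); split=> //; apply/eqP => P0.
have /eqP[] : Rs.@[c] != 0 by apply/Rs_zero.
rewrite -[RHS](@meval0 _ _ c) -P0 PE; apply: meval_eq => x.
rewrite /form_coefs /mix_forms; case: ifP => // _.
by rewrite form_ofK.
Qed.

(** Changing the powers into [H] directly could meet a degenerate system. The forms of a generic [G]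
    replace the powers one by one and are then replaced by those of [H]; [u] avoids the finitely
    many hypersurfaces where a mixed system degenerates. *)
Theorem det_asymptotics_all H : (forall j, H j \is d.-homog) -> trivial_zeros H ->
  det_asymptotics H.
Proof.
move=> Hh Hn; have Zh := powers_homog.
have Zn : trivial_zeros powers by apply/Rs_zero; rewrite // Rs_one oner_eq0.
have /choice[PH PHP] := fun k => mix_resultant_neq0 k Hh Hn.
have /choice[PZ PZP] := fun k => mix_resultant_neq0 k Zh Zn.
have /mpoly_nonroot[u] : \prod_(k < N.+1) (PH k * PZ k) != 0.
  apply/prodf_neq0 => k _; apply: mulf_neq0; first by have [] := PHP k.
  by have [] := PZP k.
rewrite meval_prod => /prodf_neq0 uP; pose G := form_of u.
have Gh j : G j \is d.-homog by apply: form_of_homog.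
have mixh k H' : (forall j, H' j \is d.-homog) -> forall j, mix_forms k G H' j \is d.-homog.
  by move=> H'h j; rewrite /mix_forms; case: ifP.
have mixn k : (k <= N)%N -> trivial_zeros (mix_forms k G H) /\ trivial_zeros (mix_forms k G powers).
  rewrite -ltnS => kN; have := uP (Ordinal kN) isT; rewrite mevalM mulf_eq0 negb_or.
  case/andP; rewrite (proj2 (PHP _)) (proj2 (PZP _)) => h1 h2; split.
    exact: (Rs_zero (mixh _ _ Hh)).1 h1.
  exact: (Rs_zero (mixh _ _ Zh)).1 h2.
have mix0 H' : mix_forms 0 G H' = H' by apply: funext.
have mixN H' : mix_forms N G H' = G.
  by apply: funext => j; rewrite /mix_forms ltn_ord.
have mixS k (kN : (k < N)%N) H' j : j != Ordinal kN ->
    mix_forms k.+1 G H' j = mix_forms k G H' j.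
  by move=> jk; rewrite /mix_forms ltnS leq_eqVlt (negPf (_ : j != k :> nat)).
have up k : (k <= N)%N -> det_asymptotics (mix_forms k G powers).
  elim: k => [_|k IH kN]; first by rewrite mix0; apply: det_asymptotics_powers.
  apply: (@det_asymptotics_exchange (Ordinal kN) (mix_forms k G powers)).
  - exact: mixh.
  - exact: mixh.
  - exact: mixS.
  - by have [] := mixn k (ltnW kN).
  - by have [] := mixn k.+1 kN.
  - exact/IH/ltnW.
have down k : (k <= N)%N -> det_asymptotics (mix_forms (N - k) G H).
  elim: k => [_|k IH kN]; first by rewrite subn0 mixN -(mixN powers); apply: up.
  have kN' : (N - k.+1 < N)%N by lia.
  have Ek : (N - k = (N - k.+1).+1)%N by lia.
  apply: (@det_asymptotics_exchange (Ordinal kN') (mix_forms (N - k) G H)).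
  - exact: mixh.
  - exact: mixh.
  - by move=> j jk; rewrite Ek (mixS _ kN').
  - by have [] := mixn (N - k)%N (leq_subr _ _).
  - by have [] := mixn (N - k.+1)%N (leq_subr _ _).
  - exact/IH/ltnW.
by have := down N (leqnn N); rewrite subnn mix0.
Qed.

End ResultantAsymptotics.

(** * Generic fibres *)

(** The Bezout identity makes [p] separable; the minimal polynomial of [A] divides it and splits
    with simple roots. *)
Lemma diagonalizable_separable (K : closedFieldType) n (A : 'M[K]_n.+1)
    (p u v : {poly K}) c : c != 0 -> c%:P = u * p + v * p^`() ->
  horner_mx A p = 0 -> diagonalizable A.
Proof.
move=> c0 E Ap; apply/diagonalizableP.
have p0 : p != 0.
  by apply: contraNneq c0 => p0; move/eqP: E; rewrite p0 deriv0 !mulr0 addr0 polyC_eq0.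
have [rs pE] := closed_field_poly_normal p.
set q := \prod_(z <- rs) _ in pE.
have l0 : lead_coef p != 0 by rewrite lead_coef_eq0.
exists rs.
  rewrite -separable_prod_XsubC -/q.
  have : separable_poly p.
    rewrite unlock; apply/Bezout_coprimepP; exists (u, v) => /=.
    by rewrite -E -size_poly_eq1 size_polyC c0.
  by apply: dvdp_separable; rewrite pE dvdpZr.
by rewrite -(dvdpZr _ _ l0) -pE; apply: mxminpoly_min.
Qed.

Section SubstBy.

Variables (K : numFieldType) (N : nat) (F : 'I_N -> {mpoly K[N]}).

Definition subst_by (p : {mpoly K[N]}) : {mpoly K[N]} := p \mPo [tuple F j | j < N].

Lemma subst_byD p q : subst_by (p + q) = subst_by p + subst_by q.
Proof. exact: comp_mpolyD. Qed.

Lemma subst_byM p q : subst_by (p * q) = subst_by p * subst_by q.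
Proof. exact: (rmorphM (comp_mpoly [tuple F j | j < N])). Qed.

Lemma subst_by_sum (I : Type) (r : seq I) (P : pred I) (G : I -> {mpoly K[N]}) :
  subst_by (\sum_(i <- r | P i) G i) = \sum_(i <- r | P i) subst_by (G i).
Proof. exact: (raddf_sum (comp_mpoly [tuple F j | j < N])). Qed.

Lemma subst_by0 : subst_by 0 = 0.
Proof. exact: comp_mpoly0. Qed.

Lemma subst_by1 : subst_by 1 = 1.
Proof. exact: comp_mpoly1. Qed.

Lemma subst_byX j : subst_by 'X_j = F j.
Proof. by rewrite /subst_by comp_mpolyXU -tnth_nth tnth_mktuple. Qed.

Lemma subst_by_eval p z : (subst_by p).@[z] = p.@[fun j => (F j).@[z]].
Proof.
by rewrite comp_mpoly_meval; apply: meval_eq => j; rewrite tnth_mktuple.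
Qed.

End SubstBy.

Section FreeFibers.

Variables (K : numClosedFieldType) (N n : nat).
Variables (F : 'I_N -> {mpoly K[N]}) (b : 'I_n.+1 -> {mpoly K[N]}).

Local Notation subst_by := (subst_by F).

Hypothesis b_free : forall P : 'I_n.+1 -> {mpoly K[N]},
  \sum_k subst_by (P k) * b k = 0 -> forall k, P k = 0.
Hypothesis b_span : forall h, exists P : 'I_n.+1 -> {mpoly K[N]},
  h = \sum_k subst_by (P k) * b k.

Lemma b_free_eq (P Q : 'I_n.+1 -> {mpoly K[N]}) :
  \sum_k subst_by (P k) * b k = \sum_k subst_by (Q k) * b k -> P =1 Q.
Proof.
move=> E k; apply/eqP; rewrite -subr_eq0; apply/eqP.
apply: (b_free (P := fun k => P k - Q k)).
under eq_bigr => l _ do rewrite /subst_by comp_mpolyB mulrBl.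
by rewrite sumrB; apply/eqP; rewrite subr_eq0; apply/eqP.
Qed.

(** Multiplication by [h] on the polynomials, seen as a free module over [K[w]] acting through
    [w = F(z)]. *)
Lemma mult_matrix : exists MX : {mpoly K[N]} -> 'M[{mpoly K[N]}]_n.+1,
  forall h s, h * b s = \sum_t subst_by (MX h s t) * b t.
Proof.
have /choice[P PP] := b_span.
exists (fun h => \matrix_(s, t) P (h * b s) t) => h s.
by rewrite {1}[h * b s]PP; apply: eq_bigr => t _; rewrite mxE.
Qed.

Variable MX : {mpoly K[N]} -> 'M[{mpoly K[N]}]_n.+1.
Hypothesis MXE : forall h s, h * b s = \sum_t subst_by (MX h s t) * b t.

Lemma mult_matrix_unique h (M : 'M[{mpoly K[N]}]_n.+1) :
  (forall s, h * b s = \sum_t subst_by (M s t) * b t) -> MX h = M.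
Proof.
move=> ME; apply/matrixP => s t; apply: (@b_free_eq (MX h s) (M s)).
by rewrite -MXE ME.
Qed.

Lemma mult_matrixD g h : MX (g + h) = MX g + MX h.
Proof.
apply: mult_matrix_unique => s; rewrite mulrDl !MXE -big_split /=.
by apply: eq_bigr => t _; rewrite mxE subst_byD mulrDl.
Qed.

Lemma mult_matrixM g h : MX (g * h) = MX g *m MX h.
Proof.
apply: mult_matrix_unique => s; rewrite [g * h]mulrC -mulrA MXE mulr_sumr.
under eq_bigr => t _ do rewrite mulrCA MXE mulr_sumr.
rewrite exchange_big /=; apply: eq_bigr => u _; rewrite mxE subst_by_sum mulr_suml.
by apply: eq_bigr => t _; rewrite subst_byM mulrA.
Qed.

Lemma mult_matrix_subst p : MX (subst_by p) = p%:M.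
Proof.
apply: mult_matrix_unique => s; rewrite (bigD1 s) //= mxE eqxx mulr1n.
rewrite big1 ?addr0 // => t /negPf ts; rewrite mxE eq_sym ts mulr0n.
by rewrite subst_by0 mul0r.
Qed.

Lemma mult_matrix0 : MX 0 = 0.
Proof. by rewrite -[in LHS](subst_by0 F) mult_matrix_subst raddf0. Qed.

Lemma b_neq0 : exists s, b s != 0.
Proof.
apply: NNPP => H; have b0 s : b s = 0.
  by apply: NNPP => bs; apply: H; exists s; apply/eqP.
have := b_free (P := fun _ => 1) _ ord0.
rewrite big1 => [/(_ erefl)/eqP|k _]; last by rewrite b0 mulr0.
by rewrite oner_eq0.
Qed.

Lemma mult_matrix_eq0 h : MX h = 0 -> h = 0.
Proof.
move=> h0; have [s bs] := b_neq0; apply: (mulIf bs).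
by rewrite mul0r MXE big1 // => t _; rewrite h0 mxE subst_by0 mul0r.
Qed.

Lemma subst_by_inj p : subst_by p = 0 -> p = 0.
Proof.
move=> p0; have := mult_matrix_subst p; rewrite p0 mult_matrix0.
by move/matrixP/(_ ord0 ord0); rewrite !mxE eqxx mulr1n => /esym.
Qed.

(* [P(F, X_i)] for [P] a polynomial in one variable over [K[w]] *)
Definition poly_at i (P : {poly {mpoly K[N]}}) : {mpoly K[N]} :=
  (map_poly subst_by P).['X_i].

Let subst_rm := (comp_mpoly [tuple F j | j < N] : {rmorphism {mpoly K[N]} -> {mpoly K[N]}}).

Lemma poly_at_rm i P : poly_at i P = (map_poly subst_rm P).['X_i].
Proof. by []. Qed.

Lemma poly_atM i P Q : poly_at i (P * Q) = poly_at i P * poly_at i Q.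
Proof. by rewrite !poly_at_rm rmorphM hornerM. Qed.

Lemma poly_atC i p : poly_at i p%:P = subst_by p.
Proof. by rewrite poly_at_rm map_polyC hornerC. Qed.

Lemma mult_matrix_poly_at i P : MX (poly_at i P) = horner_mx (MX 'X_i) P.
Proof.
elim/poly_ind: P => [|P p IH].
  by rewrite rmorph0 poly_at_rm rmorph0 horner0 mult_matrix0.
rewrite rmorphD rmorphM /= horner_mx_C horner_mx_X poly_at_rm rmorphD rmorphM /=.
rewrite map_polyX map_polyC hornerD hornerM hornerX hornerC mult_matrixD mult_matrixM.
by rewrite -/(poly_at i P) IH mult_matrix_subst.
Qed.

(** By Cayley-Hamilton the coordinates are integral over the ring generated by [F]. *)
Lemma exists_poly_at i : exists2 P, P != 0 & poly_at i P = 0.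
Proof.
exists (char_poly (MX 'X_i)); first exact/monic_neq0/char_poly_monic.
by apply: mult_matrix_eq0; rewrite mult_matrix_poly_at Cayley_Hamilton.
Qed.

(** A polynomial [P] of least size killing the coordinate is coprime to its derivative: if they had
    a nonconstant common factor, that factor or its cofactor in [P] would be a smaller annihilator.
    The constant [c] is a resultant, or the derivative itself when constant. *)
Lemma separating_poly_at i : exists P, [/\ P != 0, poly_at i P = 0 &
  exists c u v, c != 0 /\ c%:P = u * P + v * P^`()].
Proof.
have [P [P0 Pi Pmin]] : exists P, [/\ P != 0, poly_at i P = 0 &
    forall Q, Q != 0 -> poly_at i Q = 0 -> (size P <= size Q)%N].
  have [P0 P00 P0i] := exists_poly_at i.
  have [m] := ubnP (size P0); elim: m P0 P00 P0i => // m IH P P0 Pi Pm.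
  have [H|H] := classic (forall Q, Q != 0 -> poly_at i Q = 0 -> (size P <= size Q)%N).
    by exists P.
  have [Q [Q0 Qi QP]] : exists Q, [/\ Q != 0, poly_at i Q = 0 & (size Q < size P)%N].
    apply: NNPP => nQ; apply: H => Q Q0 Qi; rewrite leqNgt; apply/negP => QP.
    by apply: nQ; exists Q.
  by apply: (IH Q Q0 Qi); apply: leq_trans QP _; rewrite -ltnS.
exists P; split=> //.
have sP : (1 < size P)%N.
  rewrite ltnNge; apply/negP => /size1_polyC PE; case/eqP: P0; rewrite PE.
  by move: Pi; rewrite {1}PE poly_atC => /subst_by_inj ->.
have dP : P^`() != 0.
  have : P^`()`_(size P).-2 != 0.
    rewrite coef_deriv -[_.-2.+1](_ : (size P).-1 = _); last by lia.
    rewrite -mulr_natl mulf_neq0 // ?lead_coef_eq0 // -mpolyC_nat mpolyC_eq0.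
    by rewrite pnatr_eq0; lia.
  by apply: contraNneq => ->; rewrite coef0.
have Pd := lt_size_deriv P0.
have Pdi : poly_at i P^`() != 0.
  by apply/eqP => /(Pmin _ dP); rewrite leqNgt Pd.
have [sd|sd] := leqP (size P^`()) 1.
  exists (P^`())`_0, 0, 1; rewrite mul0r add0r mul1r -size1_polyC //; split=> //.
  by apply: contraNneq dP => E; rewrite [P^`()]size1_polyC // E.
have [[u v] _ E] := resultant_in_ideal sP sd.
exists (resultant P P^`()), u, v; split=> //.
rewrite resultant_eq0 -leqNgt leqNgt; apply/negP => sg.
have [[c Q] /= c0 EP] := Pdiv.Idomain.dvdpP _ _ (Pdiv.Idomain.dvdp_gcdl P P^`()).
set g := gcdp P P^`() in EP sg.
have g0 : g != 0 by rewrite -size_poly_gt0 (ltn_trans _ sg).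
have Q0 : Q != 0.
  apply: contraNneq P0 => Q0; move/eqP: EP; rewrite Q0 mul0r -mul_polyC mulf_eq0 polyC_eq0.
  by rewrite (negPf c0).
have sE : size P = (size Q + size g).-1.
  by rewrite -size_mul // -EP size_scale.
have gs : (size g <= size P^`())%N.
  by apply: Pdiv.Idomain.leq_gcdpr.
have : poly_at i Q * poly_at i g = 0.
  rewrite -poly_atM -EP -mul_polyC poly_atM Pi mulr0 //.
move/eqP; rewrite mulf_eq0 => /orP[] /eqP z.
  have := Pmin _ Q0 z; rewrite leqNgt sE => /negP; apply.
  by move: sg sE; move: (size Q) (size g) => x y; lia.
by have := leq_trans (Pmin _ g0 z) gs; rewrite leqNgt Pd.
Qed.

(** The vector of the [b s] at [z] is an eigenvector, for the eigenvalue [h.@[z]], of the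
    multiplication matrix taken at [F(z)]. It is nonzero because 1 is a combination of the [b s]. *)
Lemma norm_le_mult_matrix h z :
  `|h.@[z]| <= \sum_s \sum_t `|(MX h s t).@[fun j => (F j).@[z]]|.
Proof.
pose w j := (F j).@[z]; pose B := \sum_s `|(b s).@[z]|.
have B0 : 0 < B.
  have Bge : 0 <= B by apply: sumr_ge0.
  rewrite lt_neqAle Bge andbT eq_sym; apply/eqP => /eqP.
  rewrite psumr_eq0 // => /allP b0; have [P E] := b_span 1.
  have /eqP : (1 : {mpoly K[N]}).@[z] = 0.
    rewrite E meval_sum big1 // => k _; rewrite mevalM.
    have := b0 k (mem_index_enum _); rewrite /= normr_eq0 => /eqP ->.
    by rewrite mulr0.
  by rewrite meval1 oner_eq0.
rewrite -(ler_pM2r B0) mulr_sumr mulr_suml; apply: ler_sum => s _.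
rewrite -normrM -mevalM MXE meval_sum; apply: le_trans (ler_norm_sum _ _ _) _.
rewrite mulr_suml; apply: ler_sum => t _; rewrite mevalM subst_by_eval normrM.
rewrite ler_wpM2l // /B (bigD1 t) //= lerDl; exact: sumr_ge0.
Qed.

(** [Q1] is the product of the constants of [separating_poly_at]. Off its zeros the multiplications
    by the coordinates are simultaneously diagonalizable and their joint eigenvalues are points of
    the fibre. [Qd] is the determinant of the trace form, which becomes the Gram matrix of the
    evaluations at these points. *)
Theorem generic_fibers : exists Q1 Qd : {mpoly K[N]}, [/\ Q1 != 0, Qd != 0 &
  forall w, Q1.@[w] != 0 -> exists p : 'I_n.+1 -> 'I_N -> K,
    (forall l j, (F j).@[p l] = w j) /\
    (\det (\matrix_(l, t) (b t).@[p l])) ^+ 2 = Qd.@[w]].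
Proof.
have /choice[cc ccP] : forall i, exists c, c != 0 /\ exists P u v,
    poly_at i P = 0 /\ c%:P = u * P + v * P^`().
  move=> i; have [P [_ Pi [c [u [v [c0 E]]]]]] := separating_poly_at i.
  by exists c; split=> //; exists P, u, v.
pose Q1 := \prod_i cc i.
pose Qd := \det (\matrix_(t, t') \tr (MX (b t * b t'))).
have Q10 : Q1 != 0 by apply/prodf_neq0 => i _; have [] := ccP i.
have main w : Q1.@[w] != 0 -> exists p : 'I_n.+1 -> 'I_N -> K,
    [/\ forall l j, (F j).@[p l] = w j,
    (\det (\matrix_(l, t) (b t).@[p l])) ^+ 2 = Qd.@[w] &
    \det (\matrix_(l, t) (b t).@[p l]) != 0].
  rewrite meval_prod => /prodf_neq0 cw.
  pose Mw h := map_mx (meval w) (MX h).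
  have MwM g h : Mw (g * h) = Mw g *m Mw h by rewrite /Mw mult_matrixM map_mxM.
  have MwD g h : Mw (g + h) = Mw g + Mw h by rewrite /Mw mult_matrixD map_mxD.
  have MwS p : Mw (subst_by p) = (p.@[w])%:M.
    by rewrite /Mw mult_matrix_subst map_scalar_mx.
  have diagA i : diagonalizable (Mw 'X_i).
    have [_ [P [u [v [Pi E]]]]] := ccP i.
    apply: (@diagonalizable_separable _ _ _ (map_poly (meval w) P)
      (map_poly (meval w) u) (map_poly (meval w) v) (cc i).@[w]) => //.
    - exact: cw.
    - have := congr1 (map_poly (meval w)) E.
      by rewrite map_polyC rmorphD !rmorphM /= deriv_map.
    - rewrite /Mw -map_horner_mx -mult_matrix_poly_at Pi mult_matrix0.
      by rewrite raddf0.
  have [P Pu PP] : codiagonalizable [seq Mw 'X_i | i <- enum 'I_N].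
    apply/codiagonalizableP; split.
      move=> _ _ /mapP[i _ ->] /mapP[j _ ->].
      by rewrite /comm_mx -!MwM mulrC.
    by move=> _ /mapP[i _ ->]; apply: diagA.
  pose V := invmx P; have Vu : V \in unitmx by rewrite unitmx_inv.
  pose lam i l := (P *m Mw 'X_i *m V) l l.
  pose p l i := lam i l.
  have XV i : Mw 'X_i *m V = V *m diag_mx (\row_l ('X_i : {mpoly K[N]}).@[p l]).
    have iin : Mw 'X_i \in [seq Mw 'X_i | i <- enum 'I_N].
      by apply/mapP; exists i; rewrite ?mem_enum.
    have dg : is_diag_mx (conjmx P (Mw 'X_i)) := allP PP _ iin.
    move: dg; rewrite conjumx // => /diag_mxP[D DE].
    have {}DE : P *m Mw 'X_i *m V = diag_mx D := DE.
    have -> : \row_l ('X_i : {mpoly K[N]}).@[p l] = D.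
      by apply/rowP => l; rewrite !mxE mevalXU /p /lam DE !mxE eqxx mulr1n.
    by rewrite -DE -!mulmxA mulKmx // mulVmx // mulmx1.
  (* The columns of [V] are joint eigenvectors; that the eigenvalue of [h] is its value at [p l]
     extends from the coordinates to all polynomials. *)
  pose good h := Mw h *m V = V *m diag_mx (\row_l h.@[p l]).
  have goodM g h : good g -> good h -> good (g * h).
    rewrite /good => gg gh; rewrite MwM -mulmxA gh mulmxA gg -mulmxA; congr (_ *m _).
    rewrite mulmx_diag; congr diag_mx; apply/rowP => l; rewrite !mxE.
    by rewrite mevalM.
  have goodC c : good c%:MP.
    have := MwS c%:MP; rewrite /subst_by comp_mpolyC mevalC /good => ->.
    rewrite -scalar_mxC; congr (_ *m _).
    by apply/matrixP => l l'; rewrite !mxE mevalC.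
  have goodX m : good 'X_[m].
    rewrite mpolyXE_id; elim/big_ind: _ => [||i _].
    - by rewrite -mpolyC1; apply: goodC.
    - exact: goodM.
    elim: (m i) => [|k IHk]; first by rewrite expr0 -mpolyC1; apply: goodC.
    by rewrite exprS; apply: goodM => //; apply: XV.
  have goodA g h : good g -> good h -> good (g + h).
    rewrite /good => gg gh; rewrite MwD mulmxDl gg gh -mulmxDr -raddfD.
    by congr (_ *m diag_mx _); apply/rowP => l; rewrite !mxE mevalD.
  have goodall h : good h.
    elim/mpolyind: h => [|c m h _ _ IH]; first by rewrite -mpolyC0; apply: goodC.
    by apply: goodA => //; rewrite -mul_mpolyC; apply: goodM; [apply: goodC|apply: goodX].
  have goodD h : diag_mx (\row_l h.@[p l]) = invmx V *m Mw h *m V.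
    by rewrite -mulmxA goodall mulKmx.
  exists p.
  have FE l j : (F j).@[p l] = w j.
    have := goodD (F j); rewrite -[in Mw _](subst_byX F j) MwS mevalXU.
    rewrite -mulmxA mul_scalar_mx -scalemxAr mulVmx // => /matrixP/(_ l l).
    by rewrite !mxE eqxx mulr1n mulr1.
  have dX : \det (\matrix_(l, t) (b t).@[p l]) != 0.
    (* The coordinates of 1 recover the entries of an eigenvector: column [l] of [V] is [kap l]
       times the vector of the [b t] at [p l], so the evaluation matrix is invertible along with
       [V]. *)
    have [c cE] := b_span 1.
    have cM t u : \sum_s c s * MX (b t) s u = (t == u)%:R.
      move: u; apply: b_free_eq; transitivity (b t).
        under eq_bigr => u _ do rewrite subst_by_sum mulr_suml.
        rewrite exchange_big /= -[RHS]mulr1 [in RHS]cE mulr_sumr.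
        apply: eq_bigr => s _; rewrite mulrCA MXE mulr_sumr.
        by apply: eq_bigr => u _; rewrite subst_byM mulrA.
      rewrite (bigD1 t) //= eqxx subst_by1 mul1r big1 ?addr0 // => u ut.
      by rewrite eq_sym (negPf ut) subst_by0 mul0r.
    pose kap l := \sum_s (c s).@[w] * V s l.
    have VE t l : V t l = kap l * (b t).@[p l].
      have cMw u : \sum_s (c s).@[w] * Mw (b t) s u = (t == u)%:R.
        have := congr1 (meval w) (cM t u); rewrite meval_sum.
        rewrite (_ : ((t == u)%:R : {mpoly K[N]}).@[w] = (t == u)%:R); last first.
          by case: eqP; rewrite ?meval1 ?meval0.
        by move=> <-; apply: eq_bigr => s _; rewrite mevalM mxE.
      transitivity (\sum_s (c s).@[w] * (Mw (b t) *m V) s l); last first.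
        rewrite goodall /kap mulr_suml; apply: eq_bigr => s _.
        by rewrite mul_mx_diag !mxE mulrA.
      under eq_bigr => s _ do rewrite mxE mulr_sumr.
      rewrite exchange_big /= (bigD1 t) //= [X in _ + X]big1 => [|u ut].
        rewrite addr0; under eq_bigr => s _ do rewrite mulrA.
        by rewrite -mulr_suml cMw eqxx mul1r.
      under eq_bigr => s _ do rewrite mulrA.
      by rewrite -mulr_suml cMw eq_sym (negPf ut) mul0r.
    have : \det V != 0 by rewrite -unitfE -unitmxE.
    rewrite -det_tr (_ : V^T = diag_mx (\row_l kap l) *m \matrix_(l, t) (b t).@[p l]).
      by rewrite det_mulmx mulf_eq0 negb_or => /andP[].
    by apply/matrixP => l t; rewrite mul_diag_mx !mxE VE.
  split=> //; rewrite /Qd.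
  rewrite -[X in X ^+ 2]det_tr expr2 -{2}det_tr trmxK -det_mulmx -det_map_mx.
  congr (\det _); apply/matrixP => t t'; rewrite !mxE.
  rewrite -trace_map_mx -/(Mw _) -[in RHS](mul1mx (Mw _)) -(mulmxV Vu) -mulmxA mxtrace_mulC.
  rewrite -goodD mxtrace_diag; apply: eq_bigr => l _.
  by rewrite !mxE mevalM.
exists Q1, Qd; split=> // [|w /main[p [h1 h2 _]]]; last by exists p.
have [w /main[p [_ E dX]]] := mpoly_nonroot Q10.
have : Qd.@[w] != 0 by rewrite -E expf_neq0.
by apply: contraNneq => ->; rewrite meval0.
Qed.

End FreeFibers.

(** * Unitriangular families and Vandermonde determinants *)

Section FilteredBasis.

Variables (K : numFieldType) (N : nat).
Variables (f : 'X_{1..N} -> {mpoly K[N]}) (co : {mpoly K[N]} -> 'X_{1..N} -> K).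
Hypothesis fB : hbasis f co.
Implicit Types (g : 'X_{1..N} -> {mpoly K[N]}) (h : {mpoly K[N]}) (m : 'X_{1..N}).

Lemma co_small h m : (msize h <= mdeg m)%N -> co h m = 0.
Proof.
move=> hm; rewrite (pihomog_partitionE hm) (co_sum fB) big1 // => k _.
by apply: (co_homog fB (pihomogP _ _ _)); rewrite gtn_eqF.
Qed.

Lemma monos_eq_le n : perm_eq (monos_le N n) (flatten [seq monos_eq N k | k <- iota 0 n.+1]).
Proof.
have dis : {in iota 0 n.+1 &, forall k k', k != k' ->
    {in monos_eq N k & monos_eq N k', forall m m', m != m'}}.
  move=> k k' _ _ kk m m'; rewrite !mem_monos_eq => /eqP mk /eqP mk'.
  by apply: contra_neq kk => mm; rewrite -mk -mk' mm.
apply: uniq_perm; first exact: monos_le_uniq.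
  elim: (iota 0 n.+1) (iota_uniq 0 n.+1) dis => //= k s IH /andP[ks us] dis.
  rewrite cat_uniq monos_eq_uniq IH //=; last first.
    by move=> i j si sj; apply: dis; rewrite inE ?si ?sj orbT.
  rewrite andbT; apply/hasPn => m /flattenP[_ /mapP[j js ->] mj]; apply/negP => mk.
  have := dis k j; rewrite !inE eqxx js orbT => /(_ isT isT) H.
  have /H/(_ m m mk mj) : k != j by apply: contraNneq ks => ->.
  by rewrite eqxx.
move=> m; rewrite mem_monos_le; apply/idP/flattenP => [mn|[_ /mapP[k + ->]]].
  exists (monos_eq N (mdeg m)); last by rewrite mem_monos_eq.
  by apply/mapP; exists (mdeg m); rewrite // mem_iota.
by rewrite mem_iota mem_monos_eq => /= kn /eqP ->.
Qed.

Lemma co_span_le n h : (msize h <= n.+1)%N ->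
  h = \sum_(m <- monos_le N n) co h m *: f m.
Proof.
move=> hn; rewrite (perm_big _ (monos_eq_le n)) big_flatten big_map.
rewrite -[iota 0 n.+1]/(iota 0 (n.+1 - 0)) -/(index_iota 0 n.+1) big_mkord.
rewrite {1}(pihomog_partitionE hn); apply: eq_bigr => k _.
rewrite {1}(hb_span fB (pihomogP _ _ _)) !big_seq; apply: eq_bigr => m mk.
congr (_ *: _); transitivity (\sum_(j < n.+1) co (pihomog mdeg j h) m); last first.
  by rewrite -(co_sum fB) -pihomog_partitionE.
rewrite (bigD1 k) //= big1 ?addr0 // => j jk.
apply: (co_homog fB (pihomogP _ _ _)); move: mk; rewrite mem_monos_eq => /eqP ->.
by rewrite eq_sym; apply: contraNneq jk => E; apply/eqP/val_inj.
Qed.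

(** In coordinates relative to the basis, [g m] is the basis vector [m] plus terms of smaller index;
    as the order refines the degree, any perturbation of lower degree is allowed. *)
Definition unitriangular g := forall m m', (m <= m')%O -> co (g m) m' = (m == m')%:R.

Lemma unitriangular_dt n g : unitriangular g ->
  dt 0%MM 0%MM (monos_le N n) (monos_le N n) (fun m m' => co (g m) m') = 1.
Proof.
move=> gU; pose s := monos_le N n.
have sE i j : (i < size s)%N -> (j < size s)%N -> (i <= j)%N ->
    co (g (nth 0%MM s i)) (nth 0%MM s j) = (i == j)%:R.
  move=> si sj ij; rewrite gU ?nth_uniq ?monos_le_uniq //.
  by apply: (sorted_leq_nth le_trans le_refl _ (monos_le_sorted _ _)).
rewrite dt_trig => [|i j /andP[ij js]].
  by rewrite big1 // => i _; rewrite sE // eqxx.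
have si := ltn_trans ij js.
by rewrite (sE _ _ si js (ltnW ij)) ltn_eqF.
Qed.

Lemma unitriangular_unitmx n g : unitriangular g ->
  (\matrix_(i < size (monos_le N n), j < size (monos_le N n))
     co (g (nth 0%MM (monos_le N n) i)) (nth 0%MM (monos_le N n) j)) \in unitmx.
Proof.
by move=> /(unitriangular_dt n); rewrite /dt unitmxE unitfE => ->; rewrite oner_eq0.
Qed.

Lemma unitriangular_free n g (c : 'X_{1..N} -> K) : unitriangular g ->
  \sum_(m <- monos_le N n) c m *: g m = 0 -> {in monos_le N n, forall m, c m = 0}.
Proof.
move=> gU E m mn; set s := monos_le N n in E mn.
have Au := unitriangular_unitmx n gU; set A := (X in X \in unitmx) in Au.
have vA : (\row_(i < size s) c (nth 0%MM s i)) *m A = 0.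
  apply/rowP => j; rewrite !mxE -[RHS](co0 fB (nth 0%MM s j)) -E (co_sum fB).
  rewrite (big_nth 0%MM) big_mkord; apply: eq_bigr => i _.
  by rewrite !mxE (coZ fB).
have mi : (index m s < size s)%N by rewrite index_mem.
have := congr1 (fun v : 'rV_(size s) => (v *m invmx A) ord0 (Ordinal mi)) vA.
by rewrite mulmxK // mul0mx !mxE /= nth_index.
Qed.

Lemma unitriangular_span n g h : unitriangular g ->
  (forall m, (msize (g m) <= (mdeg m).+1)%N) -> (msize h <= n.+1)%N ->
  exists c : 'X_{1..N} -> K, h = \sum_(m <- monos_le N n) c m *: g m.
Proof.
move=> gU gs hn; pose s := monos_le N n.
have Au := unitriangular_unitmx n gU; set A := (X in X \in unitmx) in Au.
pose v := \row_(j < size s) co h (nth 0%MM s j); pose x := v *m invmx A.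
exists (fun m => \sum_(i < size s) x ord0 i * (nth 0%MM s i == m)%:R).
have xE (i : 'I_(size s)) :
    \sum_(j < size s) x ord0 j * (nth 0%MM s j == nth 0%MM s i)%:R = x ord0 i.
  rewrite (bigD1 i) //= eqxx mulr1 big1 ?addr0 // => j ji.
  by rewrite nth_uniq ?monos_le_uniq // (negPf (_ : j != i :> nat)) ?mulr0.
rewrite [RHS](big_nth 0%MM) big_mkord.
under eq_bigr => i _.
  rewrite xE (co_span_le (n := n) (h := g _)); last first.
    apply: leq_trans (gs _) _; rewrite ltnS -mem_monos_le mem_nth //.
  rewrite scaler_sumr (big_nth 0%MM) big_mkord.
  over.
rewrite exchange_big /= [LHS](co_span_le hn) (big_nth 0%MM) big_mkord.
apply: eq_bigr => j _; under eq_bigr => i _ do rewrite scalerA.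
rewrite -scaler_suml; congr (_ *: _).
have /rowP/(_ j) : x *m A = v by rewrite mulmxKV.
rewrite mxE [X in _ = X -> _]mxE => <-; apply: eq_bigr => i _; congr (_ * _).
by rewrite mxE.
Qed.

(** The second hypothesis provides some finite expansion of [g m]; the first removes its terms of
    larger index, hence those of larger degree. *)
Lemma unitriangular_size g m : (forall m', (m < m')%O -> co (g m) m' = 0) ->
  (exists2 n, (msize (g m) <= n.+1)%N & (mdeg m <= n)%N) -> (msize (g m) <= (mdeg m).+1)%N.
Proof.
move=> g0 [n gn mn]; rewrite (co_span_le gn) big_seq.
apply: leq_trans (mmeasure_sum _ _ _ _) _; apply/bigmax_leqP_seq => m' _ _.
have [mm|mm] := ltnP (mdeg m) (mdeg m').
  by rewrite g0 ?scale0r ?mmeasure0 // lt_mdeg_ltmc.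
apply: leq_trans (msizeZ_le _ _) _; rewrite -ltnS ltnS.
apply: leq_trans (_ : _ <= (mdeg m').+1)%N _; last by rewrite ltnS.
rewrite msizeE; apply/bigmax_leqP_seq => x xs _.
by rewrite (dhomogP _ _ _ (hb_homog fB m') x xs).
Qed.

End FilteredBasis.

Section EvaluationDeterminant.

Variables (K : numFieldType) (N : nat).
Implicit Types (g f : 'X_{1..N} -> {mpoly K[N]}) (z : 'rV[K]_N).

Definition ev (p : {mpoly K[N]}) z : K := p.@[fun j => z ord0 j].

Definition vdet (r : seq 'X_{1..N}) g (zs : seq 'rV[K]_N) : K :=
  dt 0%MM (0 : 'rV[K]_N) r zs (fun m z => ev (g m) z).

Lemma evM p q z : ev (p * q) z = ev p z * ev q z.
Proof. exact: mevalM. Qed.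

Lemma evZ c p z : ev (c *: p) z = c * ev p z.
Proof. exact: mevalZ. Qed.

Lemma ev_sum (I : Type) (r : seq I) (P : pred I) (G : I -> {mpoly K[N]}) z :
  ev (\sum_(i <- r | P i) G i) z = \sum_(i <- r | P i) ev (G i) z.
Proof. exact: meval_sum. Qed.

Lemma vdet_change (r : seq 'X_{1..N}) g f (A : 'X_{1..N} -> 'X_{1..N} -> K) zs :
  size r = size zs ->
  {in r, forall m, g m = \sum_(m' <- r) A m m' *: f m'} ->
  vdet r g zs = dt 0%MM 0%MM r r A * vdet r f zs.
Proof.
move=> rz gA; rewrite /vdet -dt_mul //; apply: eq_dt_in => // m z mr _.
by rewrite gA // ev_sum; apply: eq_bigr => m' _; rewrite evZ.
Qed.

Variables (f : 'X_{1..N} -> {mpoly K[N]}) (co : {mpoly K[N]} -> 'X_{1..N} -> K).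
Hypothesis fB : hbasis f co.

Lemma vdet_unitriangular n g zs : size zs = size (monos_le N n) ->
  unitriangular co g -> (forall m, (msize (g m) <= (mdeg m).+1)%N) ->
  vdet (monos_le N n) g zs = vdet (monos_le N n) f zs.
Proof.
move=> sz gU gs; rewrite (@vdet_change _ g f (fun m m' => co (g m) m')) //.
  by rewrite (unitriangular_dt n gU) mul1r.
move=> m; rewrite mem_monos_le => mn; apply: (co_span_le fB).
by apply: leq_trans (gs m) _; rewrite ltnS.
Qed.

Lemma mono_hbasis : hbasis (fun m : 'X_{1..N} => 'X_[m]) (fun (h : {mpoly K[N]}) m => h@_m).
Proof.
split=> [m|a g h m|k h hk|m m']; first by rewrite dhomogX.
- by rewrite mcoeffD mcoeffZ.
- exact: homogE_monos.
- by rewrite mcoeffX.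
Qed.

(** The change of basis is block diagonal by degree. The product of the [coef_dt] is the only place
    through which the resultant enters the estimates. *)
Lemma norm_vdet_hbasis n zs : size zs = size (monos_le N n) ->
  `|vdet (monos_le N n) f zs| =
  (\prod_(k < n.+1) `|coef_dt f k|) * `|vdet (monos_le N n) (fun m => 'X_[m]) zs|.
Proof.
move=> sz; rewrite (@vdet_change _ f (fun m => 'X_[m]) (fun m m' => (f m)@_m')) //; last first.
  move=> m; rewrite mem_monos_le => mn; apply: (co_span_le mono_hbasis).
  rewrite msizeE; apply/bigmax_leqP_seq => x xs _.
  by rewrite (dhomogP _ _ _ (hb_homog fB m) x xs).
rewrite normrM; congr (_ * _); have pR := monos_eq_le N n.
rewrite (ndt_perm _ _ _ _ pR) (ndt_permC _ _ _ _ pR) //; last by rewrite (perm_size pR).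
rewrite dt_flatten ?iota_uniq // => [|k k' _ _ kk m m'].
  rewrite normr_prod -[iota 0 n.+1]/(iota 0 (n.+1 - 0)) -/(index_iota 0 n.+1) big_mkord.
  exact: eq_bigr.
rewrite !mem_monos_eq => /eqP mk /eqP mk'; apply: (dhomog_nemf_coeff (hb_homog fB m)).
by rewrite /= mk mk' eq_sym.
Qed.

End EvaluationDeterminant.

(** * Polynomials as a free module over [K[F]] *)

Section BoxModule.

Variables (K : numFieldType) (N d : nat) (d0 : (0 < d)%N).
Implicit Types (m s : 'X_{1..N}).

Definition box_monos : seq 'X_{1..N} :=
  [seq m : 'X_{1..N} <- monos_le N (N * d) | [forall j, (m j < d)%N]].

Lemma mem_box_monos m : (m \in box_monos) = [forall j, (m j < d)%N].
Proof.
rewrite mem_filter mem_monos_le; case: forallP => //= mb.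
rewrite mdegE; apply: leq_trans (_ : (\sum_(j < N) d <= _)%N).
  by apply: leq_sum => j _; rewrite ltnW ?mb.
by rewrite big_const_ord iter_addn_0 mulnC.
Qed.

Lemma box_monos_uniq : uniq box_monos.
Proof. exact/filter_uniq/monos_le_uniq. Qed.

Lemma mdeg_box_monos s : s \in box_monos -> (mdeg s <= N * d)%N.
Proof. by rewrite mem_filter mem_monos_le => /andP[]. Qed.

Lemma size_box_monos : size box_monos = (d ^ N)%N.
Proof.
pose mk (x : {ffun 'I_N -> 'I_d}) : 'X_{1..N} := [multinom (x j : nat) | j < N].
have mk_inj : injective mk.
  move=> x y /mnmP E; apply/ffunP => j; apply: val_inj.
  by have := E j; rewrite !mnmE.
have -> : (d ^ N)%N = size [seq mk x | x <- enum {: {ffun 'I_N -> 'I_d}}].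
  by rewrite size_map -cardE card_ffun !card_ord.
apply/perm_size/uniq_perm; first exact: box_monos_uniq.
  by rewrite (map_inj_uniq mk_inj) enum_uniq.
move=> m; rewrite mem_box_monos; apply/forallP/mapP => [mb|[x _ ->] j].
  exists [ffun j => Ordinal (mb j)]; rewrite ?mem_enum //.
  by apply/mnmP => j; rewrite mnmE ffunE.
by rewrite mnmE.
Qed.

Lemma mbox_box m : mbox d m \in box_monos.
Proof. by rewrite mem_box_monos; apply/forallP => j; rewrite mnmE ltn_mod. Qed.

Lemma mbox_add s m : s \in box_monos -> mbox d (s + m *+ d)%MM = s.
Proof.
rewrite mem_box_monos => /forallP sb; apply/mnmP => j.
by rewrite [LHS]mnmE mnmDE mulmnE addnC modnMDl modn_small.
Qed.

Lemma mquo_add s m : s \in box_monos -> mquo d (s + m *+ d)%MM = m.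
Proof.
rewrite mem_box_monos => /forallP sb; apply/mnmP => j.
by rewrite [LHS]mnmE mnmDE mulmnE addnC divnMDl // divn_small ?addn0.
Qed.

Lemma monos_le_box n : (N * d <= n)%N -> perm_eq (monos_le N n)
  [seq (s + m *+ d)%MM | s <- box_monos, m <- monos_le N ((n - mdeg s) %/ d)].
Proof.
move=> Nn; apply: uniq_perm; first exact: monos_le_uniq.
  apply: allpairs_uniq_dep => [|s _|]; rewrite ?box_monos_uniq ?monos_le_uniq //.
  move=> _ _ /allpairsPdep[s [m [sb _ ->]]] /allpairsPdep[s' [m' [sb' _ ->]]] /= E.
  have := congr1 (mbox d) E; have := congr1 (mquo d) E.
  by rewrite !mbox_add // !mquo_add // => -> ->.
move=> m; rewrite mem_monos_le; apply/idP/allpairsPdep => [mn|[s [m' [sb + ->]]]].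
  exists (mbox d m), (mquo d m); rewrite mbox_box mem_monos_le -mbox_quo; split=> //.
  rewrite leq_divRL // -mdegMn leq_subRL.
    by rewrite -mdegD -mbox_quo.
  by apply: leq_trans Nn; apply: mdeg_box_monos; apply: mbox_box.
rewrite mem_monos_le leq_divRL // -mdegMn leq_subRL -?mdegD //.
by apply: leq_trans Nn; apply: mdeg_box_monos.
Qed.

(** As [msize] exceeds the degree by one, [p] equals [q], of degree at most [n], up to terms of
    degree below [n]; the relation is compatible with products. *)
Definition lower_than n (p q : {mpoly K[N]}) := (msize q <= n.+1)%N && (msize (p - q) <= n)%N.

Lemma lower_thanM n n' p q p' q' : lower_than n p q -> lower_than n' p' q' ->
  lower_than (n + n') (p * p') (q * q').
Proof.
move=> /andP[qn pqn] /andP[qn' pqn'].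
have sM (x y : {mpoly K[N]}) k k' : (msize x <= k)%N -> (msize y <= k'.+1)%N ->
    (msize (x * y) <= k + k')%N.
  have [->|x0] := eqVneq x 0; first by rewrite mul0r msize0.
  have [->|y0] := eqVneq y 0; first by rewrite mulr0 msize0.
  move=> xk yk; rewrite msizeM //.
  by move: (mmeasure _ x) (mmeasure _ y) xk yk => u v *; lia.
apply/andP; split; first by rewrite -addSn sM.
have p'n : (msize p' <= n'.+1)%N.
  rewrite -[p'](subrK q'); apply: leq_trans (msizeD_le _ _) _.
  by rewrite geq_max qn' (leq_trans pqn').
rewrite (_ : _ - _ = (p - q) * p' + (p' - q') * q); last by ring.
apply: leq_trans (msizeD_le _ _) _; rewrite geq_max sM //=.
by rewrite addnC sM.
Qed.

Variables (a : 'X_{1..N} -> {mpoly K[N]}) (H F : 'I_N -> {mpoly K[N]}).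
Variable co : {mpoly K[N]} -> 'X_{1..N} -> K.
Hypothesis ah : forall s, a s \is (mdeg s).-homog.
Hypothesis fB : hbasis (box_basis d a H) co.
Hypothesis Fd : forall j, (msize (F j) <= d.+1)%N.
Hypothesis HF : forall j, H j = pihomog mdeg d (F j).

Lemma msize_homog k (p : {mpoly K[N]}) : p \is k.-homog -> (msize p <= k.+1)%N.
Proof.
move=> pk; rewrite msizeE; apply/bigmax_leqP_seq => x xs _.
by rewrite (dhomogP _ _ _ pk x xs).
Qed.

Lemma lower_than_F j : lower_than d (F j) (H j).
Proof.
apply/andP; split; first by rewrite HF msize_homog // pihomogP.
rewrite HF {1}(pihomog_partitionE (Fd j)) big_ord_recr /= addrK.
apply: leq_trans (mmeasure_sum _ _ _ _) _; apply/bigmax_leqP => k _.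
by apply: leq_trans (msize_homog (pihomogP _ _ _)) _.
Qed.

Lemma lower_than_power b : lower_than (mdeg b * d) (power_prod F b) (power_prod H b).
Proof.
have l1 : lower_than 0 1 1 by rewrite /lower_than subrr msize1 mmeasure0.
rewrite /power_prod mdegE big_distrl /=.
elim/big_ind3: _ => [|n p q n' p' q'|j _] //; first exact: lower_thanM.
elim: (b j) => [|k IH]; first by rewrite !expr0.
by rewrite mulSn !exprS; apply: lower_thanM => //; apply: lower_than_F.
Qed.

Lemma lower_than_basis m : lower_than (mdeg m) (box_basis d a F m) (box_basis d a H m).
Proof.
rewrite {1}(mbox_quo d m) mdegD mdegMn; apply: lower_thanM; last exact: lower_than_power.
by rewrite /lower_than subrr mmeasure0 msize_homog.
Qed.

Lemma unitriangular_box_basis : unitriangular co (box_basis d a F).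
Proof.
move=> m m' mm; have /andP[_ ds] := lower_than_basis m.
rewrite -[box_basis d a F m](subrK (box_basis d a H m)) (coD fB) (hb_delta fB).
by rewrite (co_small fB) ?add0r // (leq_trans ds) // lemc_mdeg.
Qed.

Lemma msize_box_basis m : (msize (box_basis d a F m) <= (mdeg m).+1)%N.
Proof.
have /andP[s1 s2] := lower_than_basis m.
rewrite -[box_basis d a F m](subrK (box_basis d a H m)).
by apply: leq_trans (msizeD_le _ _) _; rewrite geq_max s1 (leq_trans s2).
Qed.

Lemma subst_by_mono m : subst_by F 'X_[m] = power_prod F m.
Proof.
rewrite /subst_by comp_mpolyX; apply: eq_bigr => j _.
by rewrite tnth_mktuple.
Qed.

Lemma subst_by_expand n p : (msize p <= n.+1)%N ->
  subst_by F p = \sum_(m <- monos_le N n) p@_m *: power_prod F m.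
Proof.
move=> pn; rewrite {1}(co_span_le (mono_hbasis K N) pn) subst_by_sum.
by apply: eq_bigr => m _; rewrite /subst_by comp_mpolyZ -/(subst_by F _) subst_by_mono.
Qed.

Lemma box_basis_add s m : s \in box_monos ->
  box_basis d a F (s + m *+ d)%MM = a s * power_prod F m.
Proof. by move=> sb; rewrite /box_basis mbox_add // mquo_add. Qed.

(** Grouping the basis by box monomials turns a combination over [K] into a combination of the [a s]
    over [K[F]]. *)
Lemma box_sum n (c : 'X_{1..N} -> K) : (N * d <= n)%N ->
  \sum_(m <- monos_le N n) c m *: box_basis d a F m =
  \sum_(s <- box_monos) subst_by F (\sum_(m <- monos_le N ((n - mdeg s) %/ d))
    c (s + m *+ d)%MM *: 'X_[m]) * a s.
Proof.
move=> Nn; rewrite (perm_big _ (monos_le_box Nn)) big_allpairs_dep.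
rewrite !big_seq; apply: eq_bigr => s sb.
rewrite subst_by_sum mulr_suml; apply: eq_bigr => m _.
rewrite box_basis_add // /subst_by comp_mpolyZ -/(subst_by F _) subst_by_mono.
by rewrite -scalerAl mulrC.
Qed.

(** In a large enough degree a relation over [K[F]] expands into a linear relation among vectors of
    a unitriangular family. *)
Lemma box_free (P : 'X_{1..N} -> {mpoly K[N]}) :
  \sum_(s <- box_monos) subst_by F (P s) * a s = 0 ->
  {in box_monos, forall s, P s = 0}.
Proof.
move=> E s0 s0b; pose B := (\max_(s <- box_monos) msize (P s))%N.
have PB s : s \in box_monos -> (msize (P s) <= B)%N.
  by move=> sb; rewrite /B (bigD1_seq s) ?box_monos_uniq //= leq_maxl.
(* Box monomials have degree at most [N * d], so every level [(n - mdeg s) %/ d] reaches the bound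
   [B] on the sizes of the [P s]. *)
pose n := (N * d + N * d + B * d)%N.
have Nn : (N * d <= n)%N by rewrite /n -addnA leq_addr.
have nB s : s \in box_monos -> (B <= (n - mdeg s) %/ d)%N.
  move=> /mdeg_box_monos sN; rewrite leq_divRL // leq_subRL ?(leq_trans sN) //.
  by rewrite /n -addnA leq_add // leq_addl.
pose c (m : 'X_{1..N}) := (P (mbox d m))@_(mquo d m).
have : \sum_(m <- monos_le N n) c m *: box_basis d a F m = 0.
  rewrite box_sum // -[RHS]E !big_seq; apply: eq_bigr => s sb; congr (subst_by F _ * _).
  rewrite [RHS](co_span_le (n := (n - mdeg s) %/ d) (mono_hbasis K N)); last first.
    by apply: leq_trans (PB s sb) _; apply: leq_trans (nB s sb) _.
  by apply: eq_bigr => m _; rewrite /c mbox_add // mquo_add.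
move=> /(unitriangular_free fB unitriangular_box_basis) c0.
apply/mpolyP => m; rewrite mcoeff0; have [Pm|Pm] := boolP (m \in msupp (P s0)); last first.
  exact: memN_msupp_eq0.
have := c0 (s0 + m *+ d)%MM; rewrite /c mbox_add // mquo_add //; apply.
rewrite mem_monos_le mdegD mdegMn.
have := msize_mdeg_lt Pm; have := PB s0 s0b; have := mdeg_box_monos s0b.
by rewrite /n; move: (mmeasure _ _) (mdeg m) (mdeg s0) => x y z *; nia.
Qed.

Lemma box_span h : exists P : 'X_{1..N} -> {mpoly K[N]},
  h = \sum_(s <- box_monos) subst_by F (P s) * a s.
Proof.
pose n := (N * d + msize h)%N.
have hn : (msize h <= n.+1)%N by rewrite ltnW // ltnS leq_addl.
have [c E] := unitriangular_span fB unitriangular_box_basis msize_box_basis hn.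
exists (fun s => \sum_(m <- monos_le N ((n - mdeg s) %/ d)) c (s + m *+ d)%MM *: 'X_[m]).
by rewrite {1}E box_sum // leq_addr.
Qed.

End BoxModule.

Section Monic.

Variables (K : idomainType) (N : nat).
Implicit Types (p q : {mpoly K[N]}) (m : 'X_{1..N}).

(** Stated by coefficients so as to match unitriangularity relative to the monomial basis. *)
Definition monic_at p m := p@_m = 1 /\ forall m', (m < m')%O -> p@_m' = 0.

Lemma monic_at_mlead p m : monic_at p m -> mlead p = m.
Proof.
move=> [pm p0]; apply/eqP; rewrite eq_le; apply/andP; split.
  have [//|lt_] := leP (mlead p) m; have := p0 _ lt_.
  have pn : p != 0 by apply: contra_eq_neq pm => ->; rewrite mcoeff0 eq_sym oner_eq0.
  by move/eqP; rewrite mleadc_eq0 (negPf pn).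
by apply: msupp_le_mlead; rewrite mcoeff_msupp pm oner_eq0.
Qed.

Lemma monic_atM p m q m' : monic_at p m -> monic_at q m' -> monic_at (p * q) (m + m')%MM.
Proof.
move=> pm qm; have [lp lq] := (monic_at_mlead pm, monic_at_mlead qm).
have pn : p != 0.
  by case: pm => + _; apply: contra_eq_neq => ->; rewrite mcoeff0 eq_sym oner_eq0.
have qn : q != 0.
  by case: qm => + _; apply: contra_eq_neq => ->; rewrite mcoeff0 eq_sym oner_eq0.
have lpq : mlead (p * q) = (m + m')%MM by rewrite mleadM // lp lq.
split; last by move=> m'' h; apply: mcoeff_gt_mlead; rewrite lpq.
by rewrite -lpq mleadM // mleadcM lp lq pm.1 qm.1 mulr1.
Qed.

Lemma monic_at_mono m : monic_at 'X_[m] m.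
Proof. by split=> [|m' mm']; rewrite mcoeffX ?eqxx // lt_eqF. Qed.

Lemma monic_at_exp p m k : monic_at p m -> monic_at (p ^+ k) (m *+ k)%MM.
Proof.
move=> pm; elim: k => [|k IH]; last by rewrite exprS mulmS; apply: monic_atM.
by rewrite expr0 mulm0n -mpolyX0; apply: monic_at_mono.
Qed.

Lemma monic_at_size p m : monic_at p m -> msize p = (mdeg m).+1.
Proof. 
move=> pm; rewrite -(monic_at_mlead pm) mlead_deg //.
by case: pm => + _; apply: contra_eq_neq => ->; rewrite mcoeff0 eq_sym oner_eq0.
Qed.

End Monic.

(** * Suprema of Vandermonde determinants *)

Section ComplexNorm.

Variable R : realType.
Local Notation K := R[i].
Local Notation nm := Normc.normc.

Lemma normcE_norm (x : K) : `|x| = (nm x)%:C.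
Proof. by []. Qed.

Lemma normc_ge0 (x : K) : 0 <= nm x.
Proof. by rewrite -lecR -normcE_norm normr_ge0. Qed.

Lemma normcX (x : K) k : nm (x ^+ k) = nm x ^+ k.
Proof. by elim: k => [|k IH]; rewrite ?expr0 ?Normc.normc1 // !exprS Normc.normcM IH. Qed.

Lemma normc_prod (I : Type) (r : seq I) (P : pred I) (F : I -> K) :
  nm (\prod_(i <- r | P i) F i) = \prod_(i <- r | P i) nm (F i).
Proof. by elim/big_rec2: _ => [|i x y _ <-]; rewrite ?Normc.normc1 ?Normc.normcM. Qed.

Lemma normc_sum_le (I : Type) (r : seq I) (P : pred I) (F : I -> K) :
  nm (\sum_(i <- r | P i) F i) <= \sum_(i <- r | P i) nm (F i).
Proof.
elim/big_rec2: _ => [|i x y _ h]; first by rewrite Normc.normc0.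
by apply: le_trans (le_normcD _ _) _; rewrite lerD2l.
Qed.

Lemma ndt_le_normc (T1 T2 : eqType) (x1 : T1) (x2 : T2) r c (M : T1 -> T2 -> K)
    (t : T1 -> R) : size r = size c ->
  {in r & c, forall x y, nm (M x y) <= t x} ->
  nm (dt x1 x2 r c M) <= (size r)`!%:R * \prod_(x <- r) t x.
Proof.
move=> src Mt; rewrite -lecR -normcE_norm.
have -> : ((size r)`!%:R * \prod_(x <- r) t x)%:C =
    (size r)`!%:R * \prod_(x <- r) (t x)%:C :> K.
  by rewrite rmorphM rmorph_nat rmorph_prod.
by apply: ndt_le => // x y xr yc; rewrite normcE_norm lecR Mt.
Qed.

Lemma ndt_cons_le_normc (T1 T2 : eqType) (x1 : T1) (x2 : T2) x r c
    (M : T1 -> T2 -> K) (B V : R) : size c = (size r).+1 ->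
  {in c, forall y, nm (M x y) <= B} ->
  (forall c', size c' = size r -> {subset c' <= c} -> nm (dt x1 x2 r c' M) <= V) ->
  nm (dt x1 x2 (x :: r) c M) <= (size r).+1%:R * (B * V).
Proof.
move=> sc MB MV; rewrite -lecR -normcE_norm.
have -> : ((size r).+1%:R * (B * V))%:C = (size r).+1%:R * (B%:C * V%:C) :> K.
  by rewrite !rmorphM rmorph_nat.
apply: ndt_cons_le => // [y yc|c' sc' c'c]; rewrite normcE_norm lecR; first exact: MB.
exact: MV.
Qed.

End ComplexNorm.

Section FeketeSup.

Variables (R : realType) (N : nat).
Local Notation K := R[i].
Local Notation nm := Normc.normc.
Variable E : set 'rV[K]_N.
Implicit Types (r : seq 'X_{1..N}) (g : 'X_{1..N} -> {mpoly K[N]}) (zs : seq 'rV[K]_N).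

Definition points_in zs := forall z, z \in zs -> E z.

Definition vset r g : set R :=
  [set x | exists zs, [/\ size zs = size r, points_in zs & x = nm (vdet r g zs)]]%classic.

(** The conventions of [sup] give 0 for an empty or unbounded set, whence nonnegativity for every
    [E]. *)
Definition vsup r g : R := sup (vset r g).

Lemma vsup_ge0 r g : 0 <= vsup r g.
Proof.
rewrite /vsup; have [[x Ax]|/set0P/negP/negPn/eqP ->] := pselect (vset r g !=set0)%classic; last first.
  by rewrite sup0.
have [ub|nub] := pselect (has_ubound (vset r g)); last first.
  by rewrite sup_out // => -[].
have [zs [_ _ xE]] := Ax.
by apply: le_trans (ub_le_sup ub Ax); rewrite xE normc_ge0.
Qed.

Lemma vsup_le r g v : 0 <= v ->
  (forall zs, size zs = size r -> points_in zs -> nm (vdet r g zs) <= v) ->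
  vsup r g <= v.
Proof.
move=> v0 H; rewrite /vsup.
have [A0|/set0P/negP/negPn/eqP ->] := pselect (vset r g !=set0)%classic; last by rewrite sup0.
by apply: sup_le_ub => // x [zs [sz zE ->]]; apply: H.
Qed.

Hypothesis Eb : exists rho : R, forall z, E z -> forall i, nm (z ord0 i) <= rho.

Lemma ev_mono (m : 'X_{1..N}) (z : 'rV[K]_N) : ev 'X_[m] z = \prod_i z ord0 i ^+ m i.
Proof. exact: mevalX. Qed.

Lemma ev_mono_le (rho : R) (m : 'X_{1..N}) (z : 'rV[K]_N) : 1 <= rho -> (forall i, nm (z ord0 i) <= rho) ->
  nm (ev 'X_[m] z) <= rho ^+ mdeg m.
Proof.
move=> r1 zr; rewrite ev_mono normc_prod mdegE -prodrXr.
apply: ler_prod => i _; rewrite normc_ge0 normcX /=.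
by apply: lerXn2r; rewrite ?nnegrE ?normc_ge0 ?(le_trans ler01).
Qed.

Lemma bounded_radius : exists2 rho : R, 1 <= rho & forall z, E z -> forall i, nm (z ord0 i) <= rho.
Proof.
have [rho H] := Eb; exists (Num.max 1 rho); first by rewrite le_max lexx.
by move=> z Ez i; rewrite le_max H ?orbT.
Qed.

Lemma ev_bounded (p : {mpoly K[N]}) : exists2 c : R, 0 <= c & forall z, E z -> nm (ev p z) <= c.
Proof.
have [rho r1 H] := bounded_radius.
exists (\sum_(m <- msupp p) nm p@_m * rho ^+ mdeg m).
  by apply: sumr_ge0 => m _; rewrite mulr_ge0 ?normc_ge0 ?exprn_ge0 ?(le_trans ler01).
move=> z Ez; rewrite [p in ev p _]mpolyE ev_sum; apply: le_trans (normc_sum_le _ _ _) _.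
apply: ler_sum => m _; rewrite evZ Normc.normcM ler_wpM2l ?normc_ge0 //.
by apply: ev_mono_le => //; apply: H.
Qed.

Lemma ev_bounded_fin (T : eqType) (s : seq T) (p : T -> {mpoly K[N]}) :
  exists2 c : R, 1 <= c & {in s, forall x, forall z, E z -> nm (ev (p x) z) <= c}.
Proof.
elim: s => [|x s [c c1 cP]]; first by exists 1.
have [c' c'0 c'P] := ev_bounded (p x); exists (c + c'); first by rewrite (le_trans c1) ?lerDl.
move=> y; rewrite inE => /predU1P[->|ys] z Ez.
  by apply: le_trans (c'P z Ez) _; rewrite lerDr (le_trans ler01).
by apply: le_trans (cP y ys z Ez) _; rewrite lerDl.
Qed.

Lemma vset_ub r g : has_ubound (vset r g).
Proof.
have [c c1 cP] := ev_bounded_fin r g.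
exists ((size r)`!%:R * \prod_(m <- r) c) => x [zs [sz zE ->]].
by apply: ndt_le_normc => // m z mr zz; apply: cP => //; apply: zE.
Qed.

Lemma vsup_ub r g zs : size zs = size r -> points_in zs -> nm (vdet r g zs) <= vsup r g.
Proof. by move=> sz zE; apply: ub_le_sup; [apply: vset_ub|exists zs]. Qed.

(** Laplace expansion row by row: each row of [r1] costs at most the number of rows times [B]. *)
Lemma vdet_rest r1 r2 g (B : R) zs : 0 <= B ->
  {in r1, forall m, forall z, E z -> nm (ev (g m) z) <= B} ->
  size zs = size (r1 ++ r2) -> points_in zs ->
  nm (vdet (r1 ++ r2) g zs) <= ((size (r1 ++ r2))%:R * B) ^+ size r1 * vsup r2 g.
Proof.
move=> B0; elim: r1 zs => [|m r1 IH] zs rB sz zE /=.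
  by rewrite expr0 mul1r; apply: vsup_ub.
have V0 := vsup_ge0 r2 g; set V := vsup r2 g in V0 IH *.
set n := size (r1 ++ r2) in IH sz *.
apply: le_trans (ndt_cons_le_normc (B := B) (V := (n%:R * B) ^+ size r1 * V) _ _ _) _.
- by rewrite sz.
- by move=> z zz; apply: rB; rewrite ?mem_head //; apply: zE.
- move=> c' sc' c'c; apply: IH => // [m' m'r|z zc]; first by apply: rB; rewrite inE m'r orbT.
  exact/zE/c'c.
rewrite -/n exprS mulrA -[leRHS]mulrA ler_wpM2l ?mulr_ge0 ?ler0n //.
rewrite ler_wpM2r // lerXn2r ?nnegrE ?mulr_ge0 ?ler0n //.
by rewrite ler_wpM2r // ler_nat.
Qed.

Lemma vsup_cat_le r1 r2 g (B : R) : 0 <= B ->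
  {in r1, forall m, forall z, E z -> nm (ev (g m) z) <= B} ->
  vsup (r1 ++ r2) g <= ((size (r1 ++ r2))%:R * B) ^+ size r1 * vsup r2 g.
Proof.
move=> B0 rB; apply: vsup_le => [|zs sz zE]; last exact: vdet_rest.
by rewrite mulr_ge0 ?vsup_ge0 ?exprn_ge0 ?mulr_ge0 ?ler0n.
Qed.

Lemma vsup_perm r r' g : perm_eq r r' -> vsup r g = vsup r' g.
Proof.
move=> rr; have sr := perm_size rr; congr sup; apply/seteqP; split=> x [zs [sz zE ->]].
  exists zs; split=> //; first by rewrite sz.
  by apply: (@complexI R); rewrite -!normcE_norm (ndt_perm _ _ _ _ rr).
exists zs; split=> //; first by rewrite sz.
by apply: (@complexI R); rewrite -!normcE_norm (ndt_perm _ _ _ _ rr).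
Qed.

Local Notation X := (fun m : 'X_{1..N} => 'X_[m] : {mpoly K[N]}).

(** Expansion along the last column: the cofactors do not depend on the last point, and the one at
    the largest monomial [m] is the determinant without it. *)
Lemma vdet_rcons_poly r (m : 'X_{1..N}) zs : size zs = size r -> {in r, forall m', (m' < m)%O} ->
  exists P : {mpoly K[N]}, [/\ P@_m = vdet r X zs, forall m', (m < m')%O -> P@_m' = 0 &
    forall z, vdet (rcons r m) X (rcons zs z) = ev P z].
Proof.
move=> sz rm; pose k := size r.
pose A z := \matrix_(i < k.+1, j < k.+1) ev (X (nth 0%MM (rcons r m) i)) (nth 0 (rcons zs z) j).
pose c i := cofactor (A 0) i ord_max.
have cE z i : cofactor (A z) i ord_max = c i.
  rewrite /c /cofactor; congr (_ * \det _); apply/matrixP => u v; rewrite !mxE.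
  by congr ev; rewrite !nth_rcons lift_max (_ : (v < size zs)%N) // sz.
have vE z : vdet (rcons r m) X (rcons zs z) = \det (A z).
  by rewrite /vdet (dtE _ _ _ _ (size_rcons r m)).
exists (\sum_(i < k.+1) c i *: X (nth 0%MM (rcons r m) i)); split.
- rewrite raddf_sum big_ord_recr /= big1 ?add0r => [|i _]; last first.
    rewrite mcoeffZ mcoeffX nth_rcons /= ltn_ord.
    by rewrite lt_eqF ?mulr0 // rm // mem_nth.
  rewrite mcoeffZ mcoeffX nth_rcons ltnn eqxx eqxx mulr1 /c /cofactor.
  rewrite addnn -signr_odd odd_double expr0 mul1r /vdet /dt; congr (\det _).
  apply/matrixP => u v; rewrite !mxE !nth_rcons !lift_max (_ : (v < size zs)%N) ?sz //.
  by rewrite (_ : (u < size r)%N).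
- move=> m' mm'; rewrite raddf_sum big1 // => i _; rewrite /= mcoeffZ mcoeffX.
  suff /lt_eqF -> : (nth 0%MM (rcons r m) i < m')%O by rewrite mulr0.
  have : nth 0%MM (rcons r m) i \in rcons r m by rewrite mem_nth // size_rcons.
  by rewrite mem_rcons inE => /predU1P[->//|/rm h]; apply: lt_trans mm'.
- move=> z; rewrite vE (expand_det_col _ ord_max) ev_sum; apply: eq_bigr => i _.
  rewrite cE evZ mulrC; congr (_ * _); rewrite mxE /=; congr ev.
  by rewrite nth_rcons /k -sz ltnn eqxx.
Qed.

(* A near-maximal configuration for the first monomials, completed by a variable
   point, yields a monic polynomial with sup norm at most twice the ratio of two
   consecutive suprema; the product telescopes. *)
Lemma chebyshev_polynomials r : sorted <%O r ->
  exists (p : 'X_{1..N} -> {mpoly K[N]}) (t : 'X_{1..N} -> R),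
  [/\ {in r, forall m, monic_at (p m) m}, forall m, 0 <= t m,
      {in r, forall m, forall z, E z -> nm (ev (p m) z) <= t m} &
      \prod_(m <- r) t m <= 2 ^+ size r * vsup r X].
Proof.
elim/last_ind: r => [_|r m IH].
  exists X, (fun _ => 0); split=> //; rewrite big_nil expr0 mul1r.
  have Z : nm (vdet [::] X [::]) = 1 by rewrite /vdet dt_nil Normc.normc1.
  by rewrite -Z; apply: vsup_ub.
rewrite (sorted_pairwise lt_trans) pairwise_rcons -(sorted_pairwise lt_trans).
move=> /andP[/allP rm /IH[p [t [pm t0 pt tr]]]].
have mr : m \notin r by apply/negP => /rm; rewrite ltxx.
have [q [s [qm s0 qs sr]]] : exists (q : {mpoly K[N]}) (s : R),
    [/\ monic_at q m, 0 <= s, forall z, E z -> nm (ev q z) <= s &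
     (2 ^+ size r * vsup r X) * s <= 2 ^+ (size r).+1 * vsup (rcons r m) X].
  (* If the supremum is 0, so is the left-hand side, and the monomial itself will do. *)
  have [V0|V0] := leP (vsup r X) 0.
    have [c c0 cP] := ev_bounded 'X_[m]; exists 'X_[m], c; split=> //.
      split=> [|m' mm']; rewrite mcoeffX ?eqxx //.
      by rewrite lt_eqF.
    have -> : vsup r X = 0 by apply/le_anti; rewrite V0 vsup_ge0.
    by rewrite mulr0 mul0r mulr_ge0 ?vsup_ge0 ?exprn_ge0.
  have hs : has_sup (vset r X).
    split; last exact: vset_ub.
    by apply/set0P/eqP => A0; move: V0; rewrite /vsup A0 sup0 ltxx.
  (* A configuration within a factor 2 of the supremum; this is the source of the powers of 2. *)
  have [_ [zs [sz zE ->]]] := sup_adherent (divr_gt0 V0 (ltr0n R 2)) hs.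
  rewrite -/(vsup r X) => big; set D := nm _ in big.
  have D0 : vsup r X / 2 < D by lra.
  have Dp : 0 < D by apply: lt_trans D0; rewrite divr_gt0.
  have [P [Pm P0 PE]] := @vdet_rcons_poly r m zs sz rm.
  have d0 : vdet r X zs != 0.
    by apply: contraTneq Dp => E0; rewrite /D E0 Normc.normc0 ltxx.
  exists ((vdet r X zs)^-1 *: P), (vsup (rcons r m) X / D); split.
  - split=> [|m' mm']; rewrite mcoeffZ; first by rewrite Pm mulVf.
    by rewrite P0 ?mulr0.
  - by rewrite divr_ge0 ?vsup_ge0 // ltW.
  - move=> z Ez; rewrite evZ Normc.normcM Normc.normcV -/D mulrC ler_pM2r ?invr_gt0 //.
    rewrite -PE; apply: vsup_ub; first by rewrite !size_rcons sz.
    by move=> z'; rewrite mem_rcons inE => /predU1P[->|/zE].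
  - have V'0 := vsup_ge0 (rcons r m) X; set V' := vsup (rcons r m) X in V'0 *.
    have p2 : 0 <= 2 ^+ size r * V' by rewrite mulr_ge0 ?exprn_ge0.
    have -> : 2 ^+ size r * vsup r X * (V' / D) = (2 ^+ size r * V') * (vsup r X / D).
      by rewrite -!mulrA; congr (_ * _); rewrite mulrCA.
    rewrite exprS [leRHS](_ : _ = 2 ^+ size r * V' * 2); last by rewrite -mulrA mulrC.
    rewrite ler_wpM2l // ler_pdivrMr //; lra.
exists (fun x => if x == m then q else p x), (fun x => if x == m then s else t x); split.
- move=> x; rewrite mem_rcons inE; case: eqP => [->//|_ /= xr]; exact: pm.
- by move=> x; case: eqP.
- by move=> x; rewrite mem_rcons inE; case: eqP => //= _ xr; apply: pt.
- rewrite big_rcons /= eqxx size_rcons; apply: le_trans sr.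
  rewrite ler_wpM2r // (le_trans _ tr) // !big_seq le_eqVlt; apply/orP; left; apply/eqP.
  by apply: eq_bigr => x xr; case: eqP => // E0; move: mr; rewrite -E0 xr.
Qed.

End FeketeSup.

(** * Counting monomials *)

Section Counting.

Variable N : nat.
Implicit Types (m : 'X_{1..N}).

Lemma perm_monos_tuple n (P : pred nat) (s : seq 'X_{1..N}) : uniq s ->
  (forall m, (m \in s) = (mdeg m <= n)%N && P (mdeg m)) ->
  size s = #|[set t : N.-tuple 'I_n.+1 | P (\sum_(i <- t) i)%N && (\sum_(i <- t) i <= n)%N]|.
Proof.
move=> us sE; pose mk (t : N.-tuple 'I_n.+1) : 'X_{1..N} := [multinom (tnth t j : nat) | j < N].
have mk_inj : injective mk.
  move=> x y /mnmP E; apply/eq_from_tnth => j; apply: val_inj.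
  by have := E j; rewrite !mnmE.
have degE t : mdeg (mk t) = (\sum_(i <- t) i)%N.
  by rewrite mdegE big_tuple; apply: eq_bigr => j _; rewrite mnmE.
rewrite cardE -(size_map mk); apply/perm_size/uniq_perm => //.
  by rewrite (map_inj_uniq mk_inj) enum_uniq.
move=> m; rewrite sE; apply/idP/mapP => [/andP[mn Pm]|[t]]; last first.
  by rewrite mem_enum inE => /andP[Pt tn] ->; rewrite degE tn Pt.
have mj j : (m j < n.+1)%N by rewrite ltnS (leq_trans (mnm_le_mdeg m j)).
have mE : m = mk [tuple Ordinal (mj j) | j < N].
  by apply/mnmP => j; rewrite mnmE tnth_mktuple.
exists [tuple Ordinal (mj j) | j < N] => //.
by rewrite mem_enum inE -degE -mE Pm mn.
Qed.

Lemma size_monos_leE n : size (monos_le N n) = 'C(N + n, N).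
Proof.
rewrite (@perm_monos_tuple n predT) ?monos_le_uniq // => [|m]; last first.
  by rewrite mem_monos_le andbT.
by rewrite -card_partial_ord_partitions; apply: eq_card => t; rewrite !inE.
Qed.

Lemma size_monos_eqE k : (0 < N)%N -> size (monos_eq N k) = 'C(N.-1 + k, N.-1).
Proof.
move=> N0; rewrite (@perm_monos_tuple k (pred1 k)) ?monos_eq_uniq // => [|m]; last first.
  by rewrite mem_monos_eq /= eq_sym; case: ltngtP.
case: N N0 => // N' _; rewrite -card_ord_partitions; apply: eq_card => t; rewrite !inE /=.
by case: ltngtP.
Qed.

Lemma monos_leS n : perm_eq (monos_le N n.+1) (monos_eq N n.+1 ++ monos_le N n).
Proof.
apply: uniq_perm => [||m]; first exact: monos_le_uniq.
  rewrite cat_uniq monos_eq_uniq monos_le_uniq andbT /=; apply/hasPn => m.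
  by rewrite mem_monos_le mem_monos_eq => mn; rewrite ltn_eqF.
by rewrite mem_cat mem_monos_eq !mem_monos_le leq_eqVlt ltnS.
Qed.

Lemma sum_mdeg_monos_le n : (0 < N)%N ->
  (\sum_(m <- monos_le N n) mdeg m = N * 'C(N + n, N.+1))%N.
Proof.
move=> N0; elim: n => [|n IH].
  rewrite addn0 bin_small // muln0 big_seq big1 // => m.
  by rewrite mem_monos_le leqn0 => /eqP.
rewrite (perm_big _ (monos_leS n)) big_cat /= IH addnS binS mulnDr addnC; congr (_ + _)%N.
transitivity (size (monos_eq N n.+1) * n.+1)%N.
  rewrite -sum1_size big_distrl /= !big_seq; apply: eq_bigr => m.
  by rewrite mem_monos_eq mul1n => /eqP.
rewrite size_monos_eqE //; case: N N0 => // N' _ /=.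
have := mul_bin_left (N' + n.+1) N'.
by rewrite addKn [(n.+1 * _)%N]mulnC => <-; rewrite addSnnS.
Qed.

Lemma bin_le_expn a k : ('C(a + k, a) <= k.+1 ^ a)%N.
Proof.
elim: a => [|a IH]; first by rewrite bin0.
rewrite -(leq_pmul2l (ltn0Sn a)) addSn -mul_bin_diag -addSn expnS.
rewrite mulnA; apply: leq_mul IH; nia.
Qed.

Lemma size_monos_le_le n : (size (monos_le N n) <= n.+1 ^ N)%N.
Proof. by rewrite size_monos_leE bin_le_expn. Qed.

Lemma size_monos_eq_le n : (0 < N)%N -> (size (monos_eq N n) <= n.+1 ^ N.-1)%N.
Proof. by move=> N0; rewrite size_monos_eqE // bin_le_expn. Qed.

End Counting.

(** * Almost submultiplicative behaviour of the suprema *)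

Section Zaharjuta.

Variables (R : realType) (N : nat).
Local Notation K := R[i].
Local Notation nm := Normc.normc.
Local Notation X := (fun m : 'X_{1..N} => 'X_[m] : {mpoly K[N]}).
Variables (E : set 'rV[K]_N) (rho : R).
Hypothesis rho1 : 1 <= rho.
Hypothesis Erho : forall z, E z -> forall i, nm (z ord0 i) <= rho.

Lemma vsup_unitriangular_le n (f g : 'X_{1..N} -> {mpoly K[N]}) co (t : 'X_{1..N} -> R) :
  hbasis f co -> unitriangular co g ->
  (forall m, (msize (g m) <= (mdeg m).+1)%N) ->
  {in monos_le N n, forall m, forall z, E z -> nm (ev (g m) z) <= t m} ->
  (forall m, 0 <= t m) ->
  vsup E (monos_le N n) f <= (size (monos_le N n))`!%:R * \prod_(m <- monos_le N n) t m.
Proof.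
move=> fB gU gs gt.
move=> t0; apply: vsup_le => [|zs sz zE]; first by rewrite mulr_ge0 ?ler0n ?prodr_ge0.
rewrite -(vdet_unitriangular fB sz gU gs); apply: ndt_le_normc => // m z mn zz.
by apply: gt => //; apply: zE.
Qed.

(** The condition on [n] leaves room for any box monomial besides [q] times a monomial of degree
    [m], so each class modulo [q] is complete. *)
Lemma perm_monos_box n m q : (0 < q)%N -> (q * (m + N) <= n)%N ->
  perm_eq [seq a <- monos_le N n | (mdeg (mquo q a) <= m)%N]
  [seq (s + c *+ q)%MM | s <- box_monos N q, c <- monos_le N m].
Proof.
move=> q0 qn; apply: uniq_perm; first by rewrite filter_uniq ?monos_le_uniq.
  apply: allpairs_uniq_dep => [|s _|]; rewrite ?box_monos_uniq ?monos_le_uniq //.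
  move=> _ _ /allpairsPdep[s [c [sb _ ->]]] /allpairsPdep[s' [c' [sb' _ ->]]] /= e.
  have := congr1 (mbox q) e; have := congr1 (mquo q) e.
  by rewrite !mbox_add // !mquo_add // => -> ->.
move=> a; rewrite mem_filter mem_monos_le; apply/andP/allpairsPdep => [[am an]|].
  by exists (mbox q a), (mquo q a); rewrite mbox_box // mem_monos_le -mbox_quo.
move=> [s [c [sb + ->]]]; rewrite mem_monos_le mquo_add // => cm; split=> //.
rewrite mdegD mdegMn; have := mdeg_box_monos sb; nia.
Qed.

(** The rows are [z^s p_c^q] with the monic polynomials [p_c] of [chebyshev_polynomials]: [q^N]
    values of [s], each contributing a [q]-th power, give the exponent [q^(N+1)]. After division by
    powers of [rho], the factors [z^s] and the rows with quotient of degree above [m] contribute at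
    most 1. *)
Lemma vsup_power_le n m q : (0 < q)%N -> (q * (m + N) <= n)%N ->
  vsup E (monos_le N n) X / rho ^+ (\sum_(a <- monos_le N n) mdeg a) <=
  (size (monos_le N n))`!%:R *
  (2 ^+ size (monos_le N m) *
   (vsup E (monos_le N m) X / rho ^+ (\sum_(a <- monos_le N m) mdeg a))) ^+ (q ^ N.+1).
Proof.
move=> q0 qn; have rho0 : 0 < rho by apply: lt_le_trans rho1.
have rhoX k : 0 <= rho ^+ k by rewrite exprn_ge0 // ltW.
have Eb : exists r : R, forall z, E z -> forall i, nm (z ord0 i) <= r by exists rho.
have sm : sorted <%O (monos_le N m) by rewrite lt_sorted_uniq_le monos_le_uniq monos_le_sorted.
have [p [t [pm t0 pt tprod]]] := chebyshev_polynomials Eb sm.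
pose g a := if (mdeg (mquo q a) <= m)%N then X (mbox q a) * p (mquo q a) ^+ q else X a.
pose u a := if (mdeg (mquo q a) <= m)%N then (t (mquo q a) / rho ^+ mdeg (mquo q a)) ^+ q else 1.
have gm a : monic_at (g a) a.
  rewrite /g; case: leqP => [am|_]; last exact: monic_at_mono.
  rewrite {3}(mbox_quo q a); apply: monic_atM; first exact: monic_at_mono.
  by apply/monic_at_exp/pm; rewrite mem_monos_le.
have gu : {in monos_le N n, forall a, forall z, E z -> nm (ev (g a) z) <= rho ^+ mdeg a * u a}.
  move=> a _ z Ez; rewrite /g /u; case: leqP => [am|_]; last first.
    by rewrite mulr1; apply: ev_mono_le => //; apply: Erho.
  have -> : rho ^+ mdeg a * (t (mquo q a) / rho ^+ mdeg (mquo q a)) ^+ q =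
      rho ^+ mdeg (mbox q a) * t (mquo q a) ^+ q.
    rewrite {1}(mbox_quo q a) mdegD mdegMn exprD exprM expr_div_n mulrA -mulrA.
    by rewrite mulrACA divff ?mulr1 // expf_neq0 // expf_neq0 // gt_eqF.
  rewrite evM Normc.normcM ler_pM ?normc_ge0 //; first by apply: ev_mono_le => //; apply: Erho.
  rewrite /ev meval_exp normcX; apply: lerXn2r; rewrite ?nnegrE ?normc_ge0 //.
  by apply: pt; rewrite ?mem_monos_le.
have gU : unitriangular (fun (h : {mpoly K[N]}) m => h@_m) g.
  move=> a a'; rewrite le_eqVlt => /predU1P[<-|aa]; first by rewrite eqxx (gm a).1.
  by rewrite (gm a).2 // lt_eqF.
have gs a : (msize (g a) <= (mdeg a).+1)%N by rewrite (monic_at_size (gm a)).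
rewrite ler_pdivrMr ?exprn_gt0 //.
apply: le_trans (vsup_unitriangular_le (mono_hbasis K N) gU gs gu _) _.
  move=> a; rewrite mulr_ge0 // /u; case: ifP => // _.
  by rewrite exprn_ge0 // divr_ge0.
rewrite -mulrA ler_wpM2l ?ler0n // big_split /= -expr_sum mulrC.
rewrite ler_wpM2r //.
have -> : \prod_(a <- monos_le N n) u a =
    (\prod_(c <- monos_le N m) (t c / rho ^+ mdeg c)) ^+ (q ^ N.+1).
  rewrite /u -big_mkcond -big_filter (perm_big _ (perm_monos_box q0 qn)) big_allpairs_dep.
  rewrite big_seq (eq_bigr (fun=> (\prod_(c <- monos_le N m) (t c / rho ^+ mdeg c)) ^+ q)).
    by rewrite -big_seq big_const_seq count_predT iter_mulr_1 size_box_monos -exprM -expnS.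
  move=> s sb; rewrite -prodrXl; apply: eq_bigr => c _.
  by rewrite mquo_add.
apply: lerXn2r; rewrite ?nnegrE.
- by apply: prodr_ge0 => c _; rewrite divr_ge0 ?exprn_ge0 // ltW.
- by rewrite mulr_ge0 ?exprn_ge0 // divr_ge0 ?vsup_ge0.
rewrite big_split /= prodfV -expr_sum mulrA ler_wpM2r // invr_ge0 //.
Qed.

End Zaharjuta.

(** * Comparison of a set with its preimage *)

Lemma ltmc_muln N d (m m' : 'X_{1..N}) : (0 < d)%N -> (m < m')%O -> ((m *+ d)%MM < (m' *+ d)%MM)%O.
Proof.
case: d => // d _ mm; elim: d => [|d IH]; first by rewrite !mulm1n.
by rewrite ![(_ *+ d.+2)%MM]mulmS; apply: ltmc_le_add => //; apply: ltW.
Qed.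

Section Rows.

Variables (R : realType) (N : nat).
Local Notation K := R[i].
Local Notation nm := Normc.normc.
Local Notation X := (fun m : 'X_{1..N} => 'X_[m] : {mpoly K[N]}).
Variables (E : set 'rV[K]_N) (rho : R).
Hypothesis rho1 : 1 <= rho.
Hypothesis Erho : forall z, E z -> forall i, nm (z ord0 i) <= rho.

(** Each row of degree above [n] is a monomial bounded by [rho ^+ k] on [E] and is discarded by
    Laplace expansion. *)
Lemma vsup_monos_le n k : (n <= k)%N ->
  vsup E (monos_le N k) X <=
  ((size (monos_le N k))%:R * rho ^+ k) ^+ (size (monos_le N k) - size (monos_le N n)) *
  vsup E (monos_le N n) X.
Proof.
move=> nk; pose r := [seq m : 'X_{1..N} <- monos_le N k | (n < mdeg m)%N].
have pr : perm_eq (monos_le N k) (r ++ monos_le N n).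
  rewrite -(perm_filterC (fun m => (n < mdeg m)%N) (monos_le N k)) perm_cat2l.
  apply: uniq_perm; rewrite ?filter_uniq ?monos_le_uniq // => m.
  rewrite mem_filter !mem_monos_le /= -leqNgt.
  by apply/andP/idP => [[]//|mn]; split=> //; apply: leq_trans nk.
rewrite (vsup_perm _ _ pr).
have sE : (size (monos_le N k) - size (monos_le N n) = size r)%N.
  by rewrite (perm_size pr) size_cat addnK.
rewrite sE (perm_size pr); apply: vsup_cat_le; first by exists rho.
  by rewrite exprn_ge0 // (le_trans ler01).
move=> m; rewrite mem_filter mem_monos_le => /andP[_ mk] z Ez.
apply: le_trans (ev_mono_le _ rho1 (Erho Ez)) _.
by apply: ler_weXn2l.
Qed.

Lemma vsup_hbasis_le n (f : 'X_{1..N} -> {mpoly K[N]}) co : hbasis f co ->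
  vsup E (monos_le N n) f <=
  (\prod_(k < n.+1) nm (coef_dt f k)) * vsup E (monos_le N n) X.
Proof.
move=> fB; have D0 : 0 <= \prod_(k < n.+1) nm (coef_dt f k).
  by apply: prodr_ge0 => k _; apply: normc_ge0.
apply: vsup_le => [|zs sz zE]; first by rewrite mulr_ge0 ?vsup_ge0.
rewrite (_ : nm _ = (\prod_(k < n.+1) nm (coef_dt f k)) * nm (vdet (monos_le N n) X zs)).
  by rewrite ler_wpM2l //; apply: vsup_ub => //; exists rho.
apply: (@complexI R); rewrite -normcE_norm (norm_vdet_hbasis fB sz) rmorphM rmorph_prod.
by [].
Qed.

Lemma vsup_hbasis_ge n (f : 'X_{1..N} -> {mpoly K[N]}) co : hbasis f co ->
  (\prod_(k < n.+1) nm (coef_dt f k)) * vsup E (monos_le N n) X <= vsup E (monos_le N n) f.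
Proof.
move=> fB; have : 0 <= \prod_(k < n.+1) nm (coef_dt f k).
  by apply: prodr_ge0 => k _; apply: normc_ge0.
rewrite le_eqVlt => /predU1P[<-|D0]; first by rewrite mul0r vsup_ge0.
rewrite mulrC -ler_pdivlMr //; apply: vsup_le => [|zs sz zE].
  by rewrite divr_ge0 ?vsup_ge0 // ltW.
rewrite ler_pdivlMr // mulrC.
rewrite (_ : _ * _ = nm (vdet (monos_le N n) f zs)); first by apply: vsup_ub => //; exists rho.
apply: (@complexI R); rewrite -normcE_norm (norm_vdet_hbasis fB sz) rmorphM rmorph_prod.
by [].
Qed.

End Rows.

Section Preimage.

Variables (R : realType) (N d : nat) (d0 : (0 < d)%N).
Local Notation K := R[i].
Local Notation nm := Normc.normc.
Local Notation X := (fun m : 'X_{1..N} => 'X_[m] : {mpoly K[N]}).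
Variables (a : 'X_{1..N} -> {mpoly K[N]}) (H F : 'I_N -> {mpoly K[N]}).
Variable co : {mpoly K[N]} -> 'X_{1..N} -> K.
Hypothesis ah : forall s, a s \is (mdeg s).-homog.
Hypothesis fB : hbasis (box_basis d a H) co.
Hypothesis Fd : forall j, (msize (F j) <= d.+1)%N.
Hypothesis HF : forall j, H j = pihomog mdeg d (F j).
Variables (E : set 'rV[K]_N) (rho : R).
Hypothesis rho1 : 1 <= rho.
Hypothesis Erho : forall z, E z -> forall i, nm (z ord0 i) <= rho.
Hypothesis Yb : exists rho' : R, forall z, E (polymap F z) -> forall i, nm (z ord0 i) <= rho'.

Local Notation Y := [set z | E (polymap F z)]%classic.
Local Notation box := (box_monos N d).
Local Notation Delta n := (\prod_(k < n.+1) nm (coef_dt (box_basis d a H) k)).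

Lemma ev_subst_by p z : ev (subst_by F p) z = ev p (polymap F z).
Proof. by rewrite /ev subst_by_eval; apply: meval_eq => j; rewrite mxE. Qed.

(** For each of the [d ^ N] box monomials [s], the rows [a_s p_c(F)] have [c] of degree up to a
    level between [n - N] and [n]; all levels are brought back to [n - N]. *)
Lemma vsup_preimage_le : exists2 A : R, 1 <= A & forall n, (N <= n)%N ->
  vsup Y (monos_le N (d * n)) X * Delta (d * n) <=
  (size (monos_le N (d * n)))`!%:R * A ^+ size (monos_le N (d * n)) *
  (2 ^+ size (monos_le N n) *
   (((size (monos_le N n))%:R * rho ^+ n) ^+ (size (monos_le N n) - size (monos_le N (n - N))) *
    vsup E (monos_le N (n - N)) X)) ^+ (d ^ N).
Proof.
have [A A1 AP] := ev_bounded_fin Yb box a; exists A => // n Nn.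
have Eb : exists r : R, forall z, E z -> forall i, nm (z ord0 i) <= r by exists rho.
have rho0 : 0 <= rho by apply: le_trans rho1.
have sm k : sorted <%O (monos_le N k) by rewrite lt_sorted_uniq_le monos_le_uniq monos_le_sorted.
have /choice[p /choice[t pt]] := fun k => chebyshev_polynomials Eb (sm k).
pose lv (s : 'X_{1..N}) := ((d * n - mdeg s) %/ d)%N.
have Ndn : (N * d <= d * n)%N by rewrite mulnC leq_mul2l Nn orbT.
(* Each level has its own family of monic polynomials, because the bound on the product of norms
   concerns the full list of that level. Beyond degree [d * n] the basis itself makes [g]
   unitriangular everywhere. *)
pose g (m : 'X_{1..N}) := if (mdeg m <= d * n)%N
  then a (mbox d m) * subst_by F (p (lv (mbox d m)) (mquo d m)) else box_basis d a F m.
pose u (m : 'X_{1..N}) := A * t (lv (mbox d m)) (mquo d m).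
have quo_lv (m : 'X_{1..N}) : (mdeg m <= d * n)%N -> (mdeg (mquo d m) <= lv (mbox d m))%N.
  move=> mn; rewrite leq_divRL // -mdegMn leq_subRL.
    by rewrite -mdegD -mbox_quo.
  by apply: leq_trans Ndn; apply/mdeg_box_monos/mbox_box.
have gE (m : 'X_{1..N}) : (mdeg m <= d * n)%N -> g m =
    \sum_(c <- monos_le N (lv (mbox d m))) (p (lv (mbox d m)) (mquo d m))@_c *:
      box_basis d a F (mbox d m + c *+ d)%MM.
  move=> mn; rewrite /g mn (subst_by_expand F (n := lv (mbox d m))); last first.
    have [pm _ _ _] := pt (lv (mbox d m)).
    by rewrite (monic_at_size (pm _ _)) ?mem_monos_le ?ltnS quo_lv.
  rewrite mulr_sumr; apply: eq_bigr => c _.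
  by rewrite box_basis_add ?mbox_box // scalerAr.
have uBF := unitriangular_box_basis d0 ah fB Fd HF.
have gU : unitriangular co g.
  move=> m m' mm; have [mn|mn] := leqP (mdeg m) (d * n); last first.
    by rewrite /g leqNgt mn uBF.
  have [pm _ _ _] := pt (lv (mbox d m)).
  have [p1 p0] : monic_at (p (lv (mbox d m)) (mquo d m)) (mquo d m).
    by apply: pm; rewrite mem_monos_le quo_lv.
  rewrite gE // (co_sum fB) (bigD1_seq (mquo d m)) ?monos_le_uniq ?mem_monos_le ?quo_lv //=.
  rewrite (coZ fB) p1 mul1r -mbox_quo uBF // big1 ?addr0 // => c cm; rewrite (coZ fB).
  have [lt_|] := ltP (mquo d m) c; first by rewrite p0 // mul0r.
  rewrite le_eqVlt (negPf cm) /= => lt_.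
  have l2 : ((mbox d m + c *+ d)%MM < m)%O by rewrite {2}(mbox_quo d m) ltmc_add2r ltmc_muln.
  by rewrite uBF ?(le_trans (ltW l2)) // lt_eqF ?mulr0 // (lt_le_trans l2).
have gs m : (msize (g m) <= (mdeg m).+1)%N.
  apply: (unitriangular_size fB) => [m' mm|].
    by rewrite gU ?ltW // lt_eqF.
  by exists (msize (g m) + mdeg m)%N; rewrite ?leq_addl // -addnS leq_addr.
have u0 m : 0 <= u m.
  by have [_ t0 _ _] := pt (lv (mbox d m)); rewrite mulr_ge0 ?t0 ?(le_trans ler01).
have gu : {in monos_le N (d * n), forall m, forall z, Y z -> nm (ev (g m) z) <= u m}.
  move=> m; rewrite mem_monos_le => mn z Yz; rewrite /g mn evM Normc.normcM.
  have [_ t0 tP _] := pt (lv (mbox d m)).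
  rewrite ler_pM ?normc_ge0 //; first by apply: AP; rewrite ?mbox_box.
  by rewrite ev_subst_by; apply: tP => //; rewrite mem_monos_le quo_lv.
rewrite mulrC; have [rho' Yrho] := Yb.
apply: le_trans (@vsup_hbasis_ge _ _ Y _ Yrho (d * n) _ _ fB) _.
apply: le_trans (@vsup_unitriangular_le _ _ Y _ _ _ _ _ fB gU gs gu u0) _.
rewrite -mulrA ler_wpM2l ?ler0n // /u big_split /= big_const_seq count_predT iter_mulr_1.
rewrite ler_wpM2l ?exprn_ge0 ?(le_trans ler01) //.
rewrite (perm_big _ (monos_le_box d0 Ndn)) big_allpairs_dep.
set W := (X in _ <= X ^+ _).
have -> : W ^+ (d ^ N) = \prod_(s <- box) W.
  by rewrite big_const_seq count_predT iter_mulr_1 size_box_monos.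
rewrite !big_seq; apply: ler_prod => s sb.
have lvn : (n - N <= lv s <= n)%N.
  have := mdeg_box_monos sb => sN; rewrite /lv leq_divRL // mulnBl.
  rewrite leq_sub ?(mulnC _ d) //=; last by rewrite mulnC.
  by rewrite -ltnS ltn_divLR // mulSn; lia.
have /andP[l1 l2] := lvn.
have [_ t0 tP tprod] := pt (lv s).
under eq_bigr => c _ do rewrite mbox_add // mquo_add //.
apply/andP; split; first by apply: prodr_ge0.
apply: le_trans tprod _.
have sle : (size (monos_le N (lv s)) <= size (monos_le N n))%N.
  by rewrite !size_monos_leE leq_bin2l // leq_add2l.
apply: ler_pM; rewrite ?exprn_ge0 ?vsup_ge0 //.
  by rewrite ler_weXn2l // ler1n.
apply: le_trans (vsup_monos_le rho1 Erho l1) _.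
rewrite ler_wpM2r ?vsup_ge0 //.
have b1 : 1 <= (size (monos_le N (lv s)))%:R * rho ^+ lv s.
  by rewrite mulr_ege1 ?exprn_ege1 // ler1n size_monos_leE bin_gt0 leq_addr.
apply: le_trans (_ : _ <= ((size (monos_le N (lv s)))%:R * rho ^+ lv s) ^+
  (size (monos_le N n) - size (monos_le N (n - N)))) _.
  by rewrite ler_weXn2l // leq_sub2r.
have m0 k : 0 <= (size (monos_le N k))%:R * rho ^+ k :> R.
  by rewrite mulr_ge0 ?ler0n ?exprn_ge0.
by apply: lerXn2r; rewrite ?nnegrE //; apply: ler_pM; rewrite ?ler0n ?exprn_ge0 ?ler_nat ?ler_weXn2l.
Qed.

End Preimage.

(** * Lower bound for the preimage *)

Lemma dt_scale_cols (K : comNzRingType) (T1 T2 : Type) (x1 : T1) (x2 : T2)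
    (r : seq T1) (l : seq T2) (c : T2 -> K) (M : T1 -> T2 -> K) : size r = size l ->
  dt x1 x2 r l (fun x y => c y * M x y) = (\prod_(y <- l) c y) * dt x1 x2 r l M.
Proof.
move=> rl; rewrite (big_nth x2) big_mkord -rl.
rewrite /dt; set A := (X in _ = _ * \det X).
have -> : \matrix_(i < size r, j < size r) (c (nth x2 l j) * M (nth x1 r i) (nth x2 l j)) =
    A *m diag_mx (\row_j c (nth x2 l j)).
  apply/matrixP => i j; rewrite mul_mx_diag !mxE; exact: mulrC.
rewrite det_mulmx det_diag mulrC; congr (_ * _).
by apply: eq_bigr => i _; rewrite mxE.
Qed.

Section KroneckerProduct.

Variables (K : numFieldType) (S T Z W : eqType) (s0 : S) (t0 : T) (z0 : Z).
Variables (b : seq S) (g : seq T) (ws : seq W) (w0 : W) (pts : nat -> seq Z).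
Variables (A : S -> Z -> K) (B : T -> W -> K) (pi : Z -> W).
Hypothesis bu : uniq b.
Hypothesis gws : size g = size ws.
Hypothesis spts : forall j, (j < size ws)%N -> size (pts j) = size b.
Hypothesis pi_pts : forall j, (j < size ws)%N -> {in pts j, forall z, pi z = nth w0 ws j}.

(* The matrix factors through the index set of pairs (row of the first factor,
   column of the second), block diagonally on both sides. *)
Lemma ndt_kronecker :
  `|dt (s0, t0) z0 [seq (s, t) | s <- b, t <- g]
      (flatten [seq pts j | j <- iota 0 (size ws)])
      (fun x z => A x.1 z * B x.2 (pi z))| =
  `|dt t0 w0 g ws B| ^+ size b *
  \prod_(j < size ws) `|dt s0 z0 b (pts j) A|.
Proof.
pose js := iota 0 (size ws).
pose l1 := [seq (s, j) | s <- b, j <- js].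
pose l2 := [seq (s, j) | j <- js, s <- b].
pose B' (x : S * T) (y : S * nat) := (x.1 == y.1)%:R * B x.2 (nth w0 ws y.2).
pose A' (y : S * nat) (jz : nat * Z) := (y.2 == jz.1)%:R * A y.1 jz.2.
pose cols := flatten [seq [seq (j, z) | z <- pts j] | j <- js].
have -> : flatten [seq pts j | j <- js] = map snd cols.
  rewrite map_flatten -map_comp; congr flatten; apply: eq_map => j /=.
  by rewrite -map_comp map_id.
have ujs : uniq js by apply: iota_uniq.
have sjs : size js = size ws by rewrite size_iota.
have jsP j : j \in js -> (j < size ws)%N by rewrite mem_iota.
pose rows := [seq (s, t) | s <- b, t <- g].
have srow : size rows = (size b * size ws)%N by rewrite size_allpairs gws.
have sl1 : size l1 = (size b * size ws)%N by rewrite size_allpairs sjs.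
have scol : size cols = (size b * size ws)%N.
  rewrite size_flatten /shape -map_comp mulnC.
  rewrite (eq_in_map _ (fun=> size b) js).1 => [|j /jsP j0 /=]; last by rewrite size_map spts.
  by rewrite sumnE big_map big_const_seq count_predT iter_addn_0 sjs mulnC.
rewrite -/rows -[X in dt _ _ X]map_id (dt_map _ _ (s0, t0) (0, z0)%N); last by rewrite srow scol.
rewrite (@eq_dt_in _ _ _ _ (s0, t0) _ (0, z0)%N _ _ _
    (fun x jz => \sum_(y <- l1) B' x y * A' y jz)); last 2 first.
- by rewrite srow scol.
- move=> _ _ /allpairsP[[s t] /= [sb tg ->]] /flattenP[_ /mapP[j jj ->] /mapP[z zj ->]] /=.
  rewrite big_allpairs (bigD1_seq s) //= [X in _ + X]big1 ?addr0 => [|s' ss]; last first.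
    by apply: big1 => j' _; rewrite /B' /= eq_sym (negPf ss) !mul0r.
  rewrite (bigD1_seq j) //= big1 ?addr0 => [|j' jj']; last first.
    by rewrite /A' /= (negPf jj') mul0r mulr0.
  by rewrite /B' /A' /= !eqxx !mul1r (pi_pts (jsP j jj)) // mulrC.
rewrite (dt_mul _ _ (s0, 0%N)) ?srow ?sl1 // normrM; congr (_ * _).
  rewrite dt_flatten // => [|s _|s s' _ _ ss x y /mapP[t _ ->] /mapP[j _ ->]].
  - rewrite big_seq (eq_bigr (fun=> dt t0 w0 g ws B)) => [|s sb].
      by rewrite -big_seq big_const_seq count_predT iter_mulr_1 normrX.
    rewrite (dt_map _ _ t0 0%N) ?sjs //.
    have wsE : ws = map (nth w0 ws) js by rewrite -/(mkseq _ _) mkseq_nth.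
    rewrite [in RHS]wsE -[g in RHS]map_id (dt_map _ _ t0 0%N) ?sjs //.
    by apply: eq_dt_in; rewrite ?sjs // => t j _ _; rewrite /B' /= eqxx mul1r.
  - by rewrite !size_map gws sjs.
  - by rewrite /B' /= (negPf ss) mul0r.
have pl : perm_eq l1 l2.
  apply: uniq_perm; try by apply: allpairs_uniq => // -[? ?] [? ?] _ _ /= [-> ->].
  move=> [s j]; apply/allpairsP/allpairsP => -[[x y] /= [xb yj [-> ->]]].
    by exists (y, x).
  by exists (y, x).
rewrite (ndt_perm _ _ _ _ pl) dt_flatten // => [|j jj|j j' _ _ jj x y /mapP[s _ ->] /mapP[z _ ->]].
- rewrite normr_prod -[js]/(iota 0 (size ws)) -{1}[size ws]subn0 -/(index_iota 0 (size ws)) big_mkord.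
  apply: eq_bigr => j _; rewrite (dt_map _ _ s0 z0) ?spts //; congr `|_|.
  by apply: eq_dt_in; rewrite ?spts // => s z _ _; rewrite /A' /= eqxx mul1r.
- by rewrite !size_map spts ?jsP.
- by rewrite /A' /= (negPf jj) mul0r.
Qed.

End KroneckerProduct.

Section PolynomialWeight.

Variables (R : realType) (N : nat).
Local Notation K := R[i].
Local Notation nm := Normc.normc.
Local Notation X := (fun m : 'X_{1..N} => 'X_[m] : {mpoly K[N]}).
Variables (E : set 'rV[K]_N) (rho : R).
Hypothesis rho1 : 1 <= rho.
Hypothesis Erho : forall z, E z -> forall i, nm (z ord0 i) <= rho.

(* Multiples of [Q] fill all but few rows of a unitriangular family, so weighting
   the Vandermonde determinant by [Q] loses little. *)
Lemma vsup_weighted_le (Q : {mpoly K[N]}) : Q != 0 ->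
  exists q (c : R), 1 <= c /\ forall n S, 0 <= S ->
  (forall ws, size ws = size (monos_le N n) -> points_in E ws ->
     nm (vdet (monos_le N n) X ws) * \prod_(w <- ws) nm (ev Q w) <= S) ->
  vsup E (monos_le N (n + q)) X <=
  ((size (monos_le N (n + q)))%:R * (c * rho ^+ (n + q))) ^+
    (size (monos_le N (n + q)) - size (monos_le N n)) *
  (c ^+ size (monos_le N n) * S).
Proof.
move=> Q0; pose l := mlead Q; pose k := (Q@_l)^-1.
have k0 : Q@_l != 0 by rewrite mleadc_eq0.
have Eb : exists r : R, forall z, E z -> forall i, nm (z ord0 i) <= r by exists rho.
have [c1 c10 c1P] := ev_bounded Eb Q.
pose c := 1 + nm k + nm k * c1; exists (mdeg l), c.
have nk0 : 0 <= nm k := normc_ge0 _.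
have c_1 : 1 <= c by rewrite /c -addrA lerDl addr_ge0 ?mulr_ge0.
split=> // n S S0 SP; set q := mdeg l.
pose g (m : 'X_{1..N}) := if (l <= m)%MM then (k *: Q) * 'X_[m - l] else X m.
have gm m : monic_at (g m) m.
  rewrite /g; case: ifP => [lm|_]; last exact: monic_at_mono.
  rewrite -[X in monic_at _ X](submK lm) addmC; apply: monic_atM; last exact: monic_at_mono.
  split=> [|m' mm']; rewrite mcoeffZ; first by rewrite mulVf.
  by rewrite mcoeff_gt_mlead ?mulr0.
have gU : unitriangular (fun (h : {mpoly K[N]}) m => h@_m) g.
  move=> m m'; rewrite le_eqVlt => /predU1P[<-|aa]; first by rewrite eqxx (gm m).1.
  by rewrite (gm m).2 // lt_eqF.
have gs m : (msize (g m) <= (mdeg m).+1)%N by rewrite (monic_at_size (gm m)).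
pose r1 := [seq m : 'X_{1..N} <- monos_le N (n + q) | ~~ (l <= m)%MM].
pose r2 := [seq (m + l)%MM | m <- monos_le N n].
have pr : perm_eq (monos_le N (n + q)) (r1 ++ r2).
  have h : perm_eq ([seq m : 'X_{1..N} <- monos_le N (n + q) | (l <= m)%MM] ++ r1)
      (monos_le N (n + q)) by rewrite perm_filterC.
  rewrite perm_sym perm_catC; apply: perm_trans h; rewrite perm_cat2r.
  apply: uniq_perm; rewrite ?filter_uniq ?monos_le_uniq //.
    by rewrite map_inj_uniq ?monos_le_uniq // => x y /(congr1 (fun m => m - l)%MM); rewrite !addmK.
  move=> m; rewrite [RHS]mem_filter mem_monos_le; apply/mapP/andP => [[x + ->]|[lm mn]].
    by rewrite mem_monos_le lem_addl mdegD leq_add2r.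
  exists (m - l)%MM; last by rewrite submK.
  by rewrite mem_monos_le -(leq_add2r q) -mdegD submK.
have s1 : size r1 = (size (monos_le N (n + q)) - size (monos_le N n))%N.
  by rewrite (perm_size pr) size_cat size_map addnK.
apply: le_trans (_ : vsup E (monos_le N (n + q)) g <= _).
  apply: vsup_le => [|zs sz zE]; first exact: vsup_ge0.
  by rewrite -(vdet_unitriangular (mono_hbasis K N) sz gU gs) vsup_ub.
have rX i : 0 <= rho ^+ i by rewrite exprn_ge0 // (le_trans ler01).
have cB : 0 <= c * rho ^+ (n + q) by rewrite mulr_ge0 // (le_trans ler01).
rewrite (vsup_perm _ _ pr) -s1 (perm_size pr).
apply: le_trans (vsup_cat_le Eb _ cB _) _.
  move=> m; rewrite mem_filter mem_monos_le => /andP[/negPf lm mn] z Ez.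
  rewrite /g lm -[leLHS]mul1r ler_pM ?normc_ge0 //.
  apply: le_trans (ev_mono_le _ rho1 (Erho Ez)) _; exact: ler_weXn2l.
apply: ler_wpM2l; first by rewrite exprn_ge0 // mulr_ge0 ?ler0n.
apply: vsup_le => [|ws]; first by rewrite mulr_ge0 // exprn_ge0 // (le_trans ler01).
rewrite size_map => sw wE.
have -> : vdet r2 g ws = k ^+ size (monos_le N n) *
    ((\prod_(w <- ws) ev Q w) * vdet (monos_le N n) X ws).
  have -> : k ^+ size (monos_le N n) = \prod_(w <- ws) k.
    by rewrite big_const_seq count_predT iter_mulr_1 sw.
  rewrite mulrA -big_split /= /vdet -dt_scale_cols ?sw // -[X in dt _ _ _ X]map_id.
  rewrite (dt_map _ _ 0%MM 0) ?sw //; apply: eq_dt_in; rewrite ?sw // => m z _ _.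
  by rewrite /g lem_addl addmK evM evZ.
rewrite Normc.normcM normcX; apply: ler_pM; rewrite ?exprn_ge0 ?normc_ge0 //.
  apply: lerXn2r; rewrite ?nnegrE //; first exact: le_trans ler01 c_1.
  by rewrite /c -addrA addrCA lerDl addr_ge0 ?mulr_ge0.
by rewrite Normc.normcM normc_prod mulrC; apply: SP.
Qed.

End PolynomialWeight.

Section PreimageLower.

Variables (R : realType) (N d : nat) (d0 : (0 < d)%N).
Local Notation K := R[i].
Local Notation nm := Normc.normc.
Local Notation X := (fun m : 'X_{1..N} => 'X_[m] : {mpoly K[N]}).
Variables (a : 'X_{1..N} -> {mpoly K[N]}) (H F : 'I_N -> {mpoly K[N]}).
Variable co : {mpoly K[N]} -> 'X_{1..N} -> K.
Hypothesis ah : forall s, a s \is (mdeg s).-homog.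
Hypothesis fB : hbasis (box_basis d a H) co.
Hypothesis Fd : forall j, (msize (F j) <= d.+1)%N.
Hypothesis HF : forall j, H j = pihomog mdeg d (F j).

Local Notation box := (box_monos N d).
Local Notation D := (d ^ N)%N.
Local Notation Delta n := (\prod_(k < n.+1) nm (coef_dt (box_basis d a H) k)).

Let b (k : 'I_D.-1.+1) := a (nth 0%MM box k).

Lemma box_sum_ord (G : 'X_{1..N} -> {mpoly K[N]}) :
  \sum_(s <- box) G s = \sum_(k < D.-1.+1) G (nth 0%MM box k).
Proof. by rewrite (big_nth 0%MM) big_mkord size_box_monos // prednK // expn_gt0 d0. Qed.

Let b_free (P : 'I_D.-1.+1 -> {mpoly K[N]}) :
  \sum_k subst_by F (P k) * b k = 0 -> forall k, P k = 0.
Proof.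
have lt_box (k : 'I_D.-1.+1) : (k < size box)%N.
  by rewrite size_box_monos // -[X in (_ < X)%N]prednK // expn_gt0 d0.
move=> E k; have := @box_free _ _ _ d0 a H F co ah fB Fd HF (fun s => P (inord (index s box))).
rewrite box_sum_ord; under eq_bigr => j _ do rewrite index_uniq ?box_monos_uniq ?inord_val //.
move=> /(_ E (nth 0%MM box k)); rewrite index_uniq ?box_monos_uniq ?inord_val //.
by apply; rewrite mem_nth.
Qed.

Let b_span h : exists P : 'I_D.-1.+1 -> {mpoly K[N]}, h = \sum_k subst_by F (P k) * b k.
Proof.
have [P E] := @box_span _ _ _ d0 a H F co ah fB Fd HF h.
by exists (fun k => P (nth 0%MM box k)); rewrite E box_sum_ord.
Qed.

Variables (E : set 'rV[K]_N) (rho : R).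
Hypothesis rho1 : 1 <= rho.
Hypothesis Erho : forall z, E z -> forall i, nm (z ord0 i) <= rho.
Local Notation Y := [set z | E (polymap F z)]%classic.

(** The coordinates of [z] are bounded by the entries of their multiplication matrices at [F(z)],
    which runs through the bounded set [E]. *)
Lemma preimage_bounded :
  exists rho' : R, forall z, E (polymap F z) -> forall i, nm (z ord0 i) <= rho'.
Proof.
have Eb : exists r : R, forall z, E z -> forall i, nm (z ord0 i) <= r by exists rho.
have [MX MXE] := mult_matrix b_span.
pose Ms := [seq MX 'X_x.1 x.2.1 x.2.2 | x : 'I_N * ('I_D.-1.+1 * 'I_D.-1.+1)].
have [c c1 cP] := ev_bounded_fin Eb Ms id.
exists (\sum_(s < D.-1.+1) \sum_(t < D.-1.+1) c) => z Ez i.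
rewrite -lecR -normcE_norm !rmorph_sum /=.
have := norm_le_mult_matrix b_span MXE 'X_i (fun j => z ord0 j).
rewrite mevalXU => /le_trans; apply; apply: ler_sum => s _.
apply: ler_sum => t _; rewrite normcE_norm lecR.
have := cP (MX 'X_i s t) _ _ Ez; rewrite /ev; move=> h; apply: le_trans (h _).
  by rewrite le_eqVlt; apply/orP; left; apply/eqP; congr nm; apply: meval_eq => j; rewrite mxE.
by apply/mapP; exists (i, (s, t)); rewrite ?mem_enum.
Qed.

(** From [det^2 = Qd] and the boundedness of [det] follows [|Qd| <= c |det|]. The power [D] of [Q]
    is chosen to match the power with which the determinant of the base points enters the Kronecker
    product. *)
Lemma fiber_determinant : exists (Q : {mpoly K[N]}) (C : R), [/\ Q != 0, 1 <= C &
  forall w, E w -> ev Q w != 0 -> exists p : seq 'rV[K]_N,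
    [/\ size p = size box, {in p, forall z, polymap F z = w} &
     nm (ev Q w) ^+ D <= C * nm (dt 0%MM 0 box p (fun s z => ev (a s) z))]].
Proof.
have D0 : (0 < D)%N by rewrite expn_gt0 d0.
have Eb : exists r : R, forall z, E z -> forall i, nm (z ord0 i) <= r by exists rho.
have [MX MXE] := mult_matrix b_span.
have [Q1 [Qd [Q10 Qd0 fib]]] := generic_fibers b_free b_span MXE.
have [c c1 cP] := ev_bounded_fin Eb [:: Q1; Qd] id.
have c0 : 0 <= c by apply: le_trans c1.
exists (Q1 * Qd), (c ^+ D * c ^+ D); split; first exact: mulf_neq0.
  by rewrite mulr_ege1 // exprn_ege1.
move=> w Ew; rewrite evM mulf_eq0 negb_or => /andP[w1 wd].
have [p [pF pd]] := fib (fun j => w ord0 j) w1.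
pose pt l := \row_j p l j : 'rV[K]_N.
exists [seq pt l | l <- enum 'I_D.-1.+1]; split.
- by rewrite size_map size_enum_ord size_box_monos // prednK.
- move=> z /mapP[l _ ->]; apply/rowP => j; rewrite mxE -[RHS](pF l).
  by apply: meval_eq => i; rewrite mxE.
set dd := dt _ _ _ _ _.
have ddE : dd = \det (\matrix_(l, t) (b t).@[p l]).
  rewrite /dd (dtE _ _ _ _ (_ : size box = D.-1.+1)); last first.
    by rewrite size_box_monos // prednK.
  rewrite -det_tr; congr (\det _); apply/matrixP => i j; rewrite !mxE.
  rewrite (nth_map ord0) ?size_enum_ord // nth_ord_enum /ev.
  by apply: meval_eq => k; rewrite mxE.
have dn0 : 0 <= nm dd := normc_ge0 _.
have dQ : nm dd ^+ 2 = nm (ev Qd w) by rewrite -normcX ddE pd.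
have Q1c : nm (ev Q1 w) <= c by apply: cP => //; rewrite inE eqxx.
have Qdc : nm (ev Qd w) <= c by apply: cP => //; rewrite !inE eqxx orbT.
have ddc : nm dd <= c.
  have [//|lt_] := leP (nm dd) c; have : c ^+ 2 < nm dd ^+ 2.
    by rewrite ltr_pXn2r ?nnegrE.
  rewrite dQ => /lt_le_trans/(_ Qdc); rewrite expr2 => cc.
  by have := ler_wpM2l c0 c1; rewrite mulr1 => /le_lt_trans/(_ cc); rewrite ltxx.
rewrite Normc.normcM exprMn -mulrA; apply: ler_pM; rewrite ?exprn_ge0 ?normc_ge0 //.
  by apply: lerXn2r; rewrite ?nnegrE ?normc_ge0.
rewrite -{1 2}(prednK D0) !exprSr -mulrA; apply: ler_pM; rewrite ?exprn_ge0 ?normc_ge0 //.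
  by apply: lerXn2r; rewrite ?nnegrE ?normc_ge0.
by rewrite -dQ expr2 ler_wpM2r.
Qed.

(** The indices [s + m *+ d] include all monomials of degree at most [d * n]; the surplus rows are
    discarded. *)
Lemma vsup_box_basis_le : exists2 c : R, 1 <= c & forall n,
  vsup Y [seq (s + m *+ d)%MM | s <- box, m <- monos_le N n] (box_basis d a F) <=
  ((D * size (monos_le N n))%:R * (c * rho ^+ n)) ^+
     (D * size (monos_le N n) - size (monos_le N (d * n))) *
  (Delta (d * n) * vsup Y (monos_le N (d * n)) X).
Proof.
have Yb := preimage_bounded.
have [c c1 cP] := ev_bounded_fin Yb box a; exists c => // n.
pose W := [seq (s + m *+ d)%MM | s <- box, m <- monos_le N n]; rewrite -/W; have c0 : 0 <= c by apply: le_trans c1.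
have Wu : uniq W.
  apply: allpairs_uniq => [||[s m] [s' m'] /allpairsP[[x y] /= [xb _ [-> ->]]]].
  - exact: box_monos_uniq.
  - exact: monos_le_uniq.
  - move=> /allpairsP[[x' y'] /= [xb' _ [-> ->]]] /= e.
    have := congr1 (mbox d) e; have := congr1 (mquo d) e.
    by rewrite !mbox_add // !mquo_add // => -> ->.
pose r := [seq m : 'X_{1..N} <- W | (d * n < mdeg m)%N].
have pr : perm_eq W (r ++ monos_le N (d * n)).
  have h : perm_eq (r ++ [seq m : 'X_{1..N} <- W | ~~ (d * n < mdeg m)%N]) W.
    by rewrite perm_filterC.
  rewrite perm_sym; apply: perm_trans h; rewrite perm_cat2l perm_sym.
  apply: uniq_perm; rewrite ?filter_uniq ?monos_le_uniq // => m.
  rewrite mem_filter mem_monos_le -leqNgt andb_idr // => mn.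
  apply/allpairsP; exists (mbox d m, mquo d m); rewrite /= mbox_box // mem_monos_le.
  split=> //; last exact: mbox_quo.
  rewrite -(leq_pmul2l d0); apply: leq_trans mn.
  by rewrite {2}(mbox_quo d m) mdegD mdegMn mulnC leq_addl.
have sW : size W = (D * size (monos_le N n))%N by rewrite size_allpairs size_box_monos.
have sr : size r = (D * size (monos_le N n) - size (monos_le N (d * n)))%N.
  by rewrite -sW (perm_size pr) size_cat addnK.
rewrite -sr -sW (vsup_perm _ _ pr) (perm_size pr).
have rX i : 0 <= rho ^+ i by rewrite exprn_ge0 // (le_trans ler01).
apply: le_trans (vsup_cat_le Yb _ (B := c * rho ^+ n) _ _) _.
- by rewrite mulr_ge0.
- move=> m; rewrite mem_filter => /andP[_ /allpairsP[[s t] /= [sb + ->]]] z Yz.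
  rewrite mem_monos_le => tn; rewrite box_basis_add // evM Normc.normcM.
  rewrite ler_pM ?normc_ge0 //; first exact: cP.
  rewrite -subst_by_mono ev_subst_by; apply: le_trans (ev_mono_le _ rho1 (Erho Yz)) _.
  exact: ler_weXn2l.
apply: ler_wpM2l; first by rewrite exprn_ge0 ?mulr_ge0.
have [rho' Yrho] := Yb.
apply: le_trans _ (@vsup_hbasis_le _ _ Y _ Yrho _ _ _ fB).
apply: vsup_le => [|zs sz zE]; first exact: vsup_ge0.
rewrite (vdet_unitriangular fB sz); first exact: vsup_ub.
  exact: (unitriangular_box_basis d0 ah fB Fd HF).
exact: (msize_box_basis d0 ah Fd HF).
Qed.

(** The Kronecker product over the fibres bounds the determinant of the base points weighted by [Q];
    [vsup_weighted_le] then removes the weight. *)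
Lemma vsup_preimage_ge : exists q (c : R), 1 <= c /\ forall n,
  vsup E (monos_le N (n + q)) X ^+ D <=
  (((size (monos_le N (n + q)))%:R * (c * rho ^+ (n + q))) ^+
    (size (monos_le N (n + q)) - size (monos_le N n)) * c ^+ size (monos_le N n)) ^+ D *
  (c ^+ size (monos_le N n) *
   ((D * size (monos_le N n))%:R * (c * rho ^+ n)) ^+
     (D * size (monos_le N n) - size (monos_le N (d * n))) *
   (Delta (d * n) * vsup Y (monos_le N (d * n)) X)).
Proof.
have D0 : (0 < D)%N by rewrite expn_gt0 d0.
have Yb := preimage_bounded.
have [Q [C [Q0 C1 fibP]]] := fiber_determinant.
have [q [c1 [c11 wP]]] := vsup_weighted_le rho1 Erho Q0.
have [c2 c21 bP] := vsup_box_basis_le.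
pose c := c1 * C * c2.
have [c10 C0 c20] : [/\ 0 <= c1, 0 <= C & 0 <= c2] by split; apply: le_trans ler01 _.
have c1c : c1 <= c by rewrite /c -mulrA ler_peMr // mulr_ege1.
have Cc : C <= c by rewrite /c mulrAC ler_peMl // mulr_ege1.
have c2c : c2 <= c by rewrite /c ler_peMl // mulr_ege1.
have c0 : 0 <= c by rewrite !mulr_ge0.
exists q, c; split=> [|n]; first exact: le_trans c11 c1c.
have rX i : 0 <= rho ^+ i by rewrite exprn_ge0 // (le_trans ler01).
set M := size (monos_le N n); set DV := Delta (d * n) * _.
have DV0 : 0 <= DV by rewrite mulr_ge0 ?vsup_ge0 // prodr_ge0 // => k _; apply: normc_ge0.
pose T := C ^+ M * (((D * M)%:R * (c2 * rho ^+ n)) ^+ (D * M - size (monos_le N (d * n))) * DV).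
have u0 e k j : 0 <= e -> 0 <= k%:R * (e * rho ^+ j).
  by move=> e0; rewrite mulr_ge0 // mulr_ge0.
have T0 : 0 <= T by apply: mulr_ge0; [|apply: mulr_ge0 => //]; apply: exprn_ge0 => //; apply: u0.
(* The Kronecker product bounds the [D]-th power of the weighted determinant, whence the root. *)
pose S := T `^ (D%:R^-1).
have SD : S ^+ D = T.
  by rewrite -powR_mulrn ?powR_ge0 // /S -powRrM mulVf ?pnatr_eq0 -?lt0n // powRr1.
have key ws : size ws = M -> points_in E ws ->
    nm (vdet (monos_le N n) X ws) * \prod_(w <- ws) nm (ev Q w) <= S.
  move=> sws wE; have S0 : 0 <= S by apply: powR_ge0.
  have P0 : 0 <= nm (vdet (monos_le N n) X ws) * \prod_(w <- ws) nm (ev Q w).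
    by rewrite mulr_ge0 ?normc_ge0 ?prodr_ge0 // => w _; apply: normc_ge0.
  rewrite -(ler_pXn2r D0) ?nnegrE // SD exprMn.
  (* If [Q] vanishes at a base point, the weighted determinant is zero and no fibre has to be
     chosen. *)
  have [/hasP[w ww /eqP Qw]|/hasPn Qw] := boolP (has (fun w => ev Q w == 0) ws).
    suff -> : \prod_(w <- ws) nm (ev Q w) = 0 by rewrite expr0n gtn_eqF // mulr0.
    by apply/eqP; rewrite prodf_seq_eq0; apply/hasP; exists w; rewrite //= Qw Normc.normc0.
  have /choice[pf pfP] : forall w, exists p : seq 'rV[K]_N, w \in ws ->
      [/\ size p = size box, {in p, forall z, polymap F z = w} &
       nm (ev Q w) ^+ D <= C * nm (dt 0%MM 0 box p (fun s z => ev (a s) z))].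
    move=> w.
    have [ww|nww] := boolP (w \in ws); last by exists [::].
    by have [p pP] := fibP w (wE w ww) (Qw w ww); exists p.
  pose pts j := pf (nth 0 ws j).
  have ptsP j : (j < size ws)%N -> nth 0 ws j \in ws by move=> h; apply: mem_nth.
  pose zs := flatten [seq pts j | j <- iota 0 (size ws)].
  pose W := [seq (s + m *+ d)%MM | s <- box, m <- monos_le N n].
  have szs : size zs = size W.
    rewrite size_flatten /shape -map_comp size_allpairs -/M -sws.
    rewrite (eq_in_map _ (fun=> size box) _).1 => [|j]; last first.
      by rewrite mem_iota /= => /ptsP/pfP[].
    by rewrite sumnE big_map big_const_seq count_predT iter_addn_0 size_iota.
  have zsY : points_in Y zs.
    move=> z /flattenP[_ /mapP[j + ->] zj]; rewrite mem_iota /= => /ptsP jw.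
    by have [_ /(_ z zj) /= e _] := pfP _ jw; rewrite /= e; apply: wE.
  have kr : nm (vdet W (box_basis d a F) zs) = nm (vdet (monos_le N n) X ws) ^+ D *
      \prod_(j < size ws) nm (dt 0%MM 0 box (pts j) (fun s z => ev (a s) z)).
    apply: (@complexI R); rewrite -normcE_norm rmorphM rmorphXn rmorph_prod /=.
    under eq_bigr => j _ do rewrite -normcE_norm.
    rewrite -normcE_norm -(size_box_monos N d).
    have /= <- := @ndt_kronecker _ _ _ _ _ 0%MM 0%MM (0 : 'rV[K]_N) box (monos_le N n) ws
      (0 : 'rV[K]_N) pts (fun s z => ev (a s) z) (fun m w => ev 'X_[m] w) (polymap F)
      (box_monos_uniq _ _) (esym sws) _ _; last 2 first.
    - by move=> j /ptsP/pfP[].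
    - by move=> j /ptsP/pfP[].
    rewrite /vdet /W -[X in dt _ _ _ X]map_id.
    have -> : [seq (s + m *+ d)%MM | s <- box, m <- monos_le N n] =
        map (fun x => (x.1 + x.2 *+ d)%MM) [seq (s, m) | s <- box, m <- monos_le N n].
      by rewrite map_allpairs.
    rewrite (dt_map _ _ (0%MM, 0%MM) 0); last by rewrite size_allpairs -/zs szs size_allpairs.
    congr `|_|; apply: eq_dt_in; first by rewrite size_allpairs -/zs szs size_allpairs.
    move=> _ z /allpairsP[[s t] /= [sb _ ->]] _ /=.
    by rewrite box_basis_add // evM -subst_by_mono ev_subst_by.
  have Wle : nm (vdet W (box_basis d a F) zs) <= vsup Y W (box_basis d a F) by apply: vsup_ub.
  apply: le_trans (_ : _ <= C ^+ M * nm (vdet W (box_basis d a F) zs)) _; last first.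
    by rewrite ler_wpM2l ?exprn_ge0 //; apply: le_trans Wle (bP n).
  rewrite kr mulrCA ler_wpM2l ?exprn_ge0 ?normc_ge0 // -sws -prodrXl.
  rewrite (big_nth 0) big_mkord -[X in C ^+ X]card_ord -prodr_const -big_split /=.
  apply: ler_prod => j _; rewrite exprn_ge0 ?normc_ge0 //=.
  by have /pfP[_ _ h] := ptsP j (ltn_ord j).
have := wP n S (powR_ge0 _ _) key; set A1 := (X in X * _) => h.
have A10 : 0 <= A1 by apply/exprn_ge0/u0.
have M0 e : 0 <= e -> 0 <= e ^+ M by move=> e0; apply: exprn_ge0.
have le_u e e' k j i : 0 <= e -> e <= e' ->
    (k%:R * (e * rho ^+ j)) ^+ i <= (k%:R * (e' * rho ^+ j)) ^+ i.
  move=> e0 ee; apply: lerXn2r; rewrite ?nnegrE ?u0 ?(le_trans e0) //.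
  by rewrite ler_wpM2l // ler_wpM2r.
apply: le_trans (_ : _ <= (A1 * (c1 ^+ M * S)) ^+ D) _.
  apply: lerXn2r; rewrite ?nnegrE ?vsup_ge0 //.
  by apply: mulr_ge0 => //; apply: mulr_ge0; [exact: M0|exact: powR_ge0].
rewrite mulrA exprMn SD -[c ^+ M * _ * DV]mulrA.
have cM : c1 ^+ M <= c ^+ M by apply: lerXn2r.
have CM : C ^+ M <= c ^+ M by apply: lerXn2r.
have A1c : A1 * c1 ^+ M <= ((size (monos_le N (n + q)))%:R * (c * rho ^+ (n + q))) ^+
    (size (monos_le N (n + q)) - M) * c ^+ M.
  by apply: ler_pM => //; [exact: M0|exact: le_u].
have A1M : 0 <= A1 * c1 ^+ M by apply: mulr_ge0 => //; apply: M0.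
apply: ler_pM => //; first exact: exprn_ge0.
  by apply: lerXn2r => //; rewrite nnegrE (le_trans A1M).
apply: ler_pM => //; first exact: M0.
  by apply: mulr_ge0 => //; apply/exprn_ge0/u0.
by apply: ler_wpM2r => //; apply: le_u.
Qed.

End PreimageLower.

Local Open Scope classical_set_scope.
Local Open Scope ring_scope.
Local Open Scope complex_scope.

(** * Limits *)

Section PowerLimits.

Variable R : realType.
Implicit Types (u t : nat -> R) (x y L : R).

(** Weighted mean inequality for [x] and 1, from [ln z <= z - 1] at [x / y] and [1 / y] with [y] the
    right-hand side. It remains useful when [x] is not bounded away from 0. *)
Lemma powR_amgm x (t : R) : 0 <= x -> 0 <= t <= 1 -> x `^ t <= t * x + (1 - t).
Proof.
move=> x0 /andP[t0 t1]; move: x0; rewrite le_eqVlt => /predU1P[<-|x0].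
  rewrite mulr0 add0r; have [->|tn] := eqVneq t 0; first by rewrite powRr0 subr0.
  by rewrite powR0 // subr_ge0.
have y0 : 0 < t * x + (1 - t).
  move: t0; rewrite le_eqVlt => /predU1P[<-|t0]; first by rewrite mul0r add0r subr0.
  by rewrite ltr_pwDl ?mulr_gt0 // subr_ge0.
set y := t * x + (1 - t) in y0 *.
rewrite /powR gt_eqF // -[leRHS]lnK ?posrE // ler_expR.
have l1 (z : R) : 0 < z -> ln z <= z - 1.
  by move=> z0; have := @le_ln1Dx R (z - 1); rewrite (_ : 1 + (z - 1) = z); [apply; lra|ring].
have h1 := l1 (x / y) (divr_gt0 x0 y0).
have h2 := l1 y^-1; rewrite invr_gt0 in h2; have {}h2 := h2 y0.
rewrite ln_div ?posrE // in h1; rewrite lnV ?posrE // in h2.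
have e : t * (x / y - 1) + (1 - t) * (y^-1 - 1) = 0.
  have : y * y^-1 = 1 by rewrite mulfV ?gt_eqF.
  by rewrite {1}/y => h; lra.
have t1' : 0 <= 1 - t by rewrite subr_ge0.
have := lerD (ler_wpM2l t0 h1) (ler_wpM2l t1' h2).
by rewrite e => h; lra.
Qed.

(** The limit 0 is included, since a transfinite diameter may vanish; there it matters that the
    exponents stay away from 0. *)
Lemma powR_cvg u t L (s : R) : (forall n, 0 <= u n) -> 0 < s ->
  u @ \oo --> L -> t @ \oo --> s -> (fun n => u n `^ t n) @ \oo --> L `^ s.
Proof.
move=> u0 s0 uL ts.
have : 0 <= L by apply: (cvgr_to_ge uL); apply: nearW.
rewrite le_eqVlt => /predU1P[L0|L0]; last first.
  rewrite [L `^ s]/powR gt_eqF //.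
  have h : (fun n => expR (t n * ln (u n))) @ \oo --> expR (s * ln L).
    apply: (@continuous_cvg _ _ _ _ _ (fun n => t n * ln (u n)) (@expR R)); first exact: continuous_expR.
    by apply: cvgM => //; apply: (@continuous_cvg _ _ _ _ _ u (@ln R)) => //; exact: continuous_ln.
  apply: cvg_trans h; apply: near_eq_cvg; near=> n.
  have un : 0 < u n by near: n; apply: (cvgr_gt _ uL).
  by rewrite /powR gt_eqF.
rewrite -L0 powR0 ?gt_eqF //; apply/cvgr0Pnorm_lt => e e0.
have s2 : 0 < s / 2 by rewrite divr_gt0.
pose del := Num.min 1 (e / 2) `^ (s / 2)^-1.
have m0 : 0 < Num.min 1 (e / 2) by rewrite lt_min ltr01 divr_gt0.
have del0 : 0 < del by apply: powR_gt0.
rewrite -L0 in uL; near=> n.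
have un1 : u n < del by near: n; apply: (cvgr_lt _ uL).
have tn : s / 2 <= t n.
  by near: n; apply: (cvgr_ge _ ts); rewrite ltr_pdivrMr // ltr_pMr // ltr1n.
rewrite ger0_norm ?powR_ge0 //; apply: (@le_lt_trans _ _ (e / 2)); last first.
  by rewrite ltr_pdivrMr // ltr_pMr // ltr1n.
have d1 : del <= 1.
  have := @ge0_ler_powR R (s / 2)^-1 _ (Num.min 1 (e / 2)) 1; rewrite powR1; apply.
  - by rewrite invr_ge0 ltW.
  - by rewrite nnegrE ltW.
  - by rewrite nnegrE.
  - by rewrite ge_min lexx.
apply: le_trans (_ : del `^ t n <= _).
  by apply: ge0_ler_powR; rewrite ?nnegrE ?u0 // ?ltW // (lt_le_trans s2).
apply: le_trans (@ger_powR R del _ _ _ tn) _; first by rewrite del0.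
rewrite /del -powRrM mulVf ?gt_eqF // powRr1; last exact: ltW.
by rewrite ge_min lexx orbT.
Unshelve. all: by end_near.
Qed.

Lemma bin_cvg (u : nat -> nat) x k : (fun n => (u n)%:R / n.+1%:R) @ \oo --> x ->
  (fun n => 'C(u n + k, k.+1)%:R / n.+1%:R ^+ k.+1) @ \oo --> x ^+ k.+1 / (k.+1)`!%:R.
Proof.
move=> ux; elim: k => [|k IH].
  under eq_fun do rewrite addn0 bin1 expr1.
  by rewrite expr1 divr1.
have inv0 : (fun n => n.+1%:R^-1 : R) @ \oo --> 0 by exact: cvg_harmonic.
have e : (fun n => 'C(u n + k.+1, k.+2)%:R / n.+1%:R ^+ k.+2) =
   (fun n => (((u n)%:R / n.+1%:R + k.+1%:R * n.+1%:R^-1) * ('C(u n + k, k.+1)%:R / n.+1%:R ^+ k.+1)) * k.+2%:R^-1 : R).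
  apply/funext => n; have /(congr1 (fun i => i%:R : R)) := mul_bin_diag (u n + k.+1) k.+1.
  rewrite addnS /= !natrM => h.
  have k2 : k.+2%:R != 0 :> R by rewrite pnatr_eq0.
  have n1 : n.+1%:R != 0 :> R by rewrite pnatr_eq0.
  apply: (mulfI k2); rewrite [LHS]mulrA -h -natr1 natrD [n.+1%:R ^+ k.+2]exprS invfM.
  by rewrite [RHS]mulrC -[RHS]mulrA mulVf // mulr1 -[k.+1%:R]natr1; ring.
rewrite e exprS factS natrM invfM.
have -> : x * x ^+ k.+1 * (k.+2%:R^-1 * (k.+1)`!%:R^-1) =
   (x + k.+1%:R * 0) * (x ^+ k.+1 / (k.+1)`!%:R) * k.+2%:R^-1 by ring.
apply: cvgM; last exact: cvg_cst.
apply: cvgM => //; apply: cvgD => //; apply: cvgM => //; exact: cvg_cst.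
Qed.

End PowerLimits.

(** * Losses negligible at the scale [n^(N+1)] *)

Section SubexponentialGrowth.

Variables (R : realType) (N : nat).
Hypothesis N0 : (0 < N)%N.
Implicit Types (x K : nat -> R) (k : nat -> nat).

(** The order of the logarithm of a factorial of [O(n^N)], the largest of the losses. *)
Definition log_growth (n : nat) : R := n.+1%:R ^+ N * (1 + ln n.+1%:R).

Definition subexp K := exists2 C, 0 <= C &
  forall n, (N <= n)%N -> 0 <= K n <= expR (C * log_growth n).

(** The cost of one discarded row; [O(n^(N-1))] such factors form a [subexp] loss. *)
Definition subgeom x := exists2 C, 0 <= C &
  forall n, (N <= n)%N -> 0 <= x n <= expR (C * n.+1%:R).

Lemma log_growth_ge n : n.+1%:R ^+ N <= log_growth n.
Proof. by rewrite ler_peMr ?exprn_ge0 // lerDl ln_ge0 // ler1n. Qed.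

Lemma log_growth_ge0 n : 0 <= log_growth n.
Proof. by apply: le_trans (log_growth_ge n); rewrite exprn_ge0. Qed.

Lemma subexpM K K' : subexp K -> subexp K' -> subexp (fun n => K n * K' n).
Proof.
move=> [C C0 h] [C' C0' h']; exists (C + C') => [|n Nn]; first exact: addr_ge0.
have /andP[k0 kC] := h n Nn; have /andP[k0' kC'] := h' n Nn.
by rewrite mulr_ge0 //= mulrDl expRD ler_pM.
Qed.

Lemma subexpX K j : subexp K -> subexp (fun n => K n ^+ j).
Proof.
move=> [C C0 h]; exists (C *+ j) => [|n Nn]; first exact: mulrn_wge0.
have /andP[k0 kC] := h n Nn; rewrite exprn_ge0 //=.
rewrite mulrnAl -mulr_natl expRM_natl; apply: lerXn2r => //; rewrite nnegrE //.
Qed.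

Lemma subgeomM x x' : subgeom x -> subgeom x' -> subgeom (fun n => x n * x' n).
Proof.
move=> [C C0 h] [C' C0' h']; exists (C + C') => [|n Nn]; first exact: addr_ge0.
have /andP[k0 kC] := h n Nn; have /andP[k0' kC'] := h' n Nn.
by rewrite mulr_ge0 //= mulrDl expRD ler_pM.
Qed.

Lemma le_expR (c : R) : c <= expR c.
Proof. by apply: le_trans (expR_ge1Dx c); rewrite lerDr. Qed.

Lemma subgeom_natr k c p : (forall n, (N <= n)%N -> (k n <= c * n.+1 ^ p)%N) ->
  subgeom (fun n => (k n)%:R).
Proof.
move=> kc; exists (c%:R + p%:R) => [|n Nn]; first by rewrite addr_ge0.
rewrite ler0n /=; apply: le_trans (_ : _ <= (c * n.+1 ^ p)%:R) _.
  by rewrite ler_nat kc.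
rewrite natrM natrX mulrDl expRD; apply: ler_pM; rewrite ?exprn_ge0 //.
  by apply: le_trans (le_expR _) _; rewrite ler_expR ler_peMr // ler1n.
by rewrite expRM_natl; apply: lerXn2r; rewrite ?nnegrE ?expR_ge0 ?le_expR.
Qed.

Lemma subgeom_cst (a : R) : 0 <= a -> subgeom (fun=> a).
Proof.
move=> a0; exists a => // n _; rewrite a0 /=; apply: le_trans (le_expR _) _.
by rewrite ler_expR ler_peMr // ler1n.
Qed.

Lemma subgeom_expn (a : R) k c : 0 <= a -> (forall n, (N <= n)%N -> (k n <= c * n.+1)%N) ->
  subgeom (fun n => a ^+ k n).
Proof.
move=> a0 kc; exists (a * c%:R) => [|n Nn]; first by rewrite mulr_ge0.
rewrite exprn_ge0 //=; apply: le_trans (_ : expR a ^+ k n <= _).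
  by apply: lerXn2r; rewrite ?nnegrE ?expR_ge0 ?le_expR.
rewrite -expRM_natl ler_expR mulrC -mulrA ler_wpM2l // -natrM ler_nat.
exact: kc.
Qed.

Lemma subexp_cst (a : R) k c : 0 <= a -> (forall n, (N <= n)%N -> (k n <= c * n.+1 ^ N)%N) ->
  subexp (fun n => a ^+ k n).
Proof.
move=> a0 kc; exists (a * c%:R) => [|n Nn]; first by rewrite mulr_ge0.
rewrite exprn_ge0 //=; apply: le_trans (_ : expR a ^+ k n <= _).
  by apply: lerXn2r; rewrite ?nnegrE ?expR_ge0 ?le_expR.
rewrite -expRM_natl ler_expR mulrC -mulrA ler_wpM2l //.
apply: le_trans (_ : (c * n.+1 ^ N)%:R <= _); first by rewrite ler_nat kc.
by rewrite natrM natrX ler_wpM2l // log_growth_ge.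
Qed.

Lemma subexp_expn x k c : subgeom x ->
  (forall n, (N <= n)%N -> (k n <= c * n.+1 ^ N.-1)%N) -> subexp (fun n => x n ^+ k n).
Proof.
move=> [C C0 h] kc; exists (C * c%:R) => [|n Nn]; first by rewrite mulr_ge0.
have /andP[x0 xC] := h n Nn; rewrite exprn_ge0 //=.
apply: le_trans (_ : expR (C * n.+1%:R) ^+ k n <= _).
  by apply: lerXn2r; rewrite ?nnegrE ?expR_ge0.
rewrite -expRM_natl ler_expR mulrC -!mulrA ler_wpM2l // mulrC.
apply: le_trans (_ : (c * n.+1 ^ N.-1)%:R * n.+1%:R <= _).
  by rewrite ler_wpM2r // ler_nat kc.
rewrite natrM natrX -mulrA ler_wpM2l // -exprSr prednK //; exact: log_growth_ge.
Qed.

Lemma leq_expn_base (m m' k : nat) : (m <= m')%N -> (m ^ k <= m' ^ k)%N.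
Proof. by case: k => // k h; rewrite leq_exp2r. Qed.

Lemma fact_le_expn (k : nat) : (k`! <= k ^ k)%N.
Proof.
elim: k => // k IH; rewrite factS expnS leq_mul2l /=; apply: leq_trans IH _.
exact: leq_expn_base.
Qed.

Lemma subexp_fact k c : (forall n, (N <= n)%N -> (k n <= c * n.+1 ^ N)%N) ->
  subexp (fun n => ((k n)`!)%:R).
Proof.
move=> kc; exists (c.+1%:R * (c%:R + N%:R)) => [|n Nn].
  by rewrite mulr_ge0 // addr_ge0.
rewrite ler0n /=; pose y : R := n.+1%:R.
apply: le_trans (_ : ((c.+1 * n.+1 ^ N) ^ k n)%:R <= _).
  rewrite ler_nat; apply: leq_trans (fact_le_expn _) _; apply: leq_expn_base.
  by apply: leq_trans (kc n Nn) _; rewrite leq_mul2r leqnSn orbT.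
have y1 : 1 <= y by rewrite ler1n.
have ly : 0 <= ln y by rewrite ln_ge0.
have -> : ((c.+1 * n.+1 ^ N) ^ k n)%:R = expR ((k n)%:R * (ln c.+1%:R + N%:R * ln y)).
  rewrite natrX expRM_natl expRD expRM_natl natrM natrX !lnK ?posrE //.
rewrite ler_expR /log_growth -/y.
apply: le_trans (_ : (c.+1%:R * y ^+ N) * (ln c.+1%:R + N%:R * ln y) <= _).
  rewrite ler_wpM2r ?addr_ge0 ?mulr_ge0 ?ln_ge0 ?ler1n // -natrX -natrM ler_nat.
  by apply: leq_trans (kc n Nn) _; rewrite leq_mul2r leqnSn orbT.
rewrite -!mulrA ler_wpM2l // mulrCA ler_wpM2l ?exprn_ge0 ?(le_trans ler01) //.
have lc : ln c.+1%:R <= c%:R :> R.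
  by rewrite -natr1 addrC le_ln1Dx // (lt_le_trans (ltrN10 _)).
have cN : 0 <= c%:R * ln y by rewrite mulr_ge0.
have NN : 0 <= N%:R :> R by [].
by rewrite mulrDr mulr1 mulrDl; lra.
Qed.

End SubexponentialGrowth.

Lemma cvg_squeeze0 (R : realType) (g h : nat -> R) :
  (\forall n \near \oo, 0 <= g n <= h n) -> h @ \oo --> 0 -> g @ \oo --> 0.
Proof. by move=> gh h0; apply: (squeeze_cvgr gh _ h0); apply: cvg_cst. Qed.

Section DegreeSum.

Variables (R : realType) (N : nat).
Hypothesis N0 : (0 < N)%N.

Definition degsum (n : nat) : R := (N * 'C(N + n, N.+1))%:R.

(** Leading coefficient of [degsum], a polynomial of degree [N.+1] in [n]. *)
Definition degsum_rate : R := N%:R / (N.+1)`!%:R.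

Lemma degsum_rate_gt0 : 0 < degsum_rate.
Proof. by rewrite divr_gt0 ?ltr0n ?fact_gt0. Qed.

Lemma degsum_gt0 n : (0 < n)%N -> 0 < degsum n.
Proof. by move=> n0; rewrite ltr0n muln_gt0 N0 bin_gt0 -addn1 leq_add2l. Qed.

Lemma degsum_cvg (u : nat -> nat) (x : R) : (fun n => (u n)%:R / n.+1%:R) @ \oo --> x ->
  (fun n => degsum (u n) / n.+1%:R ^+ N.+1) @ \oo --> degsum_rate * x ^+ N.+1.
Proof.
move=> ux0; have ux := @bin_cvg R u x N ux0.
have -> : (fun n => degsum (u n) / n.+1%:R ^+ N.+1) =
    (fun n => N%:R * ('C(u n + N, N.+1)%:R / n.+1%:R ^+ N.+1)).
  by apply/funext => n; rewrite /degsum natrM addnC mulrA.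
rewrite /degsum_rate mulrAC -mulrA; apply: cvgM => //; exact: cvg_cst.
Qed.

Lemma harmonic_cvg : (fun n => n.+1%:R^-1 : R) @ \oo --> 0.
Proof. exact: cvg_harmonic. Qed.

Lemma ratio_cvg (u : nat -> nat) (x c : R) :
  (\forall n \near \oo, `|(u n)%:R - x * n.+1%:R| <= c) ->
  (fun n => (u n)%:R / n.+1%:R) @ \oo --> x.
Proof.
move=> h; apply/subr_cvg0; apply: norm_cvg0.
have c0 : (fun n => c * n.+1%:R^-1) @ \oo --> 0.
  by rewrite -(mulr0 c); apply: cvgM; [exact: cvg_cst|exact: harmonic_cvg].
apply: (@cvg_squeeze0 R (fun n => `|(u n)%:R / n.+1%:R - x|) _ _ c0); near=> n.
rewrite normr_ge0 /=.
have n1 : n.+1%:R != 0 :> R by rewrite pnatr_eq0.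
have -> : (u n)%:R / n.+1%:R - x = ((u n)%:R - x * n.+1%:R) / n.+1%:R.
  by rewrite mulrBl mulfK.
rewrite normrM [X in _ * X]ger0_norm // ler_wpM2r //; near: n; exact: h.
Unshelve. all: by end_near.
Qed.

(** With [y = s ^+ 2] and [s >= 1], the bound [ln s <= s] gives [1 + ln y <= 3 * s], the origin of
    the constant 3. *)
Lemma log_growth_cvg : (fun n => log_growth R N n / n.+1%:R ^+ N.+1) @ \oo --> 0.
Proof.
have sq : (fun n => 3 * Num.sqrt (n.+1%:R^-1 : R)) @ \oo --> 0.
  rewrite -(mulr0 3); apply: cvgM; first exact: cvg_cst.
  rewrite -[X in _ --> X](@sqrtr0 R).
  by apply: continuous_cvg; [exact: sqrt_continuous|exact: harmonic_cvg].
apply: (@cvg_squeeze0 R _ _ _ sq); apply: nearW => n.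
rewrite divr_ge0 ?log_growth_ge0 ?exprn_ge0 //= /log_growth.
set y : R := n.+1%:R; have y0 : 0 < y by rewrite ltr0n.
have -> : y ^+ N * (1 + ln y) / y ^+ N.+1 = (1 + ln y) / y.
  rewrite exprS; have : y ^+ N != 0 by rewrite expf_neq0 // gt_eqF.
  by move: (y ^+ N) => z z0; field; rewrite z0 gt_eqF.
have s0 : 0 < Num.sqrt y by rewrite sqrtr_gt0.
rewrite sqrtrV ?(ltW y0) //; set s := Num.sqrt y in s0 *.
have sy : y = s ^+ 2 by rewrite sqr_sqrtr ?(ltW y0).
rewrite ler_pdivrMr // {2}sy expr2 mulrA mulfVK ?gt_eqF //.
rewrite sy lnXn // mulr2n; have := ln_sublinear s0.
have : 1 <= s by rewrite -[leLHS]sqrtr1 ler_wsqrtr // ler1n.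
lra.
Qed.


Lemma div_degsum_cvg (e : nat -> R) (u : nat -> nat) (l x : R) : 0 < x ->
  (fun n => e n / n.+1%:R ^+ N.+1) @ \oo --> l ->
  (fun n => (u n)%:R / n.+1%:R) @ \oo --> x ->
  (fun n => e n / degsum (u n)) @ \oo --> l / (degsum_rate * x ^+ N.+1).
Proof.
move=> x0 el /degsum_cvg ux.
have -> : (fun n => e n / degsum (u n)) =
    (fun n => (e n / n.+1%:R ^+ N.+1) / (degsum (u n) / n.+1%:R ^+ N.+1)).
  apply/funext => n; have : n.+1%:R ^+ N.+1 != 0 :> R by rewrite expf_neq0 // pnatr_eq0.
  move: (n.+1%:R ^+ N.+1) => z z0; rewrite [in RHS]invfM invrK mulrACA mulVf // mulr1 //.
apply: cvgM => //; apply: cvgV => //.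
by rewrite mulf_neq0 ?expf_neq0 ?gt_eqF ?degsum_rate_gt0.
Qed.

Lemma exp_log_growth_cvg (C : R) (u : nat -> nat) (x : R) : 0 < x ->
  (fun n => (u n)%:R / n.+1%:R) @ \oo --> x ->
  (fun n => expR (C * log_growth R N n / degsum (u n))) @ \oo --> (1 : R).
Proof.
move=> x0 ux; rewrite -(@expR0 R).
have h : (fun n => C * log_growth R N n / degsum (u n)) @ \oo --> 0.
  rewrite -(mul0r (degsum_rate * x ^+ N.+1)^-1); apply: div_degsum_cvg => //.
  under eq_fun do rewrite -mulrA.
  by rewrite -(mulr0 C); apply: cvgM; [exact: cvg_cst|exact: log_growth_cvg].
by apply: (@continuous_cvg _ _ _ _ _ _ (@expR R) 0 _ h); exact: continuous_expR.
Qed.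

Lemma ratio_id_cvg : (fun n : nat => n%:R / n.+1%:R) @ \oo --> (1 : R).
Proof.
apply: (@ratio_cvg (fun n => n) 1 1); apply: nearW => n.
by rewrite mul1r -natr1 opprD addrA subrr sub0r normrN normr1.
Qed.

(** * Existence of the limit *)

Section ZaharjutaLimit.

Variable w : nat -> R.
Hypothesis w0 : forall n, 0 <= w n.
Hypothesis wP : forall n m q, (0 < q)%N -> (q * (m + N) <= n)%N ->
  w n <= ('C(N + n, N)`!)%:R * (2 ^+ 'C(N + m, N) * w m) ^+ (q ^ N.+1).

Let B m := 2 ^+ 'C(N + m, N) * w m.
(** Limit of [q ^ N.+1 / degsum n] for [q = n %/ (m + N)]: the exponent of [B m] in the asymptotic
    bound on [x n]. *)
Let s m : R := (m + N)%:R^-1 ^+ N.+1 / degsum_rate.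
Let x n := w n `^ (degsum n)^-1.

Let B0 m : 0 <= B m.
Proof. by rewrite mulr_ge0 // exprn_ge0. Qed.

(** [wP] is applied with the largest admissible [q], and the factorial disappears in the limit. *)
Lemma root_bound m : exists2 h : nat -> R, h @ \oo --> B m `^ s m &
  \forall n \near \oo, x n <= h n.
Proof.
have mN : 0 < (m + N)%:R :> R by rewrite ltr0n addn_gt0 N0 orbT.
pose q n := (n %/ (m + N))%N.
have [C C0 CP] : subexp N (fun n => ('C(N + n, N)`!)%:R : R).
  apply: (@subexp_fact R N (fun n => 'C(N + n, N)) 1) => n _.
  by rewrite mul1n bin_le_expn.
have qc : (fun n => (q n)%:R / n.+1%:R : R) @ \oo --> ((m + N)%:R^-1 : R).
  apply: (@ratio_cvg q _ 1); apply: nearW => n.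
  have l : (n %% (m + N) < m + N)%N by rewrite ltn_pmod // addn_gt0 N0 orbT.
  have -> : (q n)%:R - (m + N)%:R^-1 * n.+1%:R = - ((n %% (m + N)).+1%:R / (m + N)%:R) :> R.
    rewrite {2}(divn_eq n (m + N)) -addnS [(_ * _ + _)%:R]natrD natrM mulrDr mulrCA mulVf ?gt_eqF // mulr1.
    by rewrite opprD addrA subrr add0r mulrC.
  by rewrite normrN ger0_norm ?divr_ge0 // ler_pdivrMr // mul1r ler_nat.
exists (fun n => expR (C * log_growth R N n / degsum n) * B m `^ ((q n ^ N.+1)%:R / degsum n)).
  rewrite -[X in _ --> X]mul1r; apply: cvgM.
    by apply: (exp_log_growth_cvg C ltr01); apply: ratio_id_cvg.
  apply: (@powR_cvg R (fun=> B m)) => //; last 1 first.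
  - have e1 : degsum_rate = degsum_rate * 1 ^+ N.+1 by rewrite expr1n mulr1.
    rewrite /s e1.
    apply: (@div_degsum_cvg _ (fun n => n)) => //; last exact: ratio_id_cvg.
    have -> : (fun n => (q n ^ N.+1)%:R / n.+1%:R ^+ N.+1) =
        (fun n => ((q n)%:R / n.+1%:R) ^+ N.+1 : R).
      by apply/funext => n; rewrite natrX -expr_div_n.
    by apply: (@continuous_cvg _ _ _ _ _ _ (fun y : R => y ^+ N.+1)) => //; exact: exprn_continuous.
  - by rewrite divr_gt0 ?degsum_rate_gt0 // exprn_gt0 // invr_gt0.
  - exact: cvg_cst.
near=> n.
have n0 : (m + N <= n)%N by near: n; exact: nbhs_infty_ge.
have q0 : (0 < q n)%N by rewrite divn_gt0 // addn_gt0 N0 orbT.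
have Nn : (N <= n)%N by apply: leq_trans n0; apply: leq_addl.
have D0 : 0 <= (degsum n)^-1 by rewrite invr_ge0 ler0n.
have := wP q0 (_ : q n * (m + N) <= n)%N; rewrite leq_divM => /(_ isT) h.
apply: le_trans (ge0_ler_powR D0 _ _ h) _; rewrite ?nnegrE //.
  by rewrite mulr_ge0 // exprn_ge0 //; exact: B0.
rewrite powRM ?ler0n //; last by rewrite exprn_ge0 //; exact: B0.
apply: ler_pM; rewrite ?powR_ge0 //.
  have /andP[_ h2] := CP n Nn; rewrite expRM.
  by apply: ge0_ler_powR; rewrite ?nnegrE ?expR_ge0.
by rewrite -powR_mulrn ?B0 // -powRrM.
Unshelve. all: by end_near.
Qed.

Lemma degsum_le m : degsum m <= degsum_rate * (m + N)%:R ^+ N.+1.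
Proof.
have f0 : 0 < (N.+1)`!%:R :> R by rewrite ltr0n fact_gt0.
rewrite /degsum /degsum_rate natrM -mulrA ler_wpM2l // mulrC ler_pdivlMr //.
rewrite -natrM -natrX ler_nat bin_ffact addnC.
elim: (N.+1) (m + N)%N => // k IH j; case: j => // j.
rewrite ffactSS expnS leq_mul2l /=; apply: leq_trans (IH j) _.
exact: leq_expn_base.
Qed.

(** Ratio of the exponent [s m] to [(degsum m)^-1]; it is at most 1 and tends to 1. *)
Let th m := degsum m * s m.

Let th1 m : 0 <= th m <= 1.
Proof.
have k0 := degsum_rate_gt0; have [mN|mN] := posnP (m + N)%N.
  by move: mN N0; lia.
have mN0 : 0 < (m + N)%:R ^+ N.+1 :> R by rewrite exprn_gt0 // ltr0n.
rewrite /th /s mulr_ge0 ?ler0n //=; last first.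
  by rewrite divr_ge0 ?exprn_ge0 // ltW.
by rewrite exprVn mulrA ler_pdivrMr // mul1r ler_pdivrMr // degsum_le.
Qed.

Let th_cvg : th @ \oo --> (1 : R).
Proof.
have k0 := degsum_rate_gt0.
have r1 : (fun n => (n + N)%:R / n.+1%:R) @ \oo --> (1 : R).
  apply: (@ratio_cvg (fun n => n + N)%N 1 N%:R); apply: nearW => n.
  have N1 : 1 <= N%:R :> R by rewrite ler1n.
  by rewrite mul1r natrD -natr1 opprD addrACA subrr add0r ler_norml; lra.
have r2 : (fun n => (n + N)%:R ^+ N.+1 / n.+1%:R ^+ N.+1) @ \oo --> (1 : R).
  have -> : (fun n => (n + N)%:R ^+ N.+1 / n.+1%:R ^+ N.+1) =
      (fun n => ((n + N)%:R / n.+1%:R) ^+ N.+1 : R).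
    by apply/funext => n; rewrite -expr_div_n.
  suff : (fun n => ((n + N)%:R / n.+1%:R) ^+ N.+1 : R) @ \oo --> (1 : R) ^+ N.+1 by rewrite expr1n.
  by apply: (@continuous_cvg _ _ _ _ _ _ (fun y : R => y ^+ N.+1)) => //; exact: exprn_continuous.
have r3 := degsum_cvg ratio_id_cvg; rewrite expr1n mulr1 in r3.
have -> : th = (fun n => (degsum n / n.+1%:R ^+ N.+1) *
    ((n + N)%:R ^+ N.+1 / n.+1%:R ^+ N.+1)^-1 / degsum_rate).
  apply/funext => n; rewrite /th /s exprVn.
  have z0 : (n + N)%:R ^+ N.+1 != 0 :> R by rewrite expf_neq0 // pnatr_eq0 addn_eq0 negb_and orbC -lt0n N0.
  have y0 : n.+1%:R ^+ N.+1 != 0 :> R by rewrite expf_neq0 // pnatr_eq0.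
  move: k0 z0 y0; move: (degsum n) (_ ^+ _) (_ ^+ _) degsum_rate => a z y k k0 z0 y0.
  by field; rewrite y0 z0 gt_eqF.
have e1 : degsum_rate * 1^-1 / degsum_rate = 1 by rewrite invr1 mulr1 divff // gt_eqF.
rewrite -[X in _ --> X]e1; apply: cvgM; last exact: cvg_cst.
by apply: cvgM; [exact: r3|exact: (cvgV (oner_neq0 R) r2)].
Qed.

Let c m : R := expR ('C(N + m, N)%:R / degsum m * ln 2).

Let c_cvg : c @ \oo --> (1 : R).
Proof.
rewrite -(@expR0 R).
have h : (fun m => 'C(N + m, N)%:R / degsum m * ln 2 : R) @ \oo --> 0.
  rewrite -(mul0r (ln 2)); apply: cvgM; last exact: cvg_cst.
  rewrite -(mul0r (degsum_rate * 1 ^+ N.+1)^-1).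
  apply: (@div_degsum_cvg _ (fun n => n)) => //; last exact: ratio_id_cvg.
  apply: (@cvg_squeeze0 R _ _ _ harmonic_cvg); apply: nearW => n.
  rewrite divr_ge0 ?exprn_ge0 //= ler_pdivrMr ?exprn_gt0 ?ltr0n //.
  by rewrite exprS mulKf ?pnatr_eq0 // -natrX ler_nat bin_le_expn.
by apply: (@continuous_cvg _ _ _ _ _ _ (@expR R) 0 _ h); exact: continuous_expR.
Qed.

(** The left-hand side is the power [th m] of [c m * x m]; the mean inequality replaces it by an
    affine bound that holds uniformly, even if [x] tends to 0. *)
Let g_le m : (0 < m)%N -> B m `^ s m <= c m * x m + (1 - th m).
Proof.
move=> m0; have D0 := degsum_gt0 m0; have := th1 m => /andP[t0 t1].
have cx : 0 <= c m * x m by rewrite mulr_ge0 ?expR_ge0 ?powR_ge0.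
have -> : B m `^ s m = (c m * x m) `^ th m.
  have -> : c m * x m = B m `^ (degsum m)^-1.
    rewrite /B powRM ?exprn_ge0 //; congr (_ * _).
    rewrite -powR_mulrn // -powRrM /c /powR gt_eqF //.
  by rewrite -powRrM /th mulrA mulVf ?mul1r // gt_eqF.
apply: le_trans (powR_amgm cx (th1 m)) _.
by rewrite lerD2r -[leRHS]mul1r ler_wpM2r.
Qed.

(** The limit is the infimum of the bounds [g m]: [root_bound] for a near-optimal [m] gives the
    estimate from above, and [g_le] at [n] itself the one from below. *)
Theorem zaharjuta_cvg : exists l : R, x @ \oo --> l.
Proof.
(* The index is shifted because [g_le] requires a positive degree. *)
pose g m := B m.+1 `^ s m.+1; pose A : set R := range g.
have A0 : A !=set0 by exists (g 0%N), 0%N.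
have lbA : has_lbound A by exists 0 => _ [m _ <-]; apply: powR_ge0.
exists (inf A); apply/cvgrPdist_le => e e0.
have e2 : 0 < e / 2 by rewrite divr_gt0.
have [_ [m _ <-] gm] := inf_adherent e2 (conj A0 lbA).
have [h hc xh] := root_bound m.+1.
have lowc : (fun n => (inf A - (1 - th n)) / c n) @ \oo --> inf A.
  have e1 : (inf A - (1 - 1)) / 1 = inf A by rewrite subrr subr0 divr1.
  rewrite -[X in _ --> X]e1; apply: cvgM; last exact: (cvgV (oner_neq0 R) c_cvg).
  by apply: cvgB; [exact: cvg_cst|apply: cvgB; [exact: cvg_cst|exact: th_cvg]].
near=> n.
have n0 : (0 < n)%N by near: n; exact: nbhs_infty_gt.
have up : x n <= inf A + e.
  apply: (@le_trans _ _ (h n)); first by near: n.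
  by near: n; apply: (cvgr_le _ hc); rewrite (lt_le_trans gm) // lerD2l; lra.
have lo : inf A - e <= x n.
  apply: (@le_trans _ _ ((inf A - (1 - th n)) / c n)).
    by near: n; apply: (cvgr_ge _ lowc); lra.
  rewrite ler_pdivrMr ?expR_gt0 // lerBlDr [x n * _]mulrC.
  apply: le_trans (g_le n0); apply: ge_inf => //.
  by exists n.-1; rewrite // /g prednK.
by rewrite ler_norml; lra.
Unshelve. all: by end_near.
Qed.

End ZaharjutaLimit.

End DegreeSum.

(** * Subexponential form of the comparison *)

Lemma size_monos_shift N n q : (size (monos_le N (n + q)) <= q.+1 ^ N * n.+1 ^ N)%N.
Proof.
apply: leq_trans (size_monos_le_le N _) _; rewrite -expnMn.
apply: leq_expn_base; nia.
Qed.

Lemma size_monos_dilate N d n : (0 < d)%N ->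
  (size (monos_le N (d * n)) <= d ^ N * n.+1 ^ N)%N.
Proof.
move=> d0; apply: leq_trans (size_monos_le_le N _) _; rewrite -expnMn.
apply: leq_expn_base; nia.
Qed.

Section MonomialCounts.

Variable N : nat.
Hypothesis N0 : (0 < N)%N.
Local Notation M n := (size (monos_le N n)).

Lemma size_monos_sub n j : (j <= n)%N -> (M n - M (n - j) <= j * n.+1 ^ N.-1)%N.
Proof.
elim: j => [|j IH] jn; first by rewrite subn0 subnn.
have [k kE] : exists k, (n - j = k.+1)%N by exists (n - j).-1; rewrite prednK // subn_gt0.
have e : (n - j.+1 = k)%N by rewrite subnS kE.
have := IH (ltnW jn); rewrite e kE (perm_size (monos_leS N k)) size_cat => h.
have := size_monos_eq_le k.+1 N0; rewrite mulSn => h2.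
have h3 : (k.+2 ^ N.-1 <= n.+1 ^ N.-1)%N by apply: leq_expn_base; rewrite -kE; lia.
rewrite leq_subLR in h; rewrite leq_subLR; apply: leq_trans h _.
by rewrite addnA leq_add2r addnC leq_add2l (leq_trans h2).
Qed.

Variable d : nat.
Hypothesis d0 : (0 < d)%N.

(** Since [mdeg s <= N * d], every box monomial leaves at least the level [n - N] to the
    quotient. *)
Lemma size_monos_mul n : (N <= n)%N -> (d ^ N * M (n - N) <= M (d * n))%N.
Proof.
move=> Nn; have Ndn : (N * d <= d * n)%N by rewrite mulnC leq_mul2l Nn orbT.
rewrite (perm_size (monos_le_box d0 Ndn)) size_allpairs_dep sumnE big_map.
rewrite -(size_box_monos N d) -sum1_size big_distrl /= !big_seq; apply: leq_sum => s sb.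
rewrite mul1n !size_monos_leE leq_bin2l // leq_add2l leq_divRL // mulnBl.
by rewrite [(n * d)%N]mulnC leq_sub // mulnC mulnC mdeg_box_monos.
Qed.

End MonomialCounts.

Section SubexponentialBounds.

Variables (R : realType) (N d : nat) (N0 : (0 < N)%N) (d0 : (0 < d)%N).
Local Notation K := R[i].
Local Notation nm := Normc.normc.
Local Notation X := (fun m : 'X_{1..N} => 'X_[m] : {mpoly K[N]}).
Variables (a : 'X_{1..N} -> {mpoly K[N]}) (H F : 'I_N -> {mpoly K[N]}).
Variable co : {mpoly K[N]} -> 'X_{1..N} -> K.
Hypothesis ah : forall s, a s \is (mdeg s).-homog.
Hypothesis fB : hbasis (box_basis d a H) co.
Hypothesis Fd : forall j, (msize (F j) <= d.+1)%N.
Hypothesis HF : forall j, H j = pihomog mdeg d (F j).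
Variables (E : set 'rV[K]_N) (rho : R).
Hypothesis rho1 : 1 <= rho.
Hypothesis Erho : forall z, E z -> forall i, nm (z ord0 i) <= rho.

Local Notation Y := [set z | E (polymap F z)]%classic.
Local Notation Delta n := (\prod_(k < n.+1) nm (coef_dt (box_basis d a H) k)).
Local Notation M n := (size (monos_le N n)).

Lemma vsup_preimage_upper : exists2 C : R, 0 <= C & forall n, (N <= n)%N ->
  vsup Y (monos_le N (d * n)) X * Delta (d * n) <=
  expR (C * log_growth R N n) * vsup E (monos_le N (n - N)) X ^+ (d ^ N).
Proof.
have Yb := preimage_bounded d0 ah fB Fd HF Erho.
have [A A1 AP] := vsup_preimage_le d0 ah fB Fd HF rho1 Erho Yb.
have rho0 : 0 <= rho by apply: le_trans rho1.
have [C C0 CP] : subexp N (fun n => ((M (d * n))`!%:R * A ^+ M (d * n)) *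
    (2 ^+ M n * ((M n)%:R * rho ^+ n) ^+ (M n - M (n - N))) ^+ (d ^ N)).
  apply: subexpM.
    apply: subexpM.
      by apply: (@subexp_fact _ _ _ (d ^ N)) => n _; apply: size_monos_dilate.
    by apply: (@subexp_cst _ _ _ _ (d ^ N)) => [|n _]; [exact: le_trans A1|apply: size_monos_dilate].
  apply/subexpX/subexpM.
    by apply: (@subexp_cst _ _ _ _ 1) => // n _; rewrite mul1n size_monos_le_le.
  apply: (@subexp_expn _ _ N0 _ _ N) => [|n Nn]; last exact: (size_monos_sub N0 Nn).
  apply: subgeomM; first by apply: (@subgeom_natr _ _ _ 1 N) => n _; rewrite mul1n size_monos_le_le.
  by apply: (@subgeom_expn _ _ _ _ 1) => // n _; rewrite mul1n.
exists C => // n Nn; apply: le_trans (AP n Nn) _.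
rewrite [2 ^+ _ * (_ * _)]mulrA.
rewrite exprMn mulrA ler_wpM2r ?exprn_ge0 ?vsup_ge0 //.
by have /andP[] := CP n Nn.
Qed.

Lemma vsup_preimage_lower : exists q (C : R), 0 <= C /\ forall n, (N <= n)%N ->
  vsup E (monos_le N (n + q)) X ^+ (d ^ N) <=
  expR (C * log_growth R N n) * (Delta (d * n) * vsup Y (monos_le N (d * n)) X).
Proof.
have [q [c [c1 cP]]] := vsup_preimage_ge d0 ah fB Fd HF rho1 Erho.
have rho0 : 0 <= rho by apply: le_trans rho1.
have c0 : 0 <= c by apply: le_trans c1.
have cM : subexp N (fun n => c ^+ M n).
  by apply: (@subexp_cst _ _ _ _ 1) => // n _; rewrite mul1n size_monos_le_le.
have [C C0 CP] : subexp N (fun n =>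
    (((M (n + q))%:R * (c * rho ^+ (n + q))) ^+ (M (n + q) - M n) * c ^+ M n) ^+ (d ^ N) *
    (c ^+ M n * ((d ^ N * M n)%:R * (c * rho ^+ n)) ^+ (d ^ N * M n - M (d * n)))).
  apply: subexpM.
    apply/subexpX/subexpM => //.
    apply: (@subexp_expn _ _ N0 _ _ (q * q.+1 ^ N.-1)) => [|n Nn]; last first.
      have := @size_monos_sub N N0 (n + q) q (leq_addl _ _); rewrite addnK => /leq_trans; apply.
      rewrite -mulnA leq_mul2l -expnMn; apply/orP; right; apply: leq_expn_base; nia.
    apply: subgeomM.
      by apply: (@subgeom_natr _ _ _ (q.+1 ^ N) N) => n _; apply: size_monos_shift.
    apply: subgeomM; first exact: subgeom_cst.
    by apply: (@subgeom_expn _ _ _ _ q.+1) => // n _; nia.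
  apply: subexpM => //.
  apply: (@subexp_expn _ _ N0 _ _ (d ^ N * N)) => [|n Nn]; last first.
    apply: leq_trans (leq_sub2l _ (size_monos_mul d0 Nn)) _.
    by rewrite -mulnBr -mulnA leq_mul2l size_monos_sub ?orbT.
  apply: subgeomM.
    apply: (@subgeom_natr _ _ _ (d ^ N) N) => n _.
    by rewrite leq_mul2l size_monos_le_le orbT.
  apply: subgeomM; first exact: subgeom_cst.
  by apply: (@subgeom_expn _ _ _ _ 1) => // n _; rewrite mul1n.
exists q, C; split=> // n Nn; apply: le_trans (cP n) _; rewrite mulrA.
rewrite ler_wpM2r //; last by have /andP[] := CP n Nn.
by rewrite mulr_ge0 ?vsup_ge0 // prodr_ge0 // => k _; apply: normc_ge0.
Qed.

End SubexponentialBounds.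

Section FeketeDiameter.

Variables (R : realType) (N : nat).
Local Notation K := R[i].
Local Notation nm := Normc.normc.
Local Notation X := (fun m : 'X_{1..N} => 'X_[m] : {mpoly K[N]}).
Implicit Types E : set 'rV[K]_N.

(** The two orderings of the monomials change the determinants only by a sign. *)
Lemma fekete_diamE E n :
  fekete_diam n E = vsup E (monos_le N n) X `^ (degsum R N n)^-1.
Proof.
pose T : finType := {: 'X_{1..N < n.+1}}.
pose r0 := [seq bmnm (enum_val i : 'X_{1..N < n.+1}) | i <- enum 'I_#|T|].
have sr0 : size r0 = #|T| by rewrite size_map size_enum_ord.
have pr : perm_eq r0 (monos_le N n).
  apply: uniq_perm; last 2 first.
  - exact: monos_le_uniq.
  - move=> m; rewrite mem_monos_le; apply/mapP/idP => [[i _ ->]|mn].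
      by rewrite -ltnS; exact: bmdeg.
    exists (enum_rank (BMultinom (mn : mdeg m < n.+1)%N)); rewrite ?mem_enum //.
    by rewrite enum_rankK.
  rewrite map_inj_uniq ?enum_uniq // => i j e.
  by apply: enum_val_inj; apply: val_inj.
have dE (zs : seq 'rV[K]_N) (zeta : 'I_#|T| -> 'rV[K]_N) :
    (forall j : 'I_#|T|, nth 0 zs j = zeta j) ->
    nm (monomial_det zeta) = nm (vdet (monos_le N n) X zs).
  move=> zsE; apply: (@complexI R); rewrite -!normcE_norm -(ndt_perm _ _ _ _ pr).
  rewrite (dtE _ _ _ _ sr0) /monomial_det; congr (`|\det _|).
  apply/matrixP => i j; rewrite !mxE zsE /ev.
  by rewrite (nth_map i) ?size_enum_ord // nth_ord_enum.
rewrite /fekete_diam; congr (sup _ `^ _); apply/seteqP; split => [x [zeta zE ->]|x [zs [sz zE ->]]].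
  exists [seq zeta j | j <- enum 'I_#|T|]; split.
  - by rewrite -(perm_size pr) sr0 size_map size_enum_ord.
  - by move=> z /mapP[j _ ->]; apply: zE.
  - by apply: dE => j; rewrite (nth_map j) ?size_enum_ord // nth_ord_enum.
have szT : size zs = #|T| by rewrite sz -(perm_size pr) sr0.
exists (fun j : 'I_#|T| => nth 0 zs j); last by rewrite (dE zs).
by move=> j; apply: zE; rewrite mem_nth // szT.
Qed.

Hypothesis N0 : (0 < N)%N.

(** The inequality required by [zaharjuta_cvg] holds after division by [rho] to the sum of the
    degrees; the [degsum]-th root of that factor is exactly [rho]. *)
Theorem fekete_diam_cvg E : bounded_CN E ->
  (fun n => fekete_diam n E) @ \oo --> transfinite_diam E.
Proof.
move=> /bounded_radius[rho rho1 Erho].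
have rho0 : 0 < rho by apply: lt_le_trans rho1.
pose w n := vsup E (monos_le N n) X / rho ^+ (\sum_(m <- monos_le N n) mdeg m).
have w0 n : 0 <= w n by rewrite divr_ge0 ?vsup_ge0 // exprn_ge0 // ltW.
have [|l lP] := @zaharjuta_cvg R N N0 w w0.
  by move=> n m q q0 qn; have := vsup_power_le rho1 Erho q0 qn; rewrite !size_monos_leE.
suff h : (fun n => fekete_diam n E) @ \oo --> rho * l.
  by rewrite /transfinite_diam (cvg_lim _ h).
have h : (fun n => rho * w n `^ (degsum R N n)^-1) @ \oo --> rho * l.
  by apply: cvgM => //; exact: cvg_cst.
apply: cvg_trans h; apply: near_eq_cvg; near=> n.
have n0 : (0 < n)%N by near: n; exact: nbhs_infty_gt.
have D0 := degsum_gt0 R N0 n0.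
rewrite fekete_diamE.
have -> : vsup E (monos_le N n) X = rho ^+ (\sum_(m <- monos_le N n) mdeg m) * w n.
  by rewrite /w mulrC mulfVK // expf_neq0 // gt_eqF.
rewrite sum_mdeg_monos_le // powRM ?exprn_ge0 ?(ltW rho0) //.
rewrite -powR_mulrn ?(ltW rho0) // -/(degsum R N n) -powRrM mulfV ?gt_eqF //.
by rewrite powRr1 // ltW.
Unshelve. all: by end_near.
Qed.

End FeketeDiameter.

(** * The contribution of the resultant *)

Section DeltaAsymptotics.

Variables (R : realType) (N d : nat) (N0 : (0 < N)%N) (d0 : (0 < d)%N).
Variables (b : nat -> R) (L C : R).
Hypothesis b0 : forall k, 0 < b k.
Hypothesis bL : forall k, `|ln (b k) - 'C(k %/ d + N.-1, N)%:R * L| <= C * k.+1%:R ^+ N.-1.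

(** The quotient is constant on blocks of [d] consecutive degrees, and the sum over blocks is the
    hockey-stick identity. *)
Lemma sum_bin_div n : (\sum_(0 <= k < d * n) 'C(k %/ d + N.-1, N) = d * 'C(n + N.-1, N.+1))%N.
Proof.
elim: n => [|n IH]; first by rewrite muln0 big_nil add0n bin_small ?muln0 // prednK.
rewrite (@big_cat_nat _ _ _ (d * n)) //=; last by rewrite leq_mul2l leqnSn orbT.
rewrite IH addSn binS mulnDr; congr (_ + _)%N.
rewrite big_nat (eq_bigr (fun=> 'C(n + N.-1, N))) => [|k /andP[k1 k2]]; last first.
  congr 'C(_ + _, _); apply/eqP; rewrite eqn_leq -ltnS ltn_divLR // leq_divRL //.
  by rewrite ![(_ * d)%N]mulnC k1 k2.
by rewrite -big_nat sum_nat_const_nat mulnS addnK mulnC.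
Qed.

Lemma ln_prod_cvg :
  (fun n => ln (\prod_(k < (d * n).+1) b k) / degsum R N (d * n)) @ \oo -->
  L / (N * d ^ N)%:R.
Proof.
have dR : 0 < d%:R :> R by rewrite ltr0n.
have NR : 0 < N%:R :> R by rewrite ltr0n.
have C0 : 0 <= C.
  by have := le_trans (normr_ge0 _) (bL 0%N); rewrite expr1n mulr1.
have dn : (fun n => (d * n)%:R / n.+1%:R) @ \oo --> (d%:R : R).
  apply: (@ratio_cvg R (fun n => d * n)%N _ d%:R); apply: nearW => n.
  by rewrite natrM -natr1 mulrDr mulr1 opprD addrA subrr add0r normrN ger0_norm.
have lnp n : ln (\prod_(k < n) b k) = \sum_(k < n) ln (b k).
  elim: n => [|n IH]; first by rewrite !big_ord0 ln1.
  by rewrite !big_ord_recr /= lnM ?IH // posrE // prodr_gt0.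
(* The first term collects the degrees below [d * n], the second the degree [d * n] itself. *)
pose S n := ((d * 'C(n + N.-1, N.+1))%:R + 'C(n + N.-1, N)%:R : R).
have SE n : S n = \sum_(k < (d * n).+1) 'C(k %/ d + N.-1, N)%:R.
  rewrite big_ord_recr /= -(big_mkord xpredT (fun k => 'C(k %/ d + N.-1, N)%:R)).
  by rewrite -natr_sum sum_bin_div mulKn.
have er n : `|ln (\prod_(k < (d * n).+1) b k) - S n * L| <= C * d%:R ^+ N * n.+1%:R ^+ N.
  rewrite lnp SE mulr_suml -sumrB; apply: le_trans (ler_norm_sum _ _ _) _.
  apply: le_trans (_ : _ <= \sum_(k < (d * n).+1) C * (d * n).+1%:R ^+ N.-1) _.
    apply: ler_sum => k _; apply: le_trans (bL k) _; rewrite ler_wpM2l //.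
    by apply: lerXn2r; rewrite ?nnegrE // ler_nat.
  rewrite sumr_const card_ord -[leLHS]mulr_natr -!mulrA ler_wpM2l // -exprSr prednK //.
  rewrite -exprMn -natrM; apply: lerXn2r; rewrite ?nnegrE // ler_nat; nia.
have e0 : (fun n => (ln (\prod_(k < (d * n).+1) b k) - S n * L) / n.+1%:R ^+ N.+1) @ \oo --> (0 : R).
  apply: norm_cvg0.
  have h : (fun n => C * d%:R ^+ N * n.+1%:R^-1) @ \oo --> (0 : R).
    by rewrite -(mulr0 (C * d%:R ^+ N)); apply: cvgM; [exact: cvg_cst|exact: harmonic_cvg].
  apply: (@cvg_squeeze0 R (fun n => `|(ln (\prod_(k < (d * n).+1) b k) - S n * L) / n.+1%:R ^+ N.+1|) _ _ h).
  apply: nearW => n; rewrite normr_ge0 /= normrM [X in _ * X]ger0_norm ?invr_ge0 ?exprn_ge0 //.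
  rewrite ler_pdivrMr ?exprn_gt0 ?ltr0n // exprS mulrA mulfVK ?pnatr_eq0 //; exact: er.
have Sl : (fun n => S n / n.+1%:R ^+ N.+1) @ \oo --> (d%:R / (N.+1)`!%:R : R).
  have u1 : (fun n => (n.-1)%:R / n.+1%:R) @ \oo --> (1 : R).
    apply: (@ratio_cvg R predn 1 2); apply: nearW => -[|n] /=.
      by rewrite mul1r sub0r normrN normr1 ler1n.
    by rewrite mul1r -[n.+2]addn2 natrD opprD addrA subrr sub0r normrN ger0_norm.
  have h1 := @bin_cvg R predn 1 N u1; rewrite expr1n in h1.
  have h2 : (fun n => 'C(n + N.-1, N)%:R / n.+1%:R ^+ N.+1) @ \oo --> (0 : R).
    have hc := @harmonic_cvg R; apply: (@cvg_squeeze0 R (fun n => 'C(n + N.-1, N)%:R / n.+1%:R ^+ N.+1) _ _ hc); apply: nearW => n.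
    rewrite divr_ge0 ?exprn_ge0 //= ler_pdivrMr ?exprn_gt0 ?ltr0n //.
    rewrite exprS mulKf ?pnatr_eq0 // -natrX ler_nat.
    apply: leq_trans (bin_le_expn N n); apply: leq_bin2l.
    by rewrite addnC leq_add2r leq_pred.
  have -> : (fun n => S n / n.+1%:R ^+ N.+1) = (fun n =>
      d%:R * ('C(n.-1 + N, N.+1)%:R / n.+1%:R ^+ N.+1) + 'C(n + N.-1, N)%:R / n.+1%:R ^+ N.+1).
    apply/funext => n; rewrite /S natrM mulrDl -mulrA; congr (_ * (_%:R / _) + _).
    case: n => [|n]; first by rewrite !bin_small // ?prednK.
    by congr 'C(_, _); rewrite /= -{2}(prednK N0) addnS addSn.
  rewrite -[X in _ --> X]addr0; apply: cvgD => //.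
  by rewrite mul1r in h1; apply: cvgM => //; exact: cvg_cst.
have fl : (fun n => ln (\prod_(k < (d * n).+1) b k) / n.+1%:R ^+ N.+1) @ \oo -->
    (d%:R / (N.+1)`!%:R * L : R).
  have -> : (fun n => ln (\prod_(k < (d * n).+1) b k) / n.+1%:R ^+ N.+1) = (fun n =>
      (ln (\prod_(k < (d * n).+1) b k) - S n * L) / n.+1%:R ^+ N.+1 + S n / n.+1%:R ^+ N.+1 * L).
    by apply/funext => n; rewrite mulrAC -mulrDl subrK.
  rewrite -[X in _ --> X]add0r; apply: cvgD => //; apply: cvgM => //; exact: cvg_cst.
have := div_degsum_cvg N0 dR fl dn.
suff -> : d%:R / (N.+1)`!%:R * L / (degsum_rate R N * d%:R ^+ N.+1) = L / (N * d ^ N)%:R by [].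
have f0 : (N.+1)`!%:R != 0 :> R by rewrite pnatr_eq0 -lt0n fact_gt0.
rewrite /degsum_rate natrM natrX exprS; have : d%:R ^+ N != 0 :> R by rewrite expf_neq0 // gt_eqF.
move: f0; move: (_ ^+ N) (_ `!%:R) => x y x0 y0; field.
by rewrite x0 y0 !gt_eqF.
Qed.

End DeltaAsymptotics.

(** * Passage to roots and limits *)

Section PowerComparison.

Variables (R : realType) (N d : nat) (N0 : (0 < N)%N) (d0 : (0 < d)%N).
Local Notation D := (degsum R N).

Lemma dilate_ratio_cvg : (fun n => (d * n)%:R / n.+1%:R) @ \oo --> (d%:R : R).
Proof.
apply: (@ratio_cvg R (fun n => d * n)%N _ d%:R); apply: nearW => n.
by rewrite natrM -natr1 mulrDr mulr1 opprD addrA subrr add0r normrN ger0_norm.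
Qed.

Lemma dilate_cvgny : (fun n => (d * n)%N) @ \oo --> \oo.
Proof.
apply/cvgnyPge => A; near=> n; apply: (@leq_trans n); first by near: n; exact: nbhs_infty_ge.
by rewrite leq_pmull.
Unshelve. all: by end_near.
Qed.

(** For [u n] within a bounded distance of [n], such as [n - N] or [n + q], the ratio of
    [d ^ N * D (u n)] to [D (d * n)] tends to [1 / d]. *)
Lemma degsum_power_cvg (v : nat -> R) (u : nat -> nat) (l c : R) :
  (forall n, 0 <= v n) -> (fun n => v n `^ (D n)^-1) @ \oo --> l ->
  (forall n, `|(u n)%:R - n.+1%:R| <= c) -> u @ \oo --> \oo ->
  (fun n => (v (u n) ^+ (d ^ N)) `^ (D (d * n))^-1) @ \oo --> l `^ d%:R^-1.
Proof.
move=> v0 vl uc uy; have dR : 0 < d%:R :> R by rewrite ltr0n.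
have k0 := degsum_rate_gt0 R N0.
have ur : (fun n => (u n)%:R / n.+1%:R) @ \oo --> (1 : R).
  by apply: (@ratio_cvg R u 1 c); apply: nearW => n; rewrite mul1r.
have tc : (fun n => ((d ^ N)%:R * D (u n)) / D (d * n)) @ \oo --> (d%:R^-1 : R).
  have h := degsum_cvg (N := N) ur; rewrite expr1n mulr1 in h.
  have h2 : (fun n => ((d ^ N)%:R * D (u n)) / n.+1%:R ^+ N.+1) @ \oo -->
      ((d ^ N)%:R * degsum_rate R N).
    under eq_fun do rewrite -mulrA.
    by apply: cvgM => //; exact: cvg_cst.
  have := div_degsum_cvg N0 dR h2 dilate_ratio_cvg.
  suff -> : (d ^ N)%:R * degsum_rate R N / (degsum_rate R N * d%:R ^+ N.+1) = d%:R^-1 by [].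
  rewrite natrX exprS; have : d%:R ^+ N != 0 :> R by rewrite expf_neq0 // gt_eqF.
  by move: (_ ^+ N) k0 => x k0 x0; field; rewrite x0 !gt_eqF.
have vu : (fun n => v (u n) `^ (D (u n))^-1) @ \oo --> l by apply: (cvg_comp _ _ uy vl).
have := powR_cvg (fun n => powR_ge0 _ _) (_ : 0 < d%:R^-1) vu tc.
rewrite invr_gt0 => /(_ dR) h; apply: cvg_trans h; apply: near_eq_cvg; near=> n.
have un : (0 < u n)%N by near: n; move/cvgnyPgt: uy; apply.
rewrite -powRrM mulrA mulrCA mulVf ?mulr1; last by rewrite gt_eqF // degsum_gt0.
by rewrite powRrM powR_mulrn.
Unshelve. all: by end_near.
Qed.

(** The inequalities concern multiples of [d] only, which suffices because the limit of the roots of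
    [w] is already known to exist. The roots of the losses tend to 1, so both bounds meet. *)
Lemma root_limit (v w Delta : nat -> R) (q : nat) (C C' lv lw la : R) :
  (forall n, 0 <= v n) -> (forall n, 0 <= w n) -> (forall n, 0 < Delta n) ->
  (fun n => v n `^ (D n)^-1) @ \oo --> lv ->
  (fun n => w n `^ (D n)^-1) @ \oo --> lw ->
  (fun n => ln (Delta n) / D (d * n)) @ \oo --> la ->
  (forall n, (N <= n)%N ->
    w (d * n)%N * Delta n <= expR (C * log_growth R N n) * v (n - N)%N ^+ (d ^ N)) ->
  (forall n, (N <= n)%N ->
    v (n + q)%N ^+ (d ^ N) <= expR (C' * log_growth R N n) * (Delta n * w (d * n)%N)) ->
  lw = expR (- la) * lv `^ d%:R^-1.
Proof.
move=> v0 w0 D0 vl wl Dl up lo; have dR : 0 < d%:R :> R by rewrite ltr0n.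
have wd : (fun n => w (d * n)%N `^ (D (d * n))^-1) @ \oo --> lw.
  exact: (cvg_comp _ _ dilate_cvgny wl).
have growth (c e : R) (f : nat -> R) : f @ \oo --> e ->
    (fun n => expR (c * log_growth R N n / D (d * n)) * expR (f n)) @ \oo --> expR e.
  move=> fe; rewrite -[X in _ --> X]mul1r; apply: cvgM.
    exact: exp_log_growth_cvg dR dilate_ratio_cvg.
  by apply: (@continuous_cvg _ _ _ _ _ f (@expR R)) => //; exact: continuous_expR.
have D1 n : 0 <= (D (d * n))^-1 by rewrite invr_ge0 ler0n.
have rootD n : expR (ln (Delta n) / D (d * n)) = Delta n `^ (D (d * n))^-1.
  by rewrite expRM lnK // posrE.
apply/eqP; rewrite eq_le; apply/andP; split.
  have vN : (fun n => (v (n - N)%N ^+ (d ^ N)) `^ (D (d * n))^-1) @ \oo --> lv `^ d%:R^-1.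
    apply: (@degsum_power_cvg v (fun n => n - N)%N lv N.+1%:R) => // [n|].
      rewrite distrC -natrB; last by rewrite (leq_trans (leq_subr _ _)).
      rewrite ger0_norm // ler_nat; lia.
    apply/cvgnyPge => A; near=> n; have : (A + N <= n)%N by near: n; exact: nbhs_infty_ge.
    lia.
  have Dl' : (fun n => - (ln (Delta n) / D (d * n))) @ \oo --> - la by apply: cvgN.
  have h : (fun n => expR (C * log_growth R N n / D (d * n)) *
      expR (- (ln (Delta n) / D (d * n))) * (v (n - N)%N ^+ (d ^ N)) `^ (D (d * n))^-1) @ \oo -->
      expR (- la) * lv `^ d%:R^-1.
    by apply: cvgM => //; apply: growth.
  apply: (ler_cvg_to wd h); near=> n.
  have Nn : (N <= n)%N by near: n; exact: nbhs_infty_ge.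
  rewrite expRN rootD mulrAC ler_pdivlMr ?powR_gt0 // -powRM ?(ltW (D0 n)) //.
  apply: le_trans (ge0_ler_powR (D1 n) _ _ (up n Nn)) _.
  - by rewrite nnegrE mulr_ge0 // ltW.
  - by rewrite nnegrE mulr_ge0 ?expR_ge0 // exprn_ge0.
  by rewrite powRM ?expR_ge0 ?exprn_ge0 // -expRM.
have vq : (fun n => (v (n + q)%N ^+ (d ^ N)) `^ (D (d * n))^-1) @ \oo --> lv `^ d%:R^-1.
  apply: (@degsum_power_cvg v (fun n => n + q)%N lv q.+1%:R) => // [n|].
    rewrite natrD -natr1 opprD addrACA subrr add0r.
    by rewrite (le_trans (ler_normB _ _)) // normr1 ger0_norm // natr1.
  apply/cvgnyPge => A; near=> n; have : (A <= n)%N by near: n; exact: nbhs_infty_ge.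
  lia.
rewrite expRN -ler_pdivlMl ?invr_gt0 ?expR_gt0 // invrK.
have h : (fun n => expR (C' * log_growth R N n / D (d * n)) *
    expR (ln (Delta n) / D (d * n)) * w (d * n)%N `^ (D (d * n))^-1) @ \oo --> expR la * lw.
  by apply: cvgM => //; apply: growth.
apply: (ler_cvg_to vq h); near=> n.
have Nn : (N <= n)%N by near: n; exact: nbhs_infty_ge.
apply: le_trans (ge0_ler_powR (D1 n) _ _ (lo n Nn)) _.
- by rewrite nnegrE exprn_ge0.
- by rewrite nnegrE !mulr_ge0 ?expR_ge0 // ltW.
by rewrite rootD !powRM ?expR_ge0 ?mulr_ge0 ?(ltW (D0 n)) // -expRM mulrA.
Unshelve. all: by end_near.
Qed.

End PowerComparison.

(** * Regular systems and conclusion *)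

Section RegularForms.

Variables (K : numFieldType) (N d : nat) (d0 : (0 < d)%N).
Implicit Types H : 'I_N -> {mpoly K[N]}.

Lemma homog_eval0 (p : {mpoly K[N]}) (v : 'I_N -> K) : p \is d.-homog ->
  (forall j, v j = 0) -> p.@[v] = 0.
Proof.
move=> ph v0; rewrite mevalE big_seq big1 // => m mp.
have : mdeg m != 0%N by rewrite (dhomogP _ _ _ ph m mp) -lt0n.
rewrite mdegE sum_nat_eq0 negb_forall => /existsP[j]; rewrite implyTb => mj.
by rewrite (bigD1 j) //= v0 expr0n (negPf mj) mul0r mulr0.
Qed.

(** In positive degree the origin is always a common zero, which gives the inclusion that
    [trivial_zeros] does not state. *)
Lemma regular_formsP H : (forall j, H j \is d.-homog) ->
  regular_forms H <-> trivial_zeros H.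
Proof.
move=> Hh; split=> [reg v Hv l|tz].
  have : (polymap H @^-1` [set 0]) (\row_j v j).
    apply/rowP => j; rewrite !mxE -[RHS](Hv j).
    by apply: meval_eq => i; rewrite mxE.
  by rewrite reg => /rowP/(_ l); rewrite !mxE.
apply/seteqP; split=> z /= => [/rowP Hz|->].
  by apply/rowP => l; rewrite mxE; apply: tz => j; have := Hz j; rewrite !mxE.
apply/rowP => j; rewrite !mxE; apply: (homog_eval0 (Hh j)) => i.
by rewrite mxE.
Qed.

End RegularForms.

Theorem theorem1p1 (R : realType) (N d : nat)
    (Res : {mpoly int[#|coef_index N d|]}) (F : 'I_N -> {mpoly R[i][N]})
    (E : set 'rV[R[i]]_N) :
  (0 < N)%N -> (0 < d)%N ->
  is_multiresultant R Res ->
  regular_map d F ->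
  bounded_CN E ->
  transfinite_diam (polymap F @^-1` E) =
    Normc.normc (eval_at_forms Res (leading_part d F))
      `^ (- (N * d ^ N)%:R^-1)
    * transfinite_diam E `^ d%:R^-1.

Proof.
move=> N0 d0 [irr Rzero Rone] [Fsize Freg] Ebd.
set H := leading_part d F in Freg *.
pose Rs : {mpoly R[i][#|coef_index N d|]} := map_mpoly intr Res.
have Hh j : H j \is d.-homog by apply: pihomogP.
have Rs_zero (G : 'I_N -> {mpoly R[i][N]}) : (forall j, G j \is d.-homog) ->
    Rs.@[form_coefs (d := d) G] != 0 <-> trivial_zeros G.
  by move=> Gh; rewrite -(regular_formsP d0 Gh); apply: Rzero.
have /(regular_formsP d0 Hh) Hz := Freg.
have [a [co [C [ah fB cn0 casym]]]] := det_asymptotics_all d0 irr Rs_zero Rone Hh Hz.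
have Fd j : (msize (F j) <= d.+1)%N by rewrite Fsize.
have [rho rho1 Erho] := bounded_radius Ebd.
have HF j : H j = pihomog mdeg d (F j) by [].
have Ybd : bounded_CN (polymap F @^-1` E) := preimage_bounded d0 ah fB Fd HF Erho.
have [Cu _ up] := vsup_preimage_upper N0 d0 ah fB Fd HF rho1 Erho.
have [q [Cl [_ lo]]] := vsup_preimage_lower N0 d0 ah fB Fd HF rho1 Erho.
have cvE := fekete_diam_cvg N0 Ebd; have cvY := fekete_diam_cvg N0 Ybd.
pose V (G : set 'rV[R[i]]_N) n :=
  vsup G (monos_le N n) (fun m : 'X_{1..N} => 'X_[m] : {mpoly R[i][N]}).
have feketeE G : (fun n => fekete_diam n G) = (fun n => V G n `^ (degsum R N n)^-1).
  by apply/funext => n; apply: fekete_diamE.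
rewrite !feketeE in cvE cvY.
have b0 k : 0 < Normc.normc (coef_dt (box_basis d a H) k) by rewrite normc_gt0.
have lnD := ln_prod_cvg N0 d0 b0 casym.
have V0 G n : 0 <= V G n by apply: vsup_ge0.
have D0 n : 0 < \prod_(k < (d * n).+1) Normc.normc (coef_dt (box_basis d a H) k).
  by apply: prodr_gt0 => k _.
rewrite (root_limit N0 d0 (V0 E) (V0 _) D0 cvE cvY lnD up lo); congr (_ * _).
(* [powR] treats base 0 separately, so rewriting the exponential of a logarithm as a power uses that
   the resultant does not vanish. *)
have r0 : Normc.normc (eval_at_forms Res H) != 0.
  by rewrite gt_eqF // normc_gt0; apply/(Rs_zero H Hh).
by rewrite /powR (negPf r0) mulNr mulrC.
Qed.
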